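(* Let $\varphi:F=\bigoplus_{i=1}^tR(b_i)\to G=\bigoplus_{j=1}^{t+2}R(a_j)$ be a graded minimal morphism between free $R$-modules of ranks $t$ and $t+2$ (so $c=3$) with $B_t=R/I_t(\varphi)$ standard determinantal, let $\ell=\sum_{j=1}^{t+2}a_j-\sum_{i=1}^tb_i$, and assume $\operatorname{depth}_JB_t\ge4$ where $J=I_{t-1}(\varphi)$. Then the normal module $N_{B_t}:=\operatorname{Hom}_R(I_t,B_t)\cong\operatorname{Ext}^1_R(I_t,I_t)$ has a minimal graded free $R$-resolution of the form $$0\to\textstyle\bigwedge^2F(-\ell)\to G\otimes F(-\ell)\to(F\otimes G^* )\oplus S_2G(-\ell)\to\big((F\otimes F^* )\oplus(G\otimes G^* )\big)/R\to G\otimes F^*\to N_{B_t}\to0,$$ where $\big((F\otimes F^* )\oplus(G\otimes G^* )\big)/R$ denotes the (free) quotient by the copy of $R$ generated by $(\mathrm{id}_F,\mathrm{id}_G)$ under $F\otimes F^*\cong\operatorname{End}(F)$, $G\otimes G^*\cong\operatorname{End}(G)$.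
   Context: $k$ is an algebraically closed field of characteristic $0$, $R=k[x_0,\dots,x_n]$ standard graded, $\mathfrak m=(x_0,\dots,x_n)$. A graded morphism $\varphi:F\to G$ of graded free $R$-modules is minimal if $\varphi(F)\subseteq\mathfrak mG$; $\varphi^*$ is the $R$-dual. $I_j(\varphi)$ is the ideal of $j\times j$ minors of a homogeneous matrix representing $\varphi$, $I_t:=I_t(\varphi)$, $B_t=R/I_t$; $B_t$ is standard determinantal if $\operatorname{depth}_{I_t(\varphi)}R=c$. $\operatorname{depth}_JN$ is the length of a maximal $N$-regular sequence in $J$ (with $J$ also viewed as an ideal of $B_t$). *)

(* Defs.v *)
From HB Require Import structures.
From mathcomp Require Import all_boot all_order all_algebra.
From mathcomp Require Import mpoly.
Set Implicit Arguments. Unset Strict Implicit. Unset Printing Implicit Defensive.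
Import Order.TTheory GRing.Theory Num.Theory.
Local Open Scope ring_scope.

Definition gen_ideal (R : comNzRingType) (I : finType) (g : I -> R) : R -> Prop :=
  fun p => exists c : I -> R, p = \sum_i c i * g i.

Definition ideal_add_seq (R : comNzRingType) (P : R -> Prop) (x : seq R) : R -> Prop :=
  fun p => exists q (c : 'I_(size x) -> R), P q /\ p = q + \sum_i c i * x`_i.

Definition regular_seq (R : comNzRingType) (P : R -> Prop) (x : seq R) : Prop :=
  (forall i : nat, (i < size x)%N ->
     forall r, ideal_add_seq P (take i x) (r * x`_i) -> ideal_add_seq P (take i x) r)
  /\ ~ ideal_add_seq P x 1.

Definition depth_ge (R : comNzRingType) (J P : R -> Prop) (d : nat) : Prop :=
  exists x : seq R, size x = d /\ (forall i, (i < size x)%N -> J x`_i) /\ regular_seq P x.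

Definition depth_eq (R : comNzRingType) (J P : R -> Prop) (d : nat) : Prop :=
  depth_ge J P d /\ ~ depth_ge J P d.+1.

Definition zero_ideal (R : comNzRingType) : R -> Prop := fun p => p = 0.

Definition minor (R : comNzRingType) (m p j : nat) (M : 'M[R]_(m, p))
  (fg : {ffun 'I_j -> 'I_m} * {ffun 'I_j -> 'I_p}) : R :=
  \det (\matrix_(u < j, v < j) M (fg.1 u) (fg.2 v)).

Definition minor_ideal (R : comNzRingType) (m p : nat) (M : 'M[R]_(m, p)) (j : nat) : R -> Prop :=
  gen_ideal (@minor R m p j M).

(* homogeneous of (integer) degree d, the zero polynomial being homogeneous of
   every degree *)
Definition homogz (k : closedFieldType) (n : nat) (d : int) (p : {mpoly k[n]}) : Prop :=
  match d with
  | Posz e => p \is e.-homog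
  | Negz _ => p = 0
  end.

Definition in_max_ideal (k : closedFieldType) (n : nat) (p : {mpoly k[n]}) : Prop :=
  p@_0%MM = 0.

(* A graded free module  (+)_i R(w_i)  is encoded by its list of twists w.
   A degree-0 graded morphism (+)_i R(u_i) -> (+)_j R(v_j) is a matrix (acting on
   column vectors) whose (j,i) entry is homogeneous of degree v_j - u_i. *)
Definition graded_mx (k : closedFieldType) (n : nat) (v u : seq int)
  (M : 'M[{mpoly k[n]}]_(size v, size u)) : Prop :=
  forall (j : 'I_(size v)) (i : 'I_(size u)), homogz (v`_j - u`_i) (M j i).

Definition minimal_mx (k : closedFieldType) (n : nat) (m p : nat)
  (M : 'M[{mpoly k[n]}]_(m, p)) : Prop :=
  forall j i, in_max_ideal (M j i).

Definition homog_vec (k : closedFieldType) (n : nat) (w : seq int) (d : int)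
  (v : 'cV[{mpoly k[n]}]_(size w)) : Prop :=
  forall i : 'I_(size w), homogz (d + w`_i) (v i 0).

(* An element of Hom_R(I, R/I) is represented by a function f : R -> R, of
   which only the values on I matter, modulo I. *)
Definition is_hom_I (R : comNzRingType) (I : R -> Prop) (f : R -> R) : Prop :=
  (forall p q, I p -> I q -> I (f (p + q) - (f p + f q))) /\
  (forall r p, I p -> I (f (r * p) - r * f p)).

Definition homog_hom (k : closedFieldType) (n : nat) (I : {mpoly k[n]} -> Prop)
  (d : int) (f : {mpoly k[n]} -> {mpoly k[n]}) : Prop :=
  forall (e : nat) p, I p -> p \is e.-homog ->
    exists q, homogz (e%:Z + d) q /\ I (f p - q).

(* Hom_R(I, R/I) has a minimal graded free resolution
     0 -> P5 -> P4 -> P3 -> P2 -> P1 -> Hom_R(I,R/I) -> 0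
   with Pi = (+) R(Li`_j).  eps : P1 -> Hom_R(I,R/I) is a degree-preserving
   R-linear surjection with kernel im d2 (i.e. a graded isomorphism
   coker d2 ~= Hom_R(I,R/I)). *)
Definition normal_module_min_res (k : closedFieldType) (n : nat)
  (I : {mpoly k[n]} -> Prop) (L1 L2 L3 L4 L5 : seq int) : Prop :=
  exists (d2 : 'M[{mpoly k[n]}]_(size L1, size L2))
         (d3 : 'M[{mpoly k[n]}]_(size L2, size L3))
         (d4 : 'M[{mpoly k[n]}]_(size L3, size L4))
         (d5 : 'M[{mpoly k[n]}]_(size L4, size L5))
         (eps : 'cV[{mpoly k[n]}]_(size L1) -> {mpoly k[n]} -> {mpoly k[n]}),
    [/\ graded_mx d2, graded_mx d3, graded_mx d4 & graded_mx d5] /\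
    [/\ minimal_mx d2, minimal_mx d3, minimal_mx d4 & minimal_mx d5] /\
    (forall v : 'cV_(size L5), d5 *m v = 0 -> v = 0) /\
    (forall v : 'cV_(size L4), d4 *m v = 0 <-> exists w : 'cV_(size L5), v = d5 *m w) /\
    (forall v : 'cV_(size L3), d3 *m v = 0 <-> exists w : 'cV_(size L4), v = d4 *m w) /\
    (forall v : 'cV_(size L2), d2 *m v = 0 <-> exists w : 'cV_(size L3), v = d3 *m w) /\
    (forall v, is_hom_I I (eps v)) /\
    (forall v w p, I p -> I (eps (v + w) p - (eps v p + eps w p))) /\
    (forall r v p, I p -> I (eps (r *: v) p - r * eps v p)) /\
    (forall v, (forall p, I p -> I (eps v p)) <-> exists w : 'cV_(size L2), v = d2 *m w) /\
    (forall f, is_hom_I I f -> exists v, forall p, I p -> I (eps v p - f p)) /\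
    (forall (d : int) v, homog_vec d v -> homog_hom I d (eps v)).

Section Twists.
Variables (t : nat) (a : 'I_t.+2 -> int) (b : 'I_t -> int).

Definition ell : int := \sum_j a j - \sum_i b i.

Definition tw1 : seq int := [seq a j - b i | j <- enum 'I_t.+2, i <- enum 'I_t].
(* ((F (x) F^dual) (+) (G (x) G^dual)) / R : one twist 0 removed *)
Definition tw2 : seq int :=
  rem 0 ([seq b i - b i' | i <- enum 'I_t, i' <- enum 'I_t]
         ++ [seq a j - a j' | j <- enum 'I_t.+2, j' <- enum 'I_t.+2]).
Definition tw3 : seq int :=
  [seq b i - a j | i <- enum 'I_t, j <- enum 'I_t.+2]
  ++ [seq a j + a j' - ell | j <- enum 'I_t.+2, j' <- filter (fun j' : 'I_t.+2 => (j <= j')%N) (enum 'I_t.+2)].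
Definition tw4 : seq int := [seq a j + b i - ell | j <- enum 'I_t.+2, i <- enum 'I_t].
Definition tw5 : seq int :=
  [seq b i + b i' - ell | i <- enum 'I_t, i' <- filter (fun i' : 'I_t => (i < i')%N) (enum 'I_t)].
End Twists.

(* Main.v *)
Require Import Defs.
From Stdlib Require Import FunctionalExtensionality PropExtensionality ClassicalEpsilon.
From HB Require Import structures.
From mathcomp Require Import all_boot all_order all_algebra perm ring zify.
From mathcomp Require Import mpoly.
Set Implicit Arguments. Unset Strict Implicit. Unset Printing Implicit Defensive.
Import GRing.Theory.
Local Open Scope ring_scope.

(* Let M = coker(phi^* : G^* -> F^* ), B = R/I_t, and let Om : G -> G^* be the alternating map
   g, g' |-> det[g | g' | phi]. The resolution consists of the maps
     Y |-> phi Y,  W |-> (- W^T Om, W phi^T + phi W^T),  (Z, S) |-> (Z phi, phi Z + S Om),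
     (A, D) |-> phi A - D phi.
   Exactness of the Buchsbaum-Rim complex F -> G -> G^* -> F^* (from grade I_t = 3) gives
   exactness at the three leftmost places, and exactness of the Eagon-Northcott complex.
   Exactness at the next place says End(M) = B, and the cokernel of the last map, which is
   coker(phi) (x) M, is compared with Hom(I_t, B) by differentiating minors. Both facts hold
   after inverting a (t-1)-minor, where M becomes isomorphic to B, and extend because a
   B-sequence y_1, ..., y_4 in I_(t-1) gives enough depth to M and to coker(phi) (x) M.
   That y_(s+1) is regular on M/(y_1, ..., y_s)M is deduced from regularity on B:
   Tor_(s+4)(B/(y_1, ..., y_(s+1)), M/(y_1, ..., y_s)M) vanishes for reasons of length, so the
   last map of the Eagon-Northcott complex is injective on the y_(s+1)-torsion, which is
   annihilated by I_t; McCoy's argument then shows that this torsion is zero. *)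

(** * Cramer's rule for the matrix [p | q | phi] *)

(** The maps are those of an endomorphism complex. A pair (A, D) with phi A = D phi is an
    endomorphism of the start F -> G of the Buchsbaum-Rim complex, and (Z, S), with Z : G -> F and S
    : G^* -> G, is a homotopy. For alternating K, Cramer's rule for [p | q | phi] provides a
    homotopy ([psiK K], K) from multiplication by [om K] to zero, which is why only symmetric S need
    to be kept. The same homotopies prove exactness of the Buchsbaum-Rim complex and show that I_t
    annihilates M. Splitting into symmetric and alternating parts requires 2 to be invertible. No
    localization is formed: what holds after inverting a minor is proved up to a power of it, and
    the power is cancelled by an element of I_(t-1) that is regular on the module in question. Four
    elements y_i occur because gluing a homomorphism I_t -> B needs y_1, y_2 regular on coker(phi)
    (x) M. Cancelling y_(s+1) there modulo y_1, ..., y_s needs every endomorphism of M/(y_1, ...,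
    y_(s+1))M to be a scalar, and this takes the next two elements; s = 1 leads to y_4. *)

Section Cramer.
Variables (R : comNzRingType).

Definition colset m n (j : 'I_n) (v : 'cV[R]_m) (A : 'M[R]_(m, n)) : 'M[R]_(m, n) :=
  \matrix_(i, l) if l == j then v i 0 else A i l.

Lemma colsetE m n (j : 'I_n) (v : 'cV[R]_m) (A : 'M[R]_(m, n)) :
  colset j v A = A + (v - col j A) *m delta_mx 0 j.
Proof.
apply/matrixP=> i l; rewrite !mxE big_ord1 !mxE eqxx /=.
by case: eqVneq => [->|_]; rewrite ?mulr1 ?mulr0 ?addr0 // addrCA subrr addr0.
Qed.

Lemma adj_mul_col n (A : 'M[R]_n) (v : 'cV_n) (j : 'I_n) :
  (\adj A *m v) j 0 = \det (colset j v A).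
Proof.
rewrite (expand_det_col _ j) mxE; apply: eq_bigr => i _.
rewrite !mxE eqxx mulrC; congr (_ * _); rewrite /cofactor; congr (_ * \det _).
by apply/matrixP=> a b; rewrite !mxE eq_sym (negPf (neq_lift _ _)).
Qed.

Lemma colset_id m n (j : 'I_n) (A : 'M[R]_(m, n)) : colset j (col j A) A = A.
Proof. by apply/matrixP=> i l; rewrite !mxE; case: eqP => [->|]. Qed.

Lemma colset_colset m n (j : 'I_n) (u v : 'cV_m) (A : 'M[R]_(m, n)) :
  colset j v (colset j u A) = colset j v A.
Proof. by apply/matrixP=> i l; rewrite !mxE; case: eqP. Qed.

Lemma det_eq_col n (A : 'M[R]_n) (i j : 'I_n) : i != j -> col i A = col j A -> \det A = 0.
Proof.
move=> nij eij; rewrite -det_tr; apply: (determinant_alternate nij) => l.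
by rewrite !mxE; move/matrixP/(_ l 0): eij; rewrite !mxE.
Qed.

Variable t : nat.
Implicit Types (p q u v : 'cV[R]_t.+2) (A : 'M[R]_(t.+2, t)).

(* The columns are indexed by [1 + 1 + t], which is convertible to [t.+2]. *)
Definition bordered p q A : 'M[R]_(t.+2, 1 + 1 + t) := row_mx (row_mx p q) A.
Definition bordered_det p q A : R := \det (bordered p q A : 'M_t.+2).
(** The rows of the adjugate that belong to the columns of [A]. The entry (i, j) is the derivative
    of [bordered_det p q A] with respect to [A j i], so the matrix serves both as a homotopy and as
    a gradient. *)
Definition bordered_adj p q A : 'M[R]_(t, t.+2) :=
  dsubmx (\adj (bordered p q A : 'M_t.+2) : 'M_(1 + 1 + t, t.+2)).
(** For [A = phi] and distinct basis vectors [u], [p], [q] this is, up to sign, the (t-1)-minor of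
    [phi] that omits column i and the three corresponding rows. Being alternating in [u], [p], [q],
    it gives access to these minors without bookkeeping of rows and signs. *)
Definition tau (i : 'I_t) u p q A : R := bordered_det p q (colset i u A).

Let c0 : 'I_t.+2 := lshift t (lshift 1 (0 : 'I_1)).
Let c1 : 'I_t.+2 := lshift t (rshift 1 (0 : 'I_1)).
Let c2 (i : 'I_t) : 'I_t.+2 := rshift (1 + 1) i.

Lemma c_ind (P : 'I_t.+2 -> Prop) : P c0 -> P c1 -> (forall i, P (c2 i)) -> forall l, P l.
Proof.
move=> P0 P1 P2 l; rewrite -[l](@splitK (1 + 1) t).
case: (@split (1 + 1) t l) => [l'|l'] /=; last exact: P2.
by rewrite -[l'](@splitK 1 1); case: (@split 1 1 l') => k /=; rewrite (ord1 k).
Qed.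

Lemma bm0 p q A i : bordered p q A i c0 = p i 0.
Proof. by rewrite /bordered (@row_mxEl _ _ (1 + 1)) (@row_mxEl _ _ 1). Qed.
Lemma bm1 p q A i : bordered p q A i c1 = q i 0.
Proof. by rewrite /bordered (@row_mxEl _ _ (1 + 1)) (@row_mxEr _ _ 1). Qed.
Lemma bm2 p q A i j : bordered p q A i (c2 j) = A i j.
Proof. by rewrite /bordered (@row_mxEr _ _ (1 + 1)). Qed.

Let n01 : (c0 == c1) = false. Proof. by []. Qed.
Let n02 i : (c0 == c2 i) = false. Proof. by []. Qed.
Let n12 i : (c1 == c2 i) = false. Proof. by []. Qed.
Let n22 i j : (c2 i == c2 j) = (i == j). Proof. exact: (inj_eq (@rshift_inj (1 + 1) t)). Qed.

Lemma bmset0 p q v A : colset c0 v (bordered p q A : 'M_t.+2) = bordered v q A.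
Proof.
apply/matrixP=> i l; rewrite mxE; elim/c_ind: l => [||l].
- by rewrite eqxx bm0.
- by rewrite eq_sym n01 !bm1.
- by rewrite eq_sym n02 !bm2.
Qed.

Lemma bmset1 p q v A : colset c1 v (bordered p q A : 'M_t.+2) = bordered p v A.
Proof.
apply/matrixP=> i l; rewrite mxE; elim/c_ind: l => [||l].
- by rewrite n01 !bm0.
- by rewrite eqxx bm1.
- by rewrite eq_sym n12 !bm2.
Qed.

Lemma bmset2 p q v A i : colset (c2 i) v (bordered p q A : 'M_t.+2) = bordered p q (colset i v A).
Proof.
apply/matrixP=> j l; rewrite mxE; elim/c_ind: l => [||l].
- by rewrite n02 !bm0.
- by rewrite n12 !bm1.
- by rewrite n22 !bm2 mxE.
Qed.

Lemma bm_sum p q A (F : 'I_t.+2 -> R) (c : 'I_t.+2) :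
  \sum_l bordered p q A c l * F l
  = p c 0 * F c0 + q c 0 * F c1 + \sum_i A c i * F (c2 i).
Proof.
rewrite (@big_split_ord _ _ _ (1 + 1) t) /= (@big_split_ord _ _ _ 1 1) /= !big_ord1.
by rewrite bm0 bm1; congr (_ + _); apply: eq_bigr => i _; congr (_ * _); exact: bm2.
Qed.

Lemma bpsi_tau p q v A i : (bordered_adj p q A *m v) i 0 = tau i v p q A.
Proof.
rewrite /tau /bordered_det -bmset2 -adj_mul_col /bordered_adj !mxE; apply: eq_bigr => k _.
by rewrite mxE.
Qed.

Lemma bpsi_col p q A k : bordered_adj p q A *m col k (bordered p q A : 'M_t.+2)
   = \col_i (bordered_det p q A *+ (c2 i == k)).
Proof.
apply/matrixP=> i j; rewrite (ord1 j) [RHS]mxE.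
have /matrixP/(_ (c2 i) k) := mul_adj_mx (bordered p q A : 'M_t.+2).
rewrite [RHS]mxE -/(bordered_det p q A) => <-.
by rewrite !mxE; apply: eq_bigr => l _; rewrite !mxE.
Qed.

Lemma bm_col0 p q A : col c0 (bordered p q A : 'M_t.+2) = p.
Proof. by apply/matrixP=> k l; rewrite mxE bm0 (ord1 l). Qed.
Lemma bm_col1 p q A : col c1 (bordered p q A : 'M_t.+2) = q.
Proof. by apply/matrixP=> k l; rewrite mxE bm1 (ord1 l). Qed.
Lemma bm_col2 p q A i : col (c2 i) (bordered p q A : 'M_t.+2) = col i A.
Proof. by apply/matrixP=> k l; rewrite [LHS]mxE bm2 [RHS]mxE. Qed.

Lemma bpsi_mul p q A : bordered_adj p q A *m A = (bordered_det p q A)%:M.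
Proof.
apply/matrixP=> i j; have e := bpsi_col p q A (c2 j).
rewrite bm_col2 colE mulmxA -colE in e; transitivity (col j (bordered_adj p q A *m A) i 0).
  by rewrite [RHS]mxE.
by rewrite e [LHS]mxE n22 [RHS]mxE.
Qed.

Lemma bpsi_p p q A : bordered_adj p q A *m p = 0.
Proof.
have := bpsi_col p q A c0; rewrite bm_col0 => ->.
by apply/matrixP=> i j; rewrite !mxE.
Qed.

Lemma bpsi_q p q A : bordered_adj p q A *m q = 0.
Proof.
have := bpsi_col p q A c1; rewrite bm_col1 => ->.
by apply/matrixP=> i j; rewrite !mxE.
Qed.

Lemma bdet_pp p A : bordered_det p p A = 0.
Proof.
by apply: (@det_eq_col _ _ c0 c1) => //; rewrite bm_col0 bm_col1.
Qed.

(** The vector [p] is a dummy: the cofactors along the first column do not see it. Linearity in that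
    column follows. *)
Lemma bdet_adj0 p v q A : bordered_det v q A = (\adj (bordered p q A : 'M_t.+2) *m v) c0 0.
Proof. by rewrite adj_mul_col bmset0. Qed.

Lemma bdet_adj1 p v q A : bordered_det p v A = (\adj (bordered p q A : 'M_t.+2) *m v) c1 0.
Proof. by rewrite adj_mul_col bmset1. Qed.

Lemma bdet_lin1 q A a p p' : bordered_det (a *: p + p') q A = a * bordered_det p q A + bordered_det p' q A.
Proof. by rewrite !(bdet_adj0 0) mulmxDr -scalemxAr !mxE. Qed.

Lemma bdet_lin2 p A a q q' : bordered_det p (a *: q + q') A = a * bordered_det p q A + bordered_det p q' A.
Proof. by rewrite !(bdet_adj1 p _ 0) mulmxDr -scalemxAr !mxE. Qed.

Lemma bdet_swap p q A : bordered_det p q A = - bordered_det q p A.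
Proof.
apply/eqP; rewrite -addr_eq0 -(bdet_pp (p + q) A); apply/eqP.
have D1 x y z : bordered_det (x + y) z A = bordered_det x z A + bordered_det y z A.
  by rewrite -[x]scale1r bdet_lin1 scale1r mul1r.
have D2 x y z : bordered_det z (x + y) A = bordered_det z x A + bordered_det z y A.
  by rewrite -[x]scale1r bdet_lin2 scale1r mul1r.
by rewrite D1 !D2 !bdet_pp add0r addr0.
Qed.

Lemma bdet_cramer p q v A :
  bordered_det v q A *: p + bordered_det p v A *: q + A *m (bordered_adj p q A *m v) = bordered_det p q A *: v.
Proof.
transitivity ((bordered p q A : 'M_t.+2) *m (\adj (bordered p q A : 'M_t.+2) *m v)); last first.
  by rewrite mulmxA mul_mx_adj mul_scalar_mx.
apply/matrixP=> c j; rewrite (ord1 j) [RHS]mxE.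
rewrite bm_sum !adj_mul_col bmset0 bmset1 !mxE ![_ * p c 0]mulrC ![_ * q c 0]mulrC.
congr (_ + _); apply: eq_bigr => i _; congr (_ * _).
by rewrite bpsi_tau /tau adj_mul_col bmset2.
Qed.

Lemma tau_lin i p q A a u u' :
  tau i (a *: u + u') p q A = a * tau i u p q A + tau i u' p q A.
Proof. by rewrite -!bpsi_tau mulmxDr -scalemxAr !mxE. Qed.

Lemma tau_pp i p q A : tau i p p q A = 0.
Proof. by rewrite -bpsi_tau bpsi_p mxE. Qed.

Lemma tau_qq i p q A : tau i q p q A = 0.
Proof. by rewrite -bpsi_tau bpsi_q mxE. Qed.

Lemma tau_swap i u p q A : tau i u p q A = - tau i p u q A.
Proof.
apply/eqP; rewrite -addr_eq0 -(tau_pp i (u + p) q A); apply/eqP.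
have D1 x y z : tau i (x + y) z q A = tau i x z q A + tau i y z q A.
  by rewrite -[x]scale1r tau_lin scale1r mul1r.
have D2 x y z : tau i z (x + y) q A = tau i z x q A + tau i z y q A.
  by rewrite -[x]scale1r /tau bdet_lin1 scale1r mul1r.
by rewrite D1 !D2 !tau_pp add0r addr0.
Qed.

Lemma tau_col i j p q A : tau i (col j A) p q A = bordered_det p q A *+ (i == j).
Proof.
have := bpsi_col p q A (c2 j); rewrite bm_col2 => /matrixP/(_ i 0).
by rewrite bpsi_tau mxE n22.
Qed.

End Cramer.

(** * Ideals and regular sequences *)

Section Ideals.
Variable R : comNzRingType.
Implicit Types (P : R -> Prop) (x y r : R).

Record ideal P : Prop := Ideal {
  ideal0 : P 0;
  idealD : forall x y, P x -> P y -> P (x + y);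
  idealM : forall r x, P x -> P (r * x) }.

Lemma idealN P x : ideal P -> P x -> P (- x).
Proof. by move=> iP Px; rewrite -mulN1r; apply: idealM. Qed.

Lemma idealB P x y : ideal P -> P x -> P y -> P (x - y).
Proof. by move=> iP Px Py; apply: idealD => //; apply: idealN. Qed.

Lemma idealMr P x r : ideal P -> P x -> P (x * r).
Proof. by move=> iP Px; rewrite mulrC; apply: idealM. Qed.

Lemma ideal_sum P (J : Type) (s : seq J) (p : pred J) (F : J -> R) :
  ideal P -> (forall i, p i -> P (F i)) -> P (\sum_(i <- s | p i) F i).
Proof. by move=> iP h; elim/big_rec: _ => [|i x pi Px]; [apply: ideal0|apply: idealD; auto]. Qed.

Lemma ideal_gen (J : finType) (g : J -> R) : ideal (gen_ideal g).
Proof.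
split=> [|x y [c ->] [d ->]|r x [c ->]].
- by exists (fun=> 0); rewrite big1 // => i _; rewrite mul0r.
- by exists (fun i => c i + d i); rewrite -big_split; apply: eq_bigr => i _; rewrite mulrDl.
- by exists (fun i => r * c i); rewrite mulr_sumr; apply: eq_bigr => i _; rewrite mulrA.
Qed.

Lemma gen_ideal_gen (J : finType) (g : J -> R) i : gen_ideal g (g i).
Proof.
exists (fun j => (j == i)%:R); rewrite (bigD1 i) //= eqxx mul1r big1 ?addr0 // => j.
by move/negPf=> ->; rewrite mul0r.
Qed.

Lemma gen_ideal_sub (J : finType) (g : J -> R) P :
  ideal P -> (forall i, P (g i)) -> forall x, gen_ideal g x -> P x.
Proof. by move=> iP h x [c ->]; apply: ideal_sum => // i _; apply: idealM. Qed.

Definition addI P x : R -> Prop := fun p => exists c, P (p - c * x).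

Lemma ideal_addI P x : ideal P -> ideal (addI P x).
Proof.
move=> iP; split=> [|p q [c hc] [d hd]|r p [c hc]].
- by exists 0; rewrite mul0r subr0; apply: ideal0.
- by exists (c + d); rewrite mulrDl opprD addrACA; apply: idealD.
- by exists (r * c); rewrite -mulrA -mulrBr; apply: idealM.
Qed.

Lemma addI_sub P x p : ideal P -> P p -> addI P x p.
Proof. by move=> iP Pp; exists 0; rewrite mul0r subr0. Qed.

Lemma addI_gen P x r : ideal P -> addI P x (r * x).
Proof. by move=> iP; exists r; rewrite subrr; apply: ideal0. Qed.

Lemma ideal_zero : ideal (@zero_ideal R).
Proof. by split=> [//|x y -> ->|r x ->]; rewrite /zero_ideal ?addr0 ?mulr0. Qed.

Definition regm P x := forall r, P (r * x) -> P r.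

Fixpoint regchain P (xs : seq R) : Prop :=
  if xs is x :: s then regm P x /\ regchain (addI P x) s else True.

Lemma ideal_add_seq0 P p : ideal_add_seq P [::] p <-> P p.
Proof.
split=> [[q [c [Pq ->]]]|Pp]; first by rewrite big_ord0 addr0.
by exists p, (fun=> 0); rewrite big_ord0 addr0.
Qed.

Lemma ideal_add_seq_cons P x s p :
  ideal_add_seq P (x :: s) p <-> ideal_add_seq (addI P x) s p.
Proof.
split=> [[q [c [Pq ->]]]|[q [c [[d Pq] ->]]]].
  exists (q + c ord0 * x), (fun i => c (lift ord0 i)); split.
    by exists (c ord0); rewrite addrK.
  by rewrite big_ord_recl addrA.
exists (q - d * x), (fun i : 'I_(size s).+1 => oapp c d (unlift ord0 i)); split=> //.
rewrite big_ord_recl unlift_none /= addrA subrK; congr (_ + _).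
by apply: eq_bigr => i _; rewrite liftK.
Qed.

Lemma regular_seq_chain P xs : regular_seq P xs -> regchain P xs.
Proof.
case=> + _; elim: xs P => //= x s IH P h; split.
  by move=> r hr; apply/ideal_add_seq0/(h 0 isT); rewrite take0; apply/ideal_add_seq0.
apply: IH => i lt_i r hr; apply/ideal_add_seq_cons/(h i.+1 lt_i).
exact/ideal_add_seq_cons.
Qed.

Definition inmx P m n (A : 'M[R]_(m, n)) := forall i j, P (A i j).

Section Inmx.
Variables (P : R -> Prop) (iP : ideal P).

Lemma inmxD m n (A B : 'M_(m, n)) : inmx P A -> inmx P B -> inmx P (A + B).
Proof. by move=> hA hB i j; rewrite mxE; apply: idealD. Qed.

Lemma inmxN m n (A : 'M_(m, n)) : inmx P A -> inmx P (- A).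
Proof. by move=> hA i j; rewrite mxE; apply: idealN. Qed.

Lemma inmxB m n (A B : 'M_(m, n)) : inmx P A -> inmx P B -> inmx P (A - B).
Proof. by move=> hA hB; apply: inmxD => //; apply: inmxN. Qed.

Lemma inmxMl m n p (A : 'M_(m, n)) (B : 'M_(n, p)) : inmx P B -> inmx P (A *m B).
Proof. by move=> hB i j; rewrite mxE; apply: ideal_sum => // k _; apply: idealM. Qed.

Lemma inmxMr m n p (A : 'M_(m, n)) (B : 'M_(n, p)) : inmx P A -> inmx P (A *m B).
Proof. by move=> hA i j; rewrite mxE; apply: ideal_sum => // k _; apply: idealMr. Qed.

Lemma inmxT m n (A : 'M_(m, n)) : inmx P A -> inmx P A^T.
Proof. by move=> hA i j; rewrite mxE. Qed.

Lemma inmx_trace n (A : 'M_n) : inmx P A -> P (\tr A).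
Proof. by move=> hA; apply: ideal_sum. Qed.

Lemma inmx_addI m n x (A : 'M_(m, n)) :
  inmx (addI P x) A -> exists B, inmx P (A - x *: B).
Proof.
move=> h; have [f hf] := fin_all_exists (fun i => fin_all_exists (h i)).
by exists (\matrix_(i, j) f i j) => i j; rewrite !mxE mulrC; apply: hf.
Qed.

Lemma inmx_reg m n x (A : 'M_(m, n)) : regm P x -> inmx P (x *: A) -> inmx P A.
Proof. by move=> rx h i j; apply: rx; have := h i j; rewrite mxE mulrC. Qed.

End Inmx.

Lemma inmx_zero m n (A : 'M[R]_(m, n)) : inmx (@zero_ideal R) A <-> A = 0.
Proof.
split=> [h|-> i j]; last by rewrite mxE.
by apply/matrixP=> i j; rewrite mxE; apply: h.
Qed.

End Ideals.

(** * The Buchsbaum-Rim complex *)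

Section Setup.
Variables (R : comNzRingType) (half : R) (halfP : half + half = 1).
Variables (t : nat) (phi : 'M[R]_(t.+2, t)).

Lemma half_dbl (V : lmodType R) (v : V) : half *: v + half *: v = v.
Proof. by rewrite -scalerDl halfP scale1r. Qed.

Lemma dbl_eq0r (x : R) : x + x = 0 -> x = 0.
Proof. by move=> h; rewrite -[x]mul1r -halfP mulrDl -mulrDr h mulr0. Qed.

Definition ev (j : 'I_t.+2) : 'cV[R]_t.+2 := delta_mx j 0.
(* The middle map of the Buchsbaum-Rim complex F -> G -> G^* -> F^*; up to sign its entries
   are the maximal minors of [phi]. *)
Definition Om : 'M[R]_t.+2 := \matrix_(j, l) bordered_det (ev j) (ev l) phi.

Lemma cV_ev (p : 'cV[R]_t.+2) : p = \sum_j p j 0 *: ev j.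
Proof.
apply/matrixP=> i j; rewrite summxE (bigD1 i) //= (ord1 j) !mxE !eqxx mulr1.
rewrite big1 ?addr0 // => k ki; rewrite !mxE eq_sym (negPf ki) mulr0 //.
Qed.

Lemma eq_mx_cV m n (A B : 'M[R]_(m, n)) : (forall v : 'cV_n, A *m v = B *m v) -> A = B.
Proof. by move=> h; apply/matrixP=> i j; have := h (delta_mx j 0); rewrite -!colE => /matrixP/(_ i 0); rewrite !mxE. Qed.

Lemma bdet_Om p q : bordered_det p q phi = (p^T *m Om *m q) 0 0.
Proof.
rewrite {1}(cV_ev p) (bdet_adj0 0) mulmx_sumr summxE !mxE.
under [RHS]eq_bigr do rewrite mxE mulr_suml; rewrite exchange_big /=.
apply: eq_bigr => j _; rewrite -scalemxAr mxE -bdet_adj0 {1}(cV_ev q) (bdet_adj1 _ _ 0).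
rewrite mulmx_sumr summxE mulr_sumr; apply: eq_bigr => l _.
by rewrite -scalemxAr mxE -bdet_adj1 !mxE -mulrA [q l 0 * _]mulrC.
Qed.

Lemma trOm : Om^T = - Om.
Proof. by apply/matrixP=> i j; rewrite !mxE bdet_swap. Qed.

Lemma bdet_phi q i : bordered_det (col i phi) q phi = 0.
Proof. by rewrite -(tau_pp i (col i phi) q phi) /tau colset_id. Qed.

Definition Kpq (p q : 'cV[R]_t.+2) : 'M_t.+2 := q *m p^T - p *m q^T.

(** This is [bdet_cramer] with the vector stripped off: the two border terms are bordered
    determinants, hence values of [Om], and combine to [Kpq p q *m Om]. *)
Lemma Kpq_H p q : phi *m bordered_adj p q phi + Kpq p q *m Om = (bordered_det p q phi)%:M.
Proof.
apply: eq_mx_cV => v; rewrite mul_scalar_mx -bdet_cramer mulmxDl -mulmxA addrC.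
congr (_ + _); rewrite mulmxBl mulmxBl -!mulmxA.
rewrite [p^T *m _]mx11_scalar [q^T *m _]mx11_scalar !mul_mx_scalar !mulmxA -!bdet_Om.
by rewrite addrC (bdet_swap v q) scaleNr.
Qed.

Lemma Om_phi : Om *m phi = 0.
Proof.
apply/matrixP=> j i; rewrite [RHS]mxE; transitivity (bordered_det (ev j) (col i phi) phi).
  by rewrite bdet_Om trmx_delta -rowE colE mulmxA -colE -row_mul !mxE.
by rewrite bdet_swap bdet_phi oppr0.
Qed.

Lemma trphi_Om : phi^T *m Om = 0.
Proof. by apply: trmx_inj; rewrite trmx_mul trmxK trOm mulNmx Om_phi oppr0 trmx0. Qed.

Definition om (K : 'M[R]_t.+2) : R := half * \tr (K *m Om).

(** Linear extension of the assignment sending [Kpq p q] to [bordered_adj p q phi]. Each pair of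
    indices is counted twice, hence [half], here and in [om]. *)
Definition psiK (K : 'M[R]_t.+2) : 'M[R]_(t, t.+2) :=
  \sum_j \sum_l (half * K j l) *: bordered_adj (ev l) (ev j) phi.

Lemma Kpq_ev j l : Kpq (ev l) (ev j) = delta_mx j l - delta_mx l j.
Proof. by rewrite /Kpq !trmx_delta !mul_delta_mx. Qed.

Lemma om_sum (K : 'M[R]_t.+2) : \sum_j \sum_l (half * K j l) * bordered_det (ev l) (ev j) phi = om K.
Proof.
rewrite /om mulr_sumr; apply: eq_bigr => j _; rewrite mxE mulr_sumr.
by apply: eq_bigr => l _; rewrite !mxE mulrA.
Qed.

(* With [psiK_phi], this makes [om K] null-homotopic on the Buchsbaum-Rim complex. *)
Lemma psiK_H K : K^T = - K -> phi *m psiK K + K *m Om = (om K)%:M.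
Proof.
move=> aK; have eK : K = \sum_j \sum_l (half * K j l) *: Kpq (ev l) (ev j).
  transitivity (half *: (K - K^T)); first by rewrite aK opprK scalerDr half_dbl.
  rewrite {1 2}(matrix_sum_delta K) linear_sum -sumrB scaler_sumr.
  apply: eq_bigr => j _; rewrite linear_sum -sumrB scaler_sumr; apply: eq_bigr => l _.
  by rewrite Kpq_ev linearZ /= trmx_delta -scalerBr scalerA.
have -> : K *m Om = \sum_j \sum_l (half * K j l) *: (Kpq (ev l) (ev j) *m Om).
  rewrite {1}eK mulmx_suml; apply: eq_bigr => j _; rewrite mulmx_suml.
  by apply: eq_bigr => l _; rewrite scalemxAl.
rewrite /psiK mulmx_sumr -big_split -om_sum raddf_sum /=; apply: eq_bigr => j _.
rewrite mulmx_sumr -big_split raddf_sum /=; apply: eq_bigr => l _.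
by rewrite -scalemxAr -scalerDr Kpq_H scale_scalar_mx.
Qed.

Lemma psiK_phi K : psiK K *m phi = (om K)%:M.
Proof.
rewrite /psiK mulmx_suml -om_sum raddf_sum; apply: eq_bigr => j _.
rewrite mulmx_suml raddf_sum; apply: eq_bigr => l _.
by rewrite -scalemxAl bpsi_mul scale_scalar_mx.
Qed.

(** I_t in a form where each element comes with a matrix from which a homotopy can be built;
    [minor_idealE] identifies it with the ideal of minors. *)
Definition inI (x : R) : Prop := exists K, x = \tr (K *m Om).

Lemma ideal_inI : ideal inI.
Proof.
split=> [|x y [K ->] [L ->]|r x [K ->]].
- by exists 0; rewrite mul0mx mxtrace0.
- by exists (K + L); rewrite mulmxDl mxtraceD.
- by exists (r *: K); rewrite -scalemxAl mxtraceZ.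
Qed.

Lemma inI_Om : inmx inI Om.
Proof.
move=> i j; exists (delta_mx j i); rewrite /mxtrace (bigD1 j) //= big1 => [|k kj].
  rewrite addr0 [RHS]mxE (bigD1 i) //= big1 => [|l li].
    by rewrite addr0 [delta_mx _ _ _ _]mxE !eqxx mul1r.
  by rewrite [delta_mx _ _ _ _]mxE (negPf li) andbF mul0r.
by rewrite mxE big1 // => l _; rewrite mxE (negPf kj) mul0r.
Qed.

(** Since [Om] is alternating, only the alternating part of [K] contributes to the trace. *)
Lemma inI_alt x : inI x -> exists2 K, K^T = - K & x = om K.
Proof.
case=> K ->; exists (K - K^T); first by rewrite linearB /= trmxK opprB.
rewrite /om mulmxBl raddfB /= -[\tr (K^T *m _)]mxtrace_tr trmx_mul trmxK trOm.
rewrite mulNmx raddfN /= opprK mxtrace_mulC mulrDr -mulrDl halfP mul1r //.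
Qed.

Lemma inI_om K : inI (om K).
Proof. by apply: idealM; [exact: ideal_inI|exists K]. Qed.

Section BR.
Variables (P : R -> Prop) (iP : ideal P).

Lemma phi_inj_mod x m (v : 'M_(t, m)) :
  inI x -> regm P x -> inmx P (phi *m v) -> inmx P v.
Proof.
move=> /inI_alt[K _ ->] rx /(inmxMl iP (psiK K)).
by rewrite mulmxA psiK_phi mul_scalar_mx; apply: inmx_reg.
Qed.
End BR.

Lemma Om_exact_mod P x x' m (g : 'M_(t.+2, m)) : ideal P ->
  inI x -> regm P x -> inI x' -> regm (addI P x) x' ->
  inmx P (Om *m g) -> exists w, inmx P (g - phi *m w).
Proof.
move=> iP /inI_alt[K aK ->] rx Ix' rx' hg.
have e : om K *: g = phi *m (psiK K *m g) + K *m (Om *m g).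
  by rewrite !mulmxA -mulmxDl psiK_H // mul_scalar_mx.
have iP' := ideal_addI (om K) iP.
have: inmx (addI P (om K)) (phi *m (psiK K *m g)).
  have -> : phi *m (psiK K *m g) = om K *: g - K *m (Om *m g) by rewrite e addrK.
  apply: inmxB => // i j; first by rewrite mxE mulrC; apply: addI_gen.
  by apply: addI_sub => //; apply: inmxMl.
move=> /(phi_inj_mod iP' Ix' rx')/inmx_addI[w hw]; exists w.
apply: (inmx_reg rx); rewrite scalerBr e addrAC scalemxAr -mulmxBr.
by apply: inmxD => //; apply: inmxMl.
Qed.

(* A regular [x] in I is null-homotopic, so a cycle times [x] bounds; dividing the bounding
   chain by [x] uses exactness one step to the left modulo [x]. *)
Lemma trphi_exact_mod P x x' x'' m (g : 'M_(t.+2, m)) : ideal P ->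
  inI x -> regm P x -> inI x' -> regm (addI P x) x' ->
  inI x'' -> regm (addI (addI P x) x') x'' ->
  inmx P (phi^T *m g) -> exists w, inmx P (g - Om *m w).
Proof.
move=> iP /inI_alt[K aK ->] rx Ix' rx' Ix'' rx'' hg.
have e : om K *: g = (psiK K)^T *m (phi^T *m g) + Om *m (K *m g).
  rewrite !mulmxA -mulmxDl -mul_scalar_mx -tr_scalar_mx -psiK_H // linearD /= !trmx_mul.
  by rewrite trOm aK mulmxN mulNmx opprK.
have iP' := ideal_addI (om K) iP.
have: inmx (addI P (om K)) (Om *m (K *m g)).
  have -> : Om *m (K *m g) = om K *: g - (psiK K)^T *m (phi^T *m g) by rewrite e addrC addKr.
  apply: inmxB => // i j; first by rewrite mxE mulrC; apply: addI_gen.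
  by apply: addI_sub => //; apply: inmxMl.
move=> /(Om_exact_mod iP' Ix' rx' Ix'' rx'')[w /inmx_addI[w' hw]]; exists w'.
apply: (inmx_reg rx); rewrite scalerBr e -addrA scalemxAr -mulmxBr.
apply: inmxD => //; first by apply: inmxMl.
have -> : Om *m (K *m g - om K *: w') = Om *m (K *m g - phi *m w - om K *: w').
  by rewrite -addrA [- (phi *m w) - _]addrC addrA [RHS]mulmxBr mulmxA Om_phi mul0mx subr0.
exact: inmxMl.
Qed.

End Setup.

(** * Exactness of the left part of the resolution and of the Eagon-Northcott complex *)

Section Exactness.
Variables (R : comNzRingType) (half : R) (halfP : half + half = 1).
Variables (t : nat) (phi : 'M[R]_(t.+2, t)).
Local Notation Om := (Om phi).
Hypothesis phi_inj : forall m (v : 'M_(t, m)), phi *m v = 0 -> v = 0.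
Hypothesis Om_exact : forall m (g : 'M_(t.+2, m)), Om *m g = 0 -> exists w, g = phi *m w.
Hypothesis trphi_exact : forall m (g : 'M_(t.+2, m)), phi^T *m g = 0 -> exists w, g = Om *m w.

Lemma scalar_mx0 n : (0 : R)%:M = 0 :> 'M_n.
Proof. exact: raddf0. Qed.

Lemma trphi_inj m (v : 'M_(m, t)) : v *m phi^T = 0 -> v = 0.
Proof.
move=> h; apply: trmx_inj; rewrite trmx0; apply: phi_inj.
by apply: trmx_inj; rewrite trmx_mul trmxK h trmx0.
Qed.

Lemma Om_exactl m (g : 'M_(m, t.+2)) : g *m Om = 0 -> exists w, g = w *m phi^T.
Proof.
move=> h; have [w e] : exists w, g^T = phi *m w.
  by apply: Om_exact; apply: trmx_inj; rewrite trmx_mul trmxK trOm mulmxN h oppr0 trmx0.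
by exists w^T; apply: trmx_inj; rewrite e trmx_mul !trmxK.
Qed.

Lemma phi_exactl m (g : 'M_(m, t.+2)) : g *m phi = 0 -> exists w, g = w *m Om.
Proof.
move=> h; have [w e] : exists w, g^T = Om *m w.
  by apply: trphi_exact; apply: trmx_inj; rewrite trmx_mul !trmxK h trmx0.
by exists (- w^T); apply: trmx_inj; rewrite e trmx_mul linearN /= trmxK trOm mulNmx mulmxN opprK.
Qed.

Lemma sym_trace_Om (S : 'M_t.+2) : S^T = S -> \tr (S *m Om) = 0.
Proof.
move=> sS; apply: (dbl_eq0r halfP); rewrite -{1}mxtrace_tr trmx_mul trOm sS mulNmx.
by rewrite raddfN /= mxtrace_mulC addNr.
Qed.

(** The first equation lifts W to phi Y^T; the second becomes phi (Y + Y^T) phi^T = 0, where phi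
    cancels on both sides. *)
Lemma alt_exact (W : 'M_(t.+2, t)) : W^T *m Om = 0 -> W *m phi^T + phi *m W^T = 0 ->
  exists2 Y : 'M_t, Y^T = - Y & W = phi *m Y.
Proof.
move=> /Om_exactl[Y e] h; exists Y^T; last by apply: trmx_inj; rewrite e trmx_mul trmxK.
have eW : W = phi *m Y^T by apply: trmx_inj; rewrite e trmx_mul trmxK.
apply/eqP; rewrite trmxK -addr_eq0; apply/eqP/phi_inj/trphi_inj.
by rewrite mulmxDr mulmxDl -mulmxA -e -eW addrC.
Qed.

(** Multiplying by [Om] on the left kills the right side, so Om V = 0 and V lifts to phi T;
    cancelling phi on both sides of the equation shows that T is symmetric. *)
Lemma sym_exact (V : 'M_(t.+2, t)) : V *m phi^T = phi *m V^T ->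
  exists2 T : 'M_t, T^T = T & V = phi *m T.
Proof.
move=> h; have [T e] : exists T, V = phi *m T.
  by apply/Om_exact/trphi_inj; rewrite -mulmxA h mulmxA Om_phi mul0mx.
exists T => //; apply/eqP; rewrite -subr_eq0; apply/eqP/phi_inj/trphi_inj.
move: h; rewrite {}e trmx_mul !mulmxA => h.
by rewrite mulmxBr mulmxBl h subrr.
Qed.

(* Taking traces in both equations gives [2 c = 0], because [Om] is alternating. *)
Lemma end_exact (Z : 'M_(t, t.+2)) (S : 'M_t.+2) (c : R) : S^T = S ->
  Z *m phi = c%:M -> phi *m Z + S *m Om = c%:M ->
  exists2 W : 'M_(t.+2, t), Z = - (W^T *m Om) & S = W *m phi^T + phi *m W^T.
Proof.
move=> sS h1 h2; have c0 : c = 0.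
  apply: (dbl_eq0r halfP); have := congr1 mxtrace h2.
  rewrite mxtraceD sym_trace_Om // addr0 mxtrace_mulC h1 !mxtrace_scalar => /eqP.
  by rewrite eq_sym -subr_eq0 -mulrnBr ?leqW // -addn2 addKn mulr2n => /eqP.
rewrite {c}c0 !scalar_mx0 in h1 h2.
have [W' e] := phi_exactl h1; pose W := - W'^T.
have eZ : Z = - (W^T *m Om) by rewrite linearN /= trmxK mulNmx opprK.
have [U eU] : exists U, S - phi *m W^T = U *m phi^T.
  by apply: Om_exactl; rewrite mulmxBl -mulmxA -[W^T *m _]opprK -eZ mulmxN opprK addrC.
have eS : S = phi *m W^T + U *m phi^T by rewrite -eU addrC subrK.
have [T sT eT] : exists2 T : 'M_t, T^T = T & W - U = phi *m T.
  apply: sym_exact; rewrite linearB /= mulmxBl mulmxBr; apply/eqP.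
  rewrite subr_eq addrAC eq_sym subr_eq; apply/eqP.
  by have := sS; rewrite eS linearD /= !trmx_mul !trmxK => <-.
(* This is the mean of W and U. Symmetry of S also gives S = W phi^T + phi U^T, and averaging the
   two expressions for S yields the required form; the correction phi T does not affect Z because
   phi^T Om = 0. *)
exists (W - half *: (phi *m T)).
  rewrite eZ [(W - _)^T]linearB /= [(half *: _)^T]linearZ /= trmx_mul mulmxBl -scalemxAl -mulmxA trphi_Om.
  by rewrite mulmx0 scaler0 subr0.
rewrite [(W - _)^T]linearB /= [(half *: _)^T]linearZ /= trmx_mul sT mulmxBl mulmxBr -scalemxAl -scalemxAr mulmxA.
rewrite addrACA -opprD (half_dbl halfP) eS -eT mulmxBl opprB.
by rewrite [W *m _ + _]addrC -addrA; congr (_ + _); rewrite addrCA subrr addr0.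
Qed.

(** When [om Y] vanishes, the homotopy ([psiK Y], Y) satisfies the equations of [end_exact] with c =
    0 and lifts in the same way; now the lift is made alternating by averaging Y with - Y^T. This is
    exactness of the Eagon-Northcott complex at the second exterior power of G. *)
Lemma alt_trace_exact (Y : 'M_t.+2) : Y^T = - Y -> \tr (Y *m Om) = 0 ->
  exists V : 'M_(t.+2, t), Y = V *m phi^T - phi *m V^T.
Proof.
move=> aY h; have o0 : om half phi Y = 0 by rewrite /om h mulr0.
have := psiK_phi half phi Y; have := psiK_H halfP phi aY; rewrite o0 !scalar_mx0 => h1 h2.
have [V' e] := phi_exactl h2; pose V := - V'^T.
have eP : psiK half phi Y = - (V^T *m Om) by rewrite linearN /= trmxK mulNmx opprK.
have [U eU] : exists U, Y - phi *m V^T = U *m phi^T.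
  by apply: Om_exactl; rewrite mulmxBl -mulmxA -[V^T *m _]opprK -eP mulmxN opprK addrC.
have eY : Y = phi *m V^T + U *m phi^T by rewrite -eU addrC subrK.
exists (half *: (U - V)); rewrite linearZ /= -scalemxAl -scalemxAr -scalerBr.
rewrite -{1}(half_dbl halfP Y) -scalerDr; congr (_ *: _).
rewrite -{2}[Y]opprK -aY eY linearD /= !trmx_mul !trmxK linearB /= mulmxBl mulmxBr.
by rewrite opprB [RHS]addrACA -opprD [U *m _ + _]addrC.
Qed.

(** For this matrix K the scalar [om K] is 0, so [psiK_H] reads phi (psiK K) = phi V^T Om and phi
    cancels. It shows later that relations among minors have derivatives in I_t. *)
Lemma psiK_d1 (V : 'M_(t.+2, t)) :
  psiK half phi (V *m phi^T - phi *m V^T) = V^T *m Om.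
Proof.
have aY : (V *m phi^T - phi *m V^T)^T = - (V *m phi^T - phi *m V^T).
  by rewrite linearB /= !trmx_mul !trmxK opprB.
have tr0 : om half phi (V *m phi^T - phi *m V^T) = 0.
  rewrite /om mulmxBl -mulmxA trphi_Om mulmx0 sub0r raddfN /= mxtrace_mulC mulmxA.
  by rewrite Om_phi mul0mx mxtrace0 oppr0 mulr0.
have := psiK_H halfP phi aY; rewrite tr0 scalar_mx0 mulmxBl -(mulmxA V) trphi_Om mulmx0 sub0r.
rewrite -mulmxA -mulmxBr => /phi_inj/eqP; rewrite subr_eq0 => /eqP ->//.
Qed.

End Exactness.

(** * Mapping cones and vanishing of Tor *)

Section Complexes.
Variable R : comNzRingType.

Record cplx := Cplx { rk : nat -> nat; df : forall i, 'M[R]_(rk i, rk i.+1) }.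
Implicit Types (C E : cplx) (y : R) (ys : seq R).

(** Degree 0 is left out, so an exact complex is a free resolution of the cokernel of [df C 0]. *)
Definition exact_cplx C := forall i, df C i *m df C i.+1 = 0 /\
  forall m (v : 'M_(rk C i.+1, m)), df C i *m v = 0 -> exists w, v = df C i.+1 *m w.

Definition shift C := Cplx (fun i => df C i.+1).

Definition prk C i := if i is j.+1 then rk C j else 0%N.
Definition pdf C i : 'M[R]_(prk C i, rk C i) :=
  if i is j.+1 then df C j else 0.

(** The mapping cone of multiplication by [y] on [C]; [prk] and [pdf] give the shifted copy of [C]
    rank 0 in degree 0. *)
Definition cone y C := Cplx (rk := fun i => (prk C i + rk C i)%N)
  (fun i => block_mx (- pdf C i) 0 y%:M (df C i)).

Fixpoint cones ys C := if ys is y :: s then cones s (cone y C) else C.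

Definition imdf C : 'cV_(rk C 0) -> Prop := fun v => exists w, v = df C 0 *m w.

Section Mod.
Variable n : nat.
Implicit Types (N : 'cV[R]_n -> Prop).
Definition addM N y : 'cV_n -> Prop := fun v => exists w, N (v - y *: w).
Definition addMs N ys := foldl addM N ys.
Definition mreg N y := forall v, N (y *: v) -> N v.
Fixpoint mchain N ys := if ys is y :: s then mreg N y /\ mchain (addM N y) s else True.
Definition eqM N N' := forall v, N v <-> N' v.

Lemma eqM_addM N N' y : eqM N N' -> eqM (addM N y) (addM N' y).
Proof. by move=> e v; split=> [] [w /e]; exists w. Qed.

Lemma eqM_mchain N N' ys : eqM N N' -> mchain N ys -> mchain N' ys.
Proof.
elim: ys N N' => //= y s IH N N' e [h1 h2]; split; last exact: IH (eqM_addM y e) h2.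
by move=> v /e/h1/e.
Qed.
End Mod.

Lemma exists_mul_col m n p (A : 'M[R]_(m, n)) (v : 'M_(m, p)) :
  (forall j, exists w : 'cV_n, col j v = A *m w) -> exists w, v = A *m w.
Proof.
move=> /fin_all_exists[f hf]; exists (\matrix_(i, j) f j i 0).
apply/matrixP=> i j; have /matrixP/(_ i 0) := hf j; rewrite !mxE => ->.
by apply: eq_bigr => k _; rewrite mxE.
Qed.

Lemma col_mx0l m n (A : 'M[R]_(0, n)) (B : 'M_(m, n)) : col_mx A B = B :> 'M_(m, n).
Proof.
apply/matrixP=> i j; have {1}-> : i = @rshift 0 m i by apply: val_inj.
exact: (@col_mxEd _ 0).
Qed.

Lemma imdf_cone y C : eqM (@imdf (cone y C)) (addM (@imdf C) y).
Proof.
move=> v; split=> [[w ->]|[w [u e]]].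
  exists (usubmx (w : 'M_(rk C 0 + rk C 1, 1))), (dsubmx (w : 'M_(rk C 0 + rk C 1, 1))).
  rewrite /= -{1}[w](@vsubmxK _ (rk C 0) (rk C 1)) mul_block_col col_mx0l.
  by rewrite mul_scalar_mx addrC addKr.
exists (col_mx w u : 'M_(rk C 0 + rk C 1, 1)).
by rewrite /= mul_block_col col_mx0l mul_scalar_mx -e addrC subrK.
Qed.

(** A cycle of the cone starts with a cycle v of C such that y v is a boundary. Then v is a
    boundary: by exactness of C in positive degrees, by regularity of y on the cokernel in degree
    0. *)
Lemma exact_cone y C : exact_cplx C -> mreg (@imdf C) y -> exact_cplx (cone y C).
Proof.
move=> eC ry; have ry' m (v : 'M_(rk C 0, m)) w : y *: v = df C 0 *m w ->
    exists w', v = df C 0 *m w'.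
  move=> e; apply: exists_mul_col => j; apply: ry; exists (col j w).
  by rewrite !colE mulmxA -e -scalemxAl.
have cp i : pdf C i *m df C i = 0.
  by case: i => [|i] /=; [rewrite mul0mx|case: (eC i)].
have ce i m (v : 'M_(rk C i, m)) w : pdf C i *m v = 0 -> y *: v = df C i *m w ->
    exists w', v = df C i *m w'.
  by case: i v w => [|i] /= v w h1 h2; [apply: ry' h2|case: (eC i) => _; apply].
move=> i; split=> /=.
  rewrite mulmx_block -block_mx0; congr block_mx.
  - by rewrite mul0mx addr0 mulNmx mulmxN opprK cp.
  - by rewrite mulmx0 mul0mx addr0.
  - by rewrite mulmxN mul_mx_scalar mul_scalar_mx addNr.
  - by rewrite mulmx0 add0r; case: (eC i).
move=> m v; rewrite -[v]vsubmxK; move: (usubmx v) (dsubmx v) => {v} v1 v2.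
rewrite mul_block_col mul0mx addr0 mul_scalar_mx -[0]vsubmxK linear0 linear0.
move=> /eq_col_mx[h1 h2].
have {}h1 : pdf C i *m v1 = 0 by apply/eqP; rewrite -oppr_eq0 -mulNmx h1.
have [w1 e1] : exists w', v1 = df C i *m w'.
  by apply: (ce _ _ _ (- v2)) => //; rewrite mulmxN; apply/eqP; rewrite -addr_eq0 h2.
have [w2 e2] : exists w', v2 + y *: w1 = df C i.+1 *m w'.
  by case: (eC i) => _; apply; rewrite mulmxDr -scalemxAr -e1 addrC.
exists (col_mx (- w1) w2); rewrite mul_block_col mul0mx addr0 mulNmx mulmxN opprK -e1.
by rewrite mul_scalar_mx -e2 scalerN addrC addrK.
Qed.

Lemma exact_cones ys C : exact_cplx C -> mchain (@imdf C) ys -> exact_cplx (cones ys C).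
Proof.
elim: ys C => //= y s IH C eC [h1 h2]; apply: IH; first exact: exact_cone.
by apply: eqM_mchain h2 => v; apply: iff_sym; apply: imdf_cone.
Qed.

Lemma exact_shift C : exact_cplx C -> exact_cplx (shift C).
Proof. by move=> eC i; apply: eC. Qed.

Lemma mulmx_dim0 m n p (A : 'M[R]_(m, n)) (B : 'M_(n, p)) : n = 0%N -> A *m B = 0.
Proof. by move=> e; subst n; rewrite [A]thinmx0 mul0mx. Qed.

(* Dimension shifting along C: Tor_i(coker E, coker C) = 0 for i > l. *)
Lemma tor_vanish l C E : exact_cplx C -> (forall i, (l < i)%N -> rk C i = 0%N) ->
  exact_cplx E -> forall i, (l <= i)%N ->
  forall (X : 'M_(rk E i.+1, rk C 0)) (Y : 'M_(rk E i, rk C 1)),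
  df E i *m X = Y *m (df C 0)^T ->
  exists X' Z, X = df E i.+1 *m X' + Z *m (df C 0)^T.
Proof.
move=> + + eE; elim: l C => [|l IH] C eC zC i li X Y e.
  have [X' ->] : exists X', X = df E i.+1 *m X'.
    by case: (eE i) => _; apply; rewrite e mulmx_dim0 // zC.
  by exists X', 0; rewrite mul0mx addr0.
case: i li X Y e => // i li X Y e.
have dY : df E i *m Y *m (df C 0)^T = 0.
  by rewrite -mulmxA -e mulmxA; case: (eE i) => -> _; rewrite mul0mx.
have [Y' eY'] : exists Y', df E i *m Y = Y' *m (df C 1)^T.
  have [w ew] : exists w, (df E i *m Y)^T = df C 1 *m w.
    case: (eC 0%N) => _; apply; apply: trmx_inj.
    by rewrite trmx_mul trmxK dY trmx0.
  by exists w^T; apply: trmx_inj; rewrite ew trmx_mul !trmxK.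
(* [Y] is a cycle with coefficients in the first syzygy module of coker C, which [shift C] resolves
   in length l. *)
have [Y1 [Z eY]] := IH (shift C) (exact_shift eC) (fun j lj => zC j.+1 lj) i li Y Y' eY'.
have [X' eX'] : exists X', X - Y1 *m (df C 0)^T = df E i.+2 *m X'.
  case: (eE i.+1) => _; apply; rewrite mulmxBr e eY mulmxDl -!mulmxA.
  rewrite -[(df C 1)^T *m _]trmx_mul; case: (eC 0%N) => -> _.
  by rewrite trmx0 mulmx0 addr0 subrr.
by exists X', Y1; rewrite -eX' subrK.
Qed.

(** An element of R^e (x) coker C0 is a matrix whose rows are read modulo the image of C0; this says
    that it is zero. *)
Definition inrow c d (C0 : 'M[R]_(c, d)) e (X : 'M_(e, c)) := exists Z, X = Z *m C0^T.

Fixpoint topi p ys := if ys is _ :: s then topi p.+1 s else p.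

(** A cycle X in degree p that is killed by y becomes the cycle (X, 0) of the cone in degree p + 1,
    and X vanishes if (X, 0) does. Iterating moves X to the degree where the hypothesis applies. *)
Lemma cones_top c d (C0 : 'M[R]_(c, d)) ys E p :
  (forall X : 'M_(rk (cones ys E) (topi p ys), c),
     inrow C0 (pdf (cones ys E) (topi p ys) *m X) -> inrow C0 X) ->
  forall X : 'M_(rk E p, c), (forall y, y \in ys -> inrow C0 (y *: X)) ->
  inrow C0 (pdf E p *m X) -> inrow C0 X.
Proof.
elim: ys E p => [|y s IH] E p /= h X hy hX; first exact: h.
have [Z] : inrow C0 (col_mx X 0 : 'M_(rk (cone y E) p.+1, c)).
  apply: (IH (cone y E) p.+1 h) => [z zs|].
    have [Z eZ] := hy z (mem_behead (s := y :: s) zs).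
    exists (col_mx Z 0 : 'M_(rk E p + rk E p.+1, d)).
    by rewrite scale_col_mx scaler0 mul_col_mx mul0mx eZ.
  have [Z1 e1] := hX; have [Z2 e2] := hy y (mem_head _ _).
  exists (col_mx (- Z1) Z2 : 'M_(prk E p + rk E p, d)).
  by rewrite /= mul_block_col !mulmx0 !addr0 mul_scalar_mx mul_col_mx !mulNmx e1 e2.
move=> /(congr1 (fun M : 'M_(rk E p + rk E p.+1, c) => usubmx M)).
by rewrite col_mxKu => ->; exists (usubmx Z); rewrite mul_usub_mx.
Qed.

Lemma rk_cones p ys E : (forall i, (p < i)%N -> rk E i = 0%N) ->
  forall i, (topi p ys < i)%N -> rk (cones ys E) i = 0%N.
Proof.
elim: ys E p => //= y s IH E p h; apply: IH => [] [|i] //= pi.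
by rewrite !h // ltnW.
Qed.

Lemma topi_rcons p ys y : topi p (rcons ys y) = (topi p ys).+1.
Proof. by elim: ys p => //= z s IH p. Qed.

(** A free resolution of R^n/N of length at most [l]. The rank in degree 0 is only provably equal to
    [n], hence the cast. *)
Definition resolves l n (N : 'cV[R]_n -> Prop) := exists C,
  [/\ exact_cplx C, forall i, (l < i)%N -> rk C i = 0%N &
      exists e : rk C 0 = n, eqM N (fun v => @imdf C (castmx (esym e, erefl 1%N) v))].

Lemma resolves_addM l n (N : 'cV_n -> Prop) y :
  resolves l N -> mreg N y -> resolves l.+1 (addM N y).
Proof.
case=> C [eC zC [e]]; subst n => eN ry; have {}eN : eqM N (@imdf C).
  by move=> v; have := eN v; rewrite castmx_id.
exists (cone y C); split; first by apply: exact_cone => // v /eN/ry/eN.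
  by move=> [|i] //= li; rewrite !zC // ltnW.
exists erefl => v; rewrite castmx_id; apply: iff_trans (eqM_addM y eN v) _.
by apply: iff_sym; apply: (@imdf_cone y C).
Qed.

Lemma resolves_addMs l n (N : 'cV_n -> Prop) ys :
  resolves l N -> mchain N ys -> resolves (topi l ys) (addMs N ys).
Proof.
elim: ys l N => //= y s IH l N rN [h1 h2]; apply: IH => //; exact: resolves_addM.
Qed.

Definition rowsin n (N : 'cV[R]_n -> Prop) m (X : 'M_(m, n)) := forall i, N (row i X)^T.

Lemma rowsin_inrow C m (X : 'M_(m, rk C 0)) : rowsin (@imdf C) X <-> inrow (df C 0) X.
Proof.
split=> [h|[Z ->] i]; last by exists (row i Z)^T; rewrite row_mul trmx_mul trmxK.
have [w e] : exists w, X^T = df C 0 *m w.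
  by apply: exists_mul_col => j; have [w e] := h j; exists w; rewrite -tr_row.
by exists w^T; apply: trmx_inj; rewrite e trmx_mul !trmxK.
Qed.

(* Tor_{l+|ys|+1}(coker E/(ys,y), (R^n/N)/ys) vanishes, and contains the elements killed by
   (ys, y) of Tor_l(coker E, (R^n/N)/ys), the kernel of the last map of E. *)
Lemma top_injective l n (N : 'cV_n -> Prop) E ys y : resolves l N -> mchain N ys ->
  exact_cplx E -> (forall i, (l < i)%N -> rk E i = 0%N) ->
  mchain (@imdf E) (rcons ys y) -> forall X : 'M_(rk E l, n),
  (forall z, z \in rcons ys y -> rowsin (addMs N ys) (z *: X)) ->
  rowsin (addMs N ys) (pdf E l *m X) -> rowsin (addMs N ys) X.
Proof.
move=> rN mN eE zE mE; have [C [eC zC [e]]] := resolves_addMs rN mN; subst n => eN X hX hp.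
have {}eN m (Y : 'M_(m, rk C 0)) : rowsin (addMs N ys) Y <-> inrow (df C 0) Y.
  apply: iff_trans (rowsin_inrow Y); split=> h i; have := h i; rewrite (eN _) castmx_id //.
apply/eN; apply: (@cones_top _ _ (df C 0) (rcons ys y) E l).
- rewrite topi_rcons => Y [Z eY].
  have [X' [Z' ->]] := tor_vanish eC zC (exact_cones eE mE) (leqnn _) eY.
  by exists Z'; rewrite mulmx_dim0 ?add0r //; apply: (rk_cones zE); rewrite topi_rcons.
- by move=> z zs; apply/eN/hX.
- exact/eN.
Qed.

End Complexes.

(** * Coordinates on spaces of matrices *)

Section Coords.
Variable R : comNzRingType.

(** A basis of the submodule [cmem] of [V]. Symmetric matrices, alternating matrices and normalized
    pairs are thus handled as free modules without types of their own; [enc] is linear on all of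
    [V], but injective only on [cmem]. *)
Record coords (V : lmodType R) (N : nat) := Coords {
  cmem : V -> Prop;
  dec : 'cV[R]_N -> V;
  enc : V -> 'cV[R]_N;
  dec_lin : linear dec;
  enc_lin : linear enc;
  decK : cancel dec enc;
  encK : forall v, cmem v -> dec (enc v) = v;
  cmem_dec : forall u, cmem (dec u) }.

Lemma linear_f0 (U V : lmodType R) (f : U -> V) : linear f -> f 0 = 0.
Proof. by move=> lf; have := lf (-1) 0 0; rewrite scaler0 addr0 scaleN1r addNr. Qed.

Lemma enc_inj (V : lmodType R) N (c : coords V N) v :
  cmem c v -> enc c v = 0 -> v = 0.
Proof. by move=> mv e; rewrite -(encK mv) e (linear_f0 (@dec_lin _ _ c)). Qed.

Definition mx_of N N' (g : 'cV[R]_N -> 'cV[R]_N') : 'M[R]_(N', N) :=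
  \matrix_(l, k) g (delta_mx k 0) l 0.

Lemma mul_mx_of N N' (g : 'cV[R]_N -> 'cV[R]_N') u : linear g -> mx_of g *m u = g u.
Proof.
move=> lg; have gs (J : Type) (r : seq J) (F : J -> 'cV_N) :
    g (\sum_(i <- r) F i) = \sum_(i <- r) g (F i).
  elim: r => [|x r IH]; first by rewrite !big_nil (linear_f0 lg).
  by rewrite !big_cons -IH -[F x]scale1r lg !scale1r.
have {2}-> : u = \sum_k u k 0 *: delta_mx k 0.
  by rewrite {1}[u]matrix_sum_delta; apply: eq_bigr => k _; rewrite big_ord1.
rewrite gs; apply/matrixP=> l j; rewrite (ord1 j) mxE summxE; apply: eq_bigr => k _.
rewrite -[u k 0 *: _]addr0 lg (linear_f0 lg) addr0 !mxE mulrC //.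
Qed.

Section LinMx.
Variables (V V' : lmodType R) (N N' : nat) (c : coords V N) (c' : coords V' N').
Variable f : V -> V'.
Hypothesis lf : linear f.

Definition lin_mx_of : 'M[R]_(N', N) := mx_of (fun u => enc c' (f (dec c u))).

Lemma mul_lin_mx_of u : lin_mx_of *m u = enc c' (f (dec c u)).
Proof. by rewrite mul_mx_of // => a v w; rewrite dec_lin lf enc_lin. Qed.

Lemma lin_mx_of_eq0 u : (forall v, cmem c v -> cmem c' (f v)) ->
  lin_mx_of *m u = 0 -> f (dec c u) = 0.
Proof. by move=> hf; rewrite mul_lin_mx_of; apply: enc_inj; apply/hf/cmem_dec. Qed.

Lemma lin_mx_ofE l k : lin_mx_of l k = enc c' (f (dec c (delta_mx k 0))) l 0.
Proof. by rewrite mxE. Qed.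
End LinMx.

Section LinMxExact.
Variables (V1 V2 V3 : lmodType R) (N1 N2 N3 : nat).
Variables (c1 : coords V1 N1) (c2 : coords V2 N2) (c3 : coords V3 N3).
Variables (f : V2 -> V1) (g : V3 -> V2).
Hypotheses (lf : linear f) (lg : linear g).
Hypotheses (hf : forall v, cmem c2 v -> cmem c1 (f v)).
Hypotheses (hg : forall v, cmem c3 v -> cmem c2 (g v)).
Hypotheses (fg : forall v, cmem c3 v -> f (g v) = 0).
Hypotheses (ex : forall v, cmem c2 v -> f v = 0 -> exists2 w, cmem c3 w & v = g w).

Lemma lin_mx_comp0 : lin_mx_of c2 c1 f *m lin_mx_of c3 c2 g = 0.
Proof.
apply: eq_mx_cV => v; rewrite mul0mx -mulmxA !mul_lin_mx_of //.
rewrite encK; last by apply/hg/cmem_dec.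
by rewrite fg ?(linear_f0 (@enc_lin _ _ c1)) //; apply: cmem_dec.
Qed.

Lemma lin_mx_exact (v : 'cV_N2) :
  lin_mx_of c2 c1 f *m v = 0 <-> exists w, v = lin_mx_of c3 c2 g *m w.
Proof.
split=> [|[w ->]]; last by rewrite mulmxA lin_mx_comp0 mul0mx.
move/(lin_mx_of_eq0 lf hf)/(ex (cmem_dec c2 v)) => [w mw e]; exists (enc c3 w).
by rewrite mul_lin_mx_of // (encK mw) -e decK.
Qed.
End LinMxExact.

Section ListCoords.
Variables (T : eqType) (s : seq T) (x0 : T) (N : nat).
Hypotheses (us : uniq s) (hN : N = size s).

(** [N] is kept apart from [size s] because the ranks in the resolution are sizes of mapped lists of
    twists. *)
Definition ldec (u : 'cV[R]_N) (x : T) : R :=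
  if insub (index x s) is Some k then u k 0 else 0.
Definition lenc (f : T -> R) : 'cV[R]_N := \col_k f (nth x0 s k).

Lemma ldecP a u v x : ldec (a *: u + v) x = a * ldec u x + ldec v x.
Proof. by rewrite /ldec; case: insub => [k|]; rewrite ?mxE ?mulr0 ?addr0. Qed.

Lemma lencP a f g h : (forall x, h x = a * f x + g x) -> lenc h = a *: lenc f + lenc g.
Proof. by move=> e; apply/matrixP=> i j; rewrite !mxE e. Qed.

Lemma ldec_nth u (k : 'I_N) : ldec u (nth x0 s k) = u k 0.
Proof.
rewrite /ldec index_uniq -?hN // insubT //= => h; congr (u _ _); exact: val_inj.
Qed.

Lemma ldecK u f : (forall x, x \in s -> f x = ldec u x) -> lenc f = u.
Proof.
move=> e; apply/matrixP=> i j; rewrite (ord1 j) mxE e ?ldec_nth //.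
by rewrite mem_nth // -hN.
Qed.

Lemma lencK f x : x \in s -> ldec (lenc f) x = f x.
Proof.
move=> xs; have h : (index x s < N)%N by rewrite hN index_mem.
have [k' ->] : exists k' : 'I_N, x = nth x0 s k' by exists (Ordinal h); rewrite /= nth_index.
by rewrite ldec_nth mxE.
Qed.

Lemma ldec_out u x : x \notin s -> ldec u x = 0.
Proof.
by rewrite -index_mem -hN /ldec => h; rewrite insubN.
Qed.

Lemma ldec_delta k x : ldec (delta_mx k 0) x = (x == nth x0 s k)%:R.
Proof.
have [xs|xs] := boolP (x \in s); last first.
  rewrite ldec_out //; case: eqVneq => // e; case/negP: xs.
  by rewrite e mem_nth // -hN.
have h : (index x s < N)%N by rewrite hN index_mem.
have [k' ->] : exists k' : 'I_N, x = nth x0 s k' by exists (Ordinal h); rewrite /= nth_index.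
by rewrite ldec_nth mxE eqxx andbT nth_uniq -?hN.
Qed.
End ListCoords.

Section PairLists.
Definition allp m n : seq ('I_m * 'I_n) := [seq (i, j) | i <- enum 'I_m, j <- enum 'I_n].
Definition symp n : seq ('I_n * 'I_n) :=
  [seq (i, j) | i : 'I_n <- enum 'I_n, j : 'I_n <- filter (fun j : 'I_n => (i <= j)%N) (enum 'I_n)].
Definition altp n : seq ('I_n * 'I_n) :=
  [seq (i, j) | i : 'I_n <- enum 'I_n, j : 'I_n <- filter (fun j : 'I_n => (i < j)%N) (enum 'I_n)].

Lemma allp_uniq m n : uniq (allp m n).
Proof. by apply: allpairs_uniq; rewrite ?enum_uniq // => -[a b] [c d]. Qed.
Lemma symp_uniq n : uniq (symp n).
Proof.
apply: allpairs_uniq_dep; first exact: enum_uniq.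
  by move=> i _; rewrite filter_uniq ?enum_uniq.
by move=> [a b] [c d] _ _ /= [-> ->].
Qed.
Lemma altp_uniq n : uniq (altp n).
Proof.
apply: allpairs_uniq_dep; first exact: enum_uniq.
  by move=> i _; rewrite filter_uniq ?enum_uniq.
by move=> [a b] [c d] _ _ /= [-> ->].
Qed.
Lemma mem_allp m n x : x \in allp m n.
Proof. by case: x => i j; apply/allpairsPdep; exists i, j; rewrite !mem_enum. Qed.
Lemma mem_symp n i j : ((i, j) \in symp n) = (i <= j)%N.
Proof.
apply/allpairsPdep/idP => [[a [b [_ + [-> ->]]]]|h]; first by rewrite mem_filter => /andP[].
by exists i, j; split; rewrite ?mem_enum // mem_filter mem_enum h.
Qed.
Lemma mem_altp n i j : ((i, j) \in altp n) = (i < j)%N.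
Proof.
apply/allpairsPdep/idP => [[a [b [_ + [-> ->]]]]|h]; first by rewrite mem_filter => /andP[].
by exists i, j; split; rewrite ?mem_enum // mem_filter mem_enum h.
Qed.
End PairLists.

Definition symof n (f : 'I_n * 'I_n -> R) : 'M[R]_n :=
  \matrix_(i, j) f (if (i <= j)%N then (i, j) else (j, i)).
Definition altof n (f : 'I_n * 'I_n -> R) : 'M[R]_n :=
  \matrix_(i, j) if (i < j)%N then f (i, j) else if (j < i)%N then - f (j, i) else 0.

Section ModCoords.
Variables (m n : nat) (xm : 'I_m) (xn : 'I_n).

Definition fullC N (hN : N = size (allp m n)) : coords 'M[R]_(m, n) N.
Proof.
refine (@Coords _ _ (fun=> True) (fun u => \matrix_(i, j) ldec (allp m n) u (i, j))
   (fun X => lenc (allp m n) (xm, xn) N (fun x => X x.1 x.2)) _ _ _ _ _).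
- by move=> a u v; apply/matrixP=> i j; rewrite !mxE ldecP.
- by move=> a u v; apply: lencP => x; rewrite !mxE.
- by move=> u; apply: ldecK => // [|[i j] _]; rewrite ?mxE ?allp_uniq.
- by move=> X _; apply/matrixP=> i j; rewrite mxE lencK ?mem_allp ?allp_uniq.
- by [].
Defined.

Definition symC N (hN : N = size (symp n)) : coords 'M[R]_n N.
Proof.
refine (@Coords _ _ (fun X => X^T = X) (fun u => symof (ldec (symp n) u))
   (fun X => lenc (symp n) (xn, xn) N (fun x => X x.1 x.2)) _ _ _ _ _).
- by move=> a u v; apply/matrixP=> i j; rewrite !mxE ldecP.
- by move=> a u v; apply: lencP => x; rewrite !mxE.
- move=> u; apply: ldecK => // [|[i j]]; first exact: symp_uniq.
by rewrite mem_symp mxE /= => ->.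
- move=> X sX; apply/matrixP=> i j; rewrite mxE lencK ?symp_uniq //.
  by case: leqP => //= _; rewrite -{1}sX mxE.
by case: leqP => h; rewrite mem_symp // ltnW.
- move=> u; apply/matrixP=> i j; rewrite !mxE; case: ltngtP => // h.
by rewrite (val_inj h).
Defined.

Hypothesis dbl0 : forall x : R, x + x = 0 -> x = 0.

Definition altC N (hN : N = size (altp n)) : coords 'M[R]_n N.
Proof.
refine (@Coords _ _ (fun X => X^T = - X) (fun u => altof (ldec (altp n) u))
   (fun X => lenc (altp n) (xn, xn) N (fun x => X x.1 x.2)) _ _ _ _ _).
- move=> a u v; apply/matrixP=> i j; rewrite !mxE !ldecP; case: ifP => // _.
by case: ifP => // _; rewrite ?mulr0 ?addr0 // opprD mulrN.
- by move=> a u v; apply: lencP => x; rewrite !mxE.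
- move=> u; apply: ldecK => // [|[i j]]; first exact: altp_uniq.
by rewrite mem_altp mxE /= => ->.
- move=> X sX; apply/matrixP=> i j; have e : X j i = - X i j.
  by have /matrixP/(_ i j) := sX; rewrite !mxE.
rewrite mxE; case: ltngtP => h; rewrite ?lencK ?altp_uniq ?mem_altp //= ?e ?opprK //.
(* On the diagonal X^T = - X only says that twice the entry is 0. *)
have ij := val_inj h; subst j; apply/esym/dbl0; by rewrite {1}e addNr.
- by move=> u; apply/matrixP=> i j; rewrite !mxE; case: ltngtP => // h; rewrite ?opprK ?oppr0.
Defined.
End ModCoords.

End Coords.

Lemma exists_notin (T : finType) (s : seq T) : (size s < #|T|)%N -> exists x, x \notin s.
Proof.
move=> h; have [x xs|all_s] := pickP [pred x | x \notin s]; first by exists x.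
have : (#|T| <= #|s|)%N by apply: subset_leq_card; apply/subsetP => x _; have /negbFE := all_s x.
by move/leq_trans/(_ (card_size s)); rewrite leqNgt h.
Qed.

(** * Regular sequences on M *)

Section KillPow.
Variable R : comNzRingType.

(** The auxiliary list [s] holds the indices whose exponent may still exceed 1. For its head i the
    exponent is lowered by passing from u to d_i u; [K] carries side conditions that survive this
    multiplication. *)
Lemma kill_pow (V : lmodType R) (J : finType) (d : J -> R) (N K : V -> Prop) :
  (forall a u, N u -> N (a *: u)) -> (forall a u, K u -> K (a *: u)) ->
  (forall u, K u -> (forall j, N (d j *: u)) -> N u) ->
  forall u, K u -> (forall j, exists n, N (d j ^+ n *: u)) -> N u.
Proof.
move=> sN sK h u Ku hu.
suff H (s : seq J) : forall u, K u -> (forall j, exists n, N (d j ^+ n *: u)) ->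
    (forall j, j \notin s -> N (d j *: u)) -> N u.
  by apply: (H (enum J)) => // j; rewrite mem_enum.
elim: s => [|i s IH] {hu}u {}Ku hu hs; first by apply: h => // j; apply: hs.
have [n] := hu i; elim: n => [|n IHn] in u Ku hu hs *; first by rewrite scale1r.
rewrite exprSr -scalerA => /(IHn (d i *: u)) H; apply: IH => // j js.
have [->|ji] := eqVneq j i; last by apply: hs; rewrite inE negb_or ji.
apply: H => [|k|k ks]; first exact: sK.
- by have [m hm] := hu k; exists m; rewrite scalerA mulrC -scalerA; apply: sN.
- by rewrite scalerA mulrC -scalerA; apply/sN/hs.
Qed.

(* Cramer's rule for a linear form on the columns [g] and one more column. *)
Lemma minor_step m t r (A : 'M[R]_(m, t)) (f : 'I_r -> 'I_m) (g : 'I_r -> 'I_t) :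
  (r < t)%N -> exists v : 'cV[R]_t,
   (exists i, v i 0 = \det (mxsub f g A)) /\
   (forall k, exists f' : 'I_r.+1 -> 'I_m, exists g', (A *m v) k 0 = \det (mxsub f' g' A)).
Proof.
move=> rt; have [i ig] : exists i, i \notin codom g.
  by apply: exists_notin; rewrite size_codom !card_ord.
pose ext (T : Type) x (h : 'I_r -> T) c := if unlift (ord0 : 'I_r.+1) c is Some c' then h c' else x.
have ext0 T x (h : 'I_r -> T) : ext T x h ord0 = x by rewrite /ext unlift_none.
have extS T x (h : 'I_r -> T) c : ext T x h (lift ord0 c) = h c by rewrite /ext liftK.
pose M k := mxsub (ext _ k f) (ext _ i g) A.
(* The cofactors along the new first row; they do not depend on the row [k] put there, so one vector
   [v] serves all [k]. *)
pose kap (c : 'I_r.+1) := (-1) ^+ (0 + c) * \det (\matrix_(a < r, b < r) A (f a) (ext _ i g (lift c b))).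
have kapE k (c : 'I_r.+1) : cofactor (M k) ord0 c = kap c.
  by rewrite /cofactor; congr (_ * \det _); apply/matrixP=> a b; rewrite !mxE extS.
exists (\col_l \sum_(c < r.+1) kap c *+ (l == ext _ i g c)); split.
  exists i; rewrite mxE big_ord_recl ext0 eqxx big1 ?addr0 => [|c _].
    rewrite /kap mulr1n mul1r; congr (\det _); apply/matrixP=> a b.
    by rewrite !mxE extS.
  by rewrite extS; case: eqP => // e; case/negP: ig; rewrite e codom_f.
move=> k; exists (ext _ k f), (ext _ i g); rewrite -/(M k) (expand_det_row _ ord0) mxE.
under eq_bigr do rewrite mxE mulr_sumr; rewrite exchange_big /=; apply: eq_bigr => c _.
rewrite kapE mxE ext0 (bigD1 (ext _ i g c)) //= eqxx mulr1n big1 ?addr0 // => l /negPf->.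
by rewrite mulr0.
Qed.

End KillPow.

Section Submodules.
Variables (R : comNzRingType) (n : nat).
Record submod (N : 'cV[R]_n -> Prop) : Prop := Submod {
  submod0 : N 0;
  submodD : forall u v, N u -> N v -> N (u + v);
  submodZ : forall a u, N u -> N (a *: u) }.

Lemma submodN (N : 'cV[R]_n -> Prop) u : submod N -> N u -> N (- u).
Proof. by move=> sN Nu; rewrite -scaleN1r; apply: submodZ. Qed.
Lemma submodB (N : 'cV[R]_n -> Prop) u v : submod N -> N u -> N v -> N (u - v).
Proof. by move=> sN Nu Nv; apply: submodD => //; apply: submodN. Qed.

Lemma submod_sum (N : 'cV[R]_n -> Prop) (J : finType) (F : J -> 'cV_n) :
  submod N -> (forall i, N (F i)) -> N (\sum_i F i).
Proof. by move=> sN h; elim/big_rec: _ => [|i x _ Nx]; [apply: submod0|apply: submodD]. Qed.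

Lemma submod_addM (N : 'cV[R]_n -> Prop) y : submod N -> submod (addM N y).
Proof.
move=> sN; split=> [|u v [w hw] [z hz]|a u [w hw]].
- by exists 0; rewrite scaler0 subr0; apply: submod0.
- by exists (w + z); rewrite scalerDr opprD addrACA; apply: submodD.
- by exists (a *: w); rewrite scalerA mulrC -scalerA -scalerBr; apply: submodZ.
Qed.

Lemma submod_addMs (N : 'cV[R]_n -> Prop) ys : submod N -> submod (addMs N ys).
Proof. by elim: ys N => //= y s IH N sN; apply/IH/submod_addM. Qed.

Lemma addM_sub (N : 'cV[R]_n -> Prop) y u : submod N -> N u -> addM N y u.
Proof. by move=> sN Nu; exists 0; rewrite scaler0 subr0. Qed.

Lemma addMs_sub (N : 'cV[R]_n -> Prop) ys u : submod N -> N u -> addMs N ys u.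
Proof.
elim: ys N => //= y s IH N sN Nu; apply: IH; first exact: submod_addM.
exact: addM_sub.
Qed.

Lemma addMs_mem (N : 'cV[R]_n -> Prop) ys y u : submod N -> y \in ys -> addMs N ys (y *: u).
Proof.
elim: ys N => //= z s IH N sN; rewrite inE => /orP[/eqP->|ys].
  apply: addMs_sub; first exact: submod_addM.
  by exists u; rewrite subrr; apply: submod0.
by apply: IH => //; apply: submod_addM.
Qed.

Lemma addMs_rcons (N : 'cV[R]_n -> Prop) ys y : addMs N (rcons ys y) = addM (addMs N ys) y.
Proof. by rewrite /addMs foldl_rcons. Qed.

Lemma mchain_rcons (N : 'cV[R]_n -> Prop) ys y :
  mchain N (rcons ys y) <-> mchain N ys /\ mreg (addMs N ys) y.
Proof.
elim: ys N => [|z s IH] N /=; first tauto.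
by split=> [[h /IH[]]|[[h1 h2] h3]] //; split=> //; apply/IH.
Qed.
End Submodules.

(** * The two resolutions, and regular sequences passing from R/I_t to M *)

Section Resolutions.
Variables (R : comNzRingType) (half : R) (halfP : half + half = 1).
Variables (t : nat) (phi : 'M[R]_(t.+2, t)) (i0 : 'I_t).
Local Notation Om := (Om phi).
Hypothesis phi_inj : forall m (v : 'M_(t, m)), phi *m v = 0 -> v = 0.
Hypothesis Om_exact : forall m (g : 'M_(t.+2, m)), Om *m g = 0 -> exists w, g = phi *m w.
Hypothesis trphi_exact : forall m (g : 'M_(t.+2, m)), phi^T *m g = 0 -> exists w, g = Om *m w.

Definition NM (v : 'cV[R]_t) := exists w, v = phi^T *m w.

Lemma submod_NM : submod NM.
Proof.
split=> [|u v [w ->] [z ->]|a u [w ->]]; first by exists 0; rewrite mulmx0.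
  by exists (w + z); rewrite mulmxDr.
by exists (a *: w); rewrite -scalemxAr.
Qed.

Lemma inI_NM x u : inI phi x -> NM (x *: u).
Proof.
case/(inI_alt halfP) => K _ ->; exists ((psiK half phi K)^T *m u).
by rewrite mulmxA -trmx_mul psiK_phi tr_scalar_mx mul_scalar_mx.
Qed.

Definition BR := Cplx (rk := fun i => match i with 0 => t | 1 | 2 => t.+2 | 3 => t | _ => 0 end)
  (fun i => match i with 0 => phi^T | 1 => Om | 2 => phi | _ => 0 end).

Lemma exact_BR : exact_cplx BR.
Proof.
case=> [|[|[|i]]]; split=> /=.
- exact: trphi_Om.
- by move=> m v /trphi_exact.
- exact: Om_phi.
- by move=> m v /Om_exact.
- exact: mulmx0.
- by move=> m v /phi_inj ->; exists 0; rewrite mulmx0.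
- by rewrite mulmx0.
- by move=> m v _; exists 0; rewrite [v]flatmx0 mulmx0.
Qed.

Lemma resolves_BR : resolves 3 NM.
Proof.
exists BR; split; first exact: exact_BR.
  by move=> [|[|[|[|i]]]].
by exists erefl => v; rewrite castmx_id.
Qed.

Lemma dbl0 (x : R) : x + x = 0 -> x = 0. Proof. exact: (dbl_eq0r halfP). Qed.

Let cE0 : coords 'cV[R]_1 1.
Proof. by refine (@Coords _ _ _ (fun=> True) id id _ _ _ _ _). Defined.
Let cE1 := altC (ord0 : 'I_t.+2) dbl0 erefl.
Let cE2 := @fullC R t.+2 t ord0 i0 _ erefl.
Let cE3 := @symC R t i0 _ erefl.

Let e0 (K : 'M[R]_t.+2) : 'cV[R]_1 := (om half phi K)%:M.
Let e1 (V : 'M[R]_(t.+2, t)) := V *m phi^T - phi *m V^T.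

Let lin_e0 : linear e0.
Proof.
move=> a u v; rewrite /e0 /om mulmxDl -scalemxAl mxtraceD mxtraceZ mulrDr mulrCA.
by apply/matrixP=> i j; rewrite !mxE !(ord1 _) !mulr1n.
Qed.
Let lin_e1 : linear e1.
Proof.
move=> a u v; rewrite /e1 linearP /= mulmxDl mulmxDr -scalemxAl -scalemxAr scalerBr.
by rewrite opprD addrACA.
Qed.
Let lin_e2 : linear (mulmx phi : 'M_t -> _).
Proof. by move=> a u v; rewrite mulmxDr -scalemxAr. Qed.

(** The Eagon-Northcott complex of R/I_t: after R come the second exterior power of G, G (x) F and
    S_2 F, realized as alternating, arbitrary and symmetric matrices. *)
Definition EN := Cplx (rk := fun i => match i with 0 => 1 | 1 => size (altp t.+2)
    | 2 => size (allp t.+2 t) | 3 => size (symp t) | _ => 0 end)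
  (fun i => match i with 0 => lin_mx_of cE1 cE0 e0 | 1 => lin_mx_of cE2 cE1 e1
    | 2 => lin_mx_of cE3 cE2 (mulmx phi) | _ => 0 end).

Let alt_e1 V : (e1 V)^T = - e1 V.
Proof. by rewrite /e1 linearB /= !trmx_mul !trmxK opprB. Qed.

Let e01 V : e0 (e1 V) = 0.
Proof.
rewrite /e0 /e1 /om mulmxBl -mulmxA trphi_Om mulmx0 sub0r raddfN /= mxtrace_mulC mulmxA.
by rewrite Om_phi mul0mx mxtrace0 oppr0 mulr0 scalar_mx0.
Qed.

Lemma exact_EN : exact_cplx EN.
Proof.
have cV m n p (A : 'M[R]_(m, n)) (B : 'M_(n, p)) :
    (forall v : 'cV_n, A *m v = 0 -> exists w, v = B *m w) ->
    forall q (v : 'M_(n, q)), A *m v = 0 -> exists w, v = B *m w.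
  move=> h q v e; apply: exists_mul_col => j; apply: h.
  by rewrite colE mulmxA e mul0mx.
case=> [|[|[|i]]]; split=> /=.
- by apply: lin_mx_comp0 => //= *; rewrite ?alt_e1 ?e01.
- apply: cV => v; apply: (proj1 (lin_mx_exact lin_e0 lin_e1 _ _ _ _ v)) => //= Y aY.
  move=> /matrixP/(_ 0 0); rewrite !mxE mulr1n => h.
  have [|V ->] := alt_trace_exact halfP Om_exact trphi_exact aY; last by exists V.
  by rewrite -[LHS](mul1r) -halfP mulrDl -/(om half phi Y) h addr0.
- by apply: lin_mx_comp0 => //= T sT; rewrite /e1 trmx_mul sT mulmxA subrr.
- apply: cV => v; apply: (proj1 (lin_mx_exact lin_e1 lin_e2 _ _ _ _ v)) => //= [T sT|V _].
  + by rewrite /e1 trmx_mul sT mulmxA subrr.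
  + by move/eqP; rewrite subr_eq0 => /eqP/(sym_exact phi_inj Om_exact)[T sT ->]; exists T.
- exact: mulmx0.
- apply: cV => v /(lin_mx_of_eq0 lin_e2)/= h; exists 0; rewrite mulmx0.
  have e : dec cE3 v = 0 := phi_inj (h (fun _ _ => I)).
  by rewrite -[v](decK cE3) e (linear_f0 (@enc_lin _ _ _ cE3)).
- by rewrite mulmx0.
- by move=> m v _; exists 0; rewrite [v]flatmx0 mulmx0.
Qed.

Lemma imdf_EN : eqM (fun v : 'cV_1 => inI phi (v 0 0)) (@imdf _ EN).
Proof.
move=> v; split=> [/(inI_alt halfP)[K aK e]|[w ->]]; last first.
  by rewrite mul_lin_mx_of // /= mxE; apply: inI_om.
exists (enc cE1 K); rewrite mul_lin_mx_of // (encK (c := cE1)) //=.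
by apply/matrixP=> i j; rewrite !(ord1 _) mxE e.
Qed.

Lemma mchain_entry (P : R -> Prop) ys : regchain P ys ->
  mchain (fun v : 'cV_1 => P (v 0 0)) ys.
Proof.
elim: ys P => //= y s IH P [h1 /IH h2]; split.
  by move=> v; rewrite mxE mulrC; apply: h1.
apply: eqM_mchain h2 => v; split=> [[c hc]|[w hw]].
  by exists c%:M; rewrite !mxE mulr1n mulrC.
by exists (w 0 0); rewrite mulrC; move: hw; rewrite !mxE.
Qed.

(** Two rows j, l are missed by [f]. Selecting the rows j, l, f of [e_j | e_l | phi] gives a block
    triangular matrix with the minor in its corner, and multiplicativity of the determinant replaces
    a Laplace expansion with signs. *)
Lemma minor_inI (f : 'I_t -> 'I_t.+2) (g : 'I_t -> 'I_t) : inI phi (\det (mxsub f g phi)).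
Proof.
have [j jf] : exists j, j \notin codom f by apply: exists_notin; rewrite size_codom !card_ord.
have [l] : exists l, l \notin j :: codom f.
  by apply: exists_notin; rewrite /= size_codom !card_ord.
rewrite inE negb_or => /andP[lj lf].
have -> : mxsub f g phi = rowsub f phi *m colsub g 1%:M.
  by rewrite -mxsub_mul mulmx1.
rewrite det_mulmx; apply: idealMr; first exact: ideal_inI.
pose P : 'M[R]_(1 + 1 + t, t.+2) := col_mx (col_mx (ev R j)^T (ev R l)^T) (rowsub f 1%:M).
suff e : P *m bordered (ev R j) (ev R l) phi = block_mx 1%:M
    (col_mx ((ev R j)^T *m phi) ((ev R l)^T *m phi)) 0 (rowsub f phi).
  have := congr1 determinant e; rewrite det_ublock det1 mul1r => <-.
  rewrite (@det_mulmx _ t.+2 P (bordered (ev R j) (ev R l) phi)).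
  apply: idealM; first exact: ideal_inI.
  by have := inI_Om phi j l; rewrite mxE.
have ee a b : (ev R a)^T *m ev R b = ((a == b)%:R)%:M.
  rewrite trmx_delta mul_delta_mx_cond; apply/matrixP=> x y.
  by rewrite (ord1 x) (ord1 y); case: (a == b); rewrite !mxE ?eqxx.
have fe a : a \notin codom f -> rowsub f 1%:M *m ev R a = 0.
  move=> af; apply/matrixP=> x y; rewrite -colE !mxE.
  by case: eqP => // e; case/negP: af; rewrite -e codom_f.
rewrite /P /bordered mul_col_row mul_col_row mul_col_mx mul_mx_row !fe // !ee !eqxx.
rewrite (negPf lj) eq_sym (negPf lj) !scalar_mx0 mul_rowsub_mx mul1mx row_mx0; congr block_mx.
exact/esym/(@scalar_mx_block _ 1 1).
Qed.

Section Step.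
Variables (ys : seq R) (y : R).
Hypotheses (ry : regchain (inI phi) (rcons ys y)) (mys : mchain NM ys).
Let N := addMs NM ys.
Let sN : submod N. Proof. exact/submod_addMs/submod_NM. Qed.

(* [v v^T (x) u] is a cycle of S_2 F (x) M/(ys)M as soon as the entries of [phi v] kill [u]. *)
Lemma sq_kill (u v : 'cV_t) : (forall z, z \in rcons ys y -> N (z *: u)) ->
  (forall j, N ((phi *m v) j 0 *: u)) -> forall i, N (v i 0 ^+ 2 *: u).
Proof.
move=> hu hv i; have sv : (v *m v^T)^T = v *m v^T by rewrite trmx_mul trmxK.
have rowE m (w : 'cV_m) k : (row k (w *m u^T))^T = w k 0 *: u.
  by apply/matrixP=> a b; rewrite (ord1 b) !mxE big_ord1 !mxE.
have zE4 i' : (3 < i')%N -> rk EN i' = 0%N by case: i' => [|[|[|[|]]]].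
have H := top_injective resolves_BR mys exact_EN zE4
  (eqM_mchain imdf_EN (mchain_entry ry)).
have {}H : rowsin N (enc cE3 (v *m v^T) *m u^T).
  apply: H => [z zs k|k].
    by rewrite scalemxAl rowE mxE -scalerA scalerA mulrC -scalerA; apply/(submodZ sN)/hu.
  rewrite [pdf _ _]/= mulmxA mul_lin_mx_of // (encK (c := cE3)) // rowE mxE /=.
  by rewrite mulmxA mxE big_ord1 mulrC -scalerA; apply/(submodZ sN)/hv.
have iS : (i, i) \in symp t by rewrite mem_symp.
have h : (index (i, i) (symp t) < size (symp t))%N by rewrite index_mem.
have := H (Ordinal h); rewrite rowE mxE /= nth_index //= mxE big_ord1 mxE.
by [].
Qed.

(* McCoy's argument: no nonzero element killed by [(ys, y)] is killed by the r-minors, by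
   induction on r; at r = t all elements are killed by the maximal minors. *)
Lemma mreg_step : mreg N y.
Proof.
move=> u hu; have {}hu z : z \in rcons ys y -> N (z *: u).
  rewrite mem_rcons inE => /orP[/eqP->//|zs].
  by apply: addMs_mem => //; apply: submod_NM.
suff H r : (r <= t)%N -> forall u, (forall z, z \in rcons ys y -> N (z *: u)) ->
    (forall (f : 'I_r -> 'I_t.+2) (g : 'I_r -> 'I_t), N (\det (mxsub f g phi) *: u)) -> N u.
  apply: (H t) => // f g; apply: addMs_sub; first exact: submod_NM.
  by apply: inI_NM; apply: minor_inI.
elim: r => [|r IH] rt {hu}u hu hr.
  (* The empty minor is 1. *)
  by have := hr (fun=> ord0) (fun=> i0); rewrite det_mx00 scale1r.
pose K u := (forall z, z \in rcons ys y -> N (z *: u)) /\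
  (forall (f : 'I_r.+1 -> 'I_t.+2) (g : 'I_r.+1 -> 'I_t), N (\det (mxsub f g phi) *: u)).
pose d (fg : {ffun 'I_r -> 'I_t.+2} * {ffun 'I_r -> 'I_t}) := \det (mxsub fg.1 fg.2 phi).
have cZ a b (w : 'cV[R]_t) : N (b *: w) -> N (b *: (a *: w)).
  by move=> h; rewrite scalerA mulrC -scalerA; apply: submodZ.
apply: (kill_pow (d := d) (N := N) (K := K)) => // [a w|a w [h1 h2]|w [h1 h2] h|[f g]].
- exact: submodZ.
- by split=> *; apply: cZ; auto.
- apply: (IH (ltnW rt)) => // f g; have := h ([ffun x => f x], [ffun x => g x]).
  rewrite /d /=; congr (N (\det _ *: _)); apply/matrixP=> i j; by rewrite !mxE !ffunE.
have [v [[i vi] hv]] := minor_step phi f g rt.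
(* The r-minor is the entry [v i 0], and [sq_kill] controls its square; the entries of [phi *m v]
   are (r+1)-minors. *)
exists 2; rewrite /d /= -vi; apply: sq_kill => // j.
by have [f' [g' ->]] := hv j.
Qed.
End Step.

Lemma mchain_NM ys : regchain (inI phi) ys -> mchain NM ys.
Proof.
have pre (P : R -> Prop) s y : regchain P (rcons s y) -> regchain P s.
  by elim: s P => //= z s IH P [h1 /IH h2].
elim/last_ind: ys => // s y IH h; apply/mchain_rcons; have ms := IH (pre _ _ _ h).
by split=> //; apply: mreg_step.
Qed.

End Resolutions.

(** * Endomorphisms of M *)

Section RankOne.
Variables (R : comNzRingType) (t : nat).

Definition dotp (w m : 'cV[R]_t) : R := (w^T *m m) 0 0.

Lemma dotpD w m m' : dotp w (m + m') = dotp w m + dotp w m'.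
Proof. by rewrite /dotp mulmxDr mxE. Qed.
Lemma dotpZ w a m : dotp w (a *: m) = a * dotp w m.
Proof. by rewrite /dotp -scalemxAr mxE. Qed.
Lemma dotpB w m m' : dotp w (m - m') = dotp w m - dotp w m'.
Proof. by rewrite -scaleN1r dotpD dotpZ mulN1r. Qed.

(* R^t/N looks locally like R/P: at each [sg j], the maps [dotp (w j)] and [1 |-> e j] are
   inverse to each other up to the factor [sg j]. *)
Variables (J : finType) (sg : J -> R) (e w : J -> 'cV[R]_t).
Variables (P : R -> Prop) (N : 'cV[R]_t -> Prop).
Hypotheses (iP : ideal P) (sN : submod N).
Hypothesis PN : forall z m, P z -> N (z *: m).
Hypothesis hdec : forall j m, N (sg j *: m - dotp (w j) m *: e j).
Hypothesis hdot : forall j m, N m -> P (dotp (w j) m).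
Hypothesis hdote : forall j, P (dotp (w j) (e j) - sg j).
Hypothesis tP : forall z, (forall j, exists n, P (sg j ^+ n * z)) -> P z.
Hypothesis tN : forall m, (forall j, exists n, N (sg j ^+ n *: m)) -> N m.

(** Modulo P, [sg l] times any of the forms is its value at [e l] times the form of index l.
    Replacing both factors costs [sg l ^+ 2], which [tP] removes. *)
Lemma dotp_comm j k m m' : P (dotp (w j) m * dotp (w k) m' - dotp (w j) m' * dotp (w k) m).
Proof.
apply: tP => l; exists 2.
have H i x : P (sg l * dotp (w i) x - dotp (w l) x * dotp (w i) (e l)).
  by have := hdot i (hdec l x); rewrite dotpB !dotpZ.
pose d i x := sg l * dotp (w i) x - dotp (w l) x * dotp (w i) (e l).
have -> : sg l ^+ 2 * (dotp (w j) m * dotp (w k) m' - dotp (w j) m' * dotp (w k) m) =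
  (sg l * dotp (w k) m') * d j m + (dotp (w l) m * dotp (w j) (e l)) * d k m'
  - ((sg l * dotp (w k) m) * d j m' + (dotp (w l) m' * dotp (w j) (e l)) * d k m).
  by rewrite /d; ring.
by apply: idealB => //; apply: idealD => //; apply: idealM => //; apply: H.
Qed.

Lemma faithful b : (forall m, N (b *: m)) -> P b.
Proof.
move=> h; apply: tP => j; exists 1; rewrite expr1 mulrC.
have := hdot j (h (e j)); rewrite dotpZ => hb.
have -> : b * sg j = b * dotp (w j) (e j) - b * (dotp (w j) (e j) - sg j) by ring.
by apply: idealB => //; apply: idealM.
Qed.

Variable F : 'M[R]_t.
Hypothesis hF : forall m, N m -> N (F *m m).

(* [sg j F] and a scalar agree on [e j], hence on all of R^t/N because it has rank one. *)
Lemma local_homothety j m : N (sg j *: (F *m m) - dotp (w j) (F *m e j) *: m).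
Proof.
have h1 : N (sg j *: (F *m m) - dotp (w j) m *: (F *m e j)).
  by have := hF (hdec j m); rewrite mulmxBr -!scalemxAr.
suff h2 : N (dotp (w j) m *: (F *m e j) - dotp (w j) (F *m e j) *: m).
  by have := submodD sN h1 h2; rewrite addrA subrK.
apply: tN => k; exists 1; rewrite expr1.
set x := _ - _; rewrite -[_ *: x](subrK (dotp (w k) x *: e k)).
apply: submodD => //; apply: PN; rewrite /x dotpB !dotpZ.
exact: dotp_comm.
Qed.

Definition gens (y : R) := exists c : J -> R, y = \sum_j c j * sg j.

(** On R^t/N both y F and y' F are scalars b and b'. Faithfulness gives y' b = y b' modulo P, so b =
    c y modulo P by regularity of y' modulo y; then y (F - c) = 0 and y cancels. *)
Lemma homothety y y' : gens y -> gens y' -> regm P y -> regm (addI P y) y' -> mreg N y ->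
  exists b, forall m, N (F *m m - b *: m).
Proof.
have H z : gens z -> exists b, forall m, N (z *: (F *m m) - b *: m).
  case=> c ->; exists (\sum_j c j * dotp (w j) (F *m e j)) => m.
  rewrite !scaler_suml -sumrB; apply: submod_sum => // j.
  by rewrite -!scalerA -scalerBr; apply: submodZ => //; apply: local_homothety.
move=> /H[b hb] /H[b' hb'] ry ry' rN.
have [c hc] : addI P y b.
  apply: ry'; exists b'; apply: faithful => m.
  have := submodB sN (submodZ sN y (hb' m)) (submodZ sN y' (hb m)).
  rewrite !scalerBr !scalerA [y' * y]mulrC opprB addrCA [X in N (_ + X)]addrAC subrr.
  by rewrite sub0r scalerBl [y * b']mulrC [b * y']mulrC.
exists c => m; apply: rN; rewrite scalerBr scalerA.
have -> : y *: (F *m m) - (y * c) *: m = (y *: (F *m m) - b *: m) + (b - c * y) *: m.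
  by rewrite scalerBl addrA subrK mulrC.
by apply: submodD => //; apply: PN.
Qed.
End RankOne.

(** * The structure of M and coker(phi) up to a (t-1)-minor *)

Section Sigma.
Variable R : comNzRingType.
Variables (t : nat) (phi : 'M[R]_(t.+2, t)).

Section Local.
Variables (i : 'I_t) (u p q : 'cV[R]_t.+2).
Let A := colset i u phi.
Let sg := tau i u p q phi.
Let rho := bordered_adj p q A.
Let e : 'cV[R]_t := delta_mx i 0.
(** It is read off from rho A = sg, where A differs from phi in column i only: this gives rho phi =
    sg - sgw e^T. Hence sg m and (sgw . m) e agree in M. *)
Definition sgw : 'cV[R]_t := tau i u p q phi *: delta_mx i 0 - bordered_adj p q (colset i u phi) *m col i phi.

Lemma rho_u : rho *m u = sg *: e.
Proof.
apply/matrixP=> k l; rewrite (ord1 l) bpsi_tau !mxE eqxx andbT.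
have {1}-> : u = col i A by apply/matrixP=> a b; rewrite !mxE eqxx (ord1 b).
by rewrite tau_col mulr_natr.
Qed.

Lemma bdet_inI p' q' : inI phi (bordered_det p' q' phi).
Proof.
rewrite bdet_Om mxE; apply: ideal_sum; [exact: ideal_inI|] => k _.
apply: idealMr; [exact: ideal_inI|]; exact: (inmxMl (ideal_inI phi) _ (inI_Om phi)).
Qed.

Let A_mul (x : 'cV_t) : A *m x = phi *m x + x i 0 *: (u - col i phi).
Proof.
rewrite /A colsetE mulmxDl -mulmxA -rowE; congr (_ + _).
by rewrite [row i x]mx11_scalar mul_mx_scalar mxE.
Qed.

Let rho_i v : (rho *m v) i 0 = tau i v p q phi.
Proof. by rewrite bpsi_tau /tau colset_colset. Qed.

Let cramerA v : sg *: v = tau i u v q phi *: p + tau i u p v phi *: q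
  + (phi *m (rho *m v) + tau i v p q phi *: (u - col i phi)).
Proof. by rewrite -rho_i -A_mul bdet_cramer. Qed.

Lemma local_cramer v : exists z, sg *: v = phi *m z + tau i v p q phi *: u
  + tau i u v q phi *: p + tau i u p v phi *: q.
Proof.
exists (rho *m v - tau i v p q phi *: e); rewrite cramerA.
rewrite mulmxBr -scalemxAr -colE scalerBr addrC -!addrA; congr (_ + _).
by rewrite addrCA.
Qed.

Let eA : A = phi + (u - col i phi) *m delta_mx 0 i.
Proof. exact: colsetE. Qed.

Lemma sg_decomp : phi^T *m rho^T + e *m sgw^T = sg%:M.
Proof.
apply: trmx_inj; rewrite linearD /= !trmx_mul !trmxK tr_scalar_mx.
transitivity (rho *m A); last exact: bpsi_mul.
by rewrite eA mulmxDr mulmxA mulmxBr rho_u trmx_delta.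
Qed.

(** By Cramer's rule for v = [col i phi], the product is a combination of vectors whose coefficients
    are [tau] with v among its arguments; moving v back into column i turns each into a bordered
    determinant of phi itself. So [dotp sgw] is defined on M with values in R/I_t. *)
Lemma phi_sgw : inmx (inI phi) (phi *m sgw).
Proof.
have I0 := ideal_inI phi; pose v := col i phi.
have Iv x y : inI phi (tau i v x y phi).
  by rewrite /tau /v colset_id; apply: bdet_inI.
have -> : phi *m sgw = tau i u v q phi *: p + tau i u p v phi *: q
    + tau i v p q phi *: (u - v).
  rewrite /sgw mulmxBr -scalemxAr -colE -/v -/sg cramerA -/v.
  by rewrite [phi *m _ + _]addrC addrA addrK.
apply: inmxD => //; first apply: inmxD => // a b.
- by rewrite mxE tau_swap; apply: idealMr => //; apply: idealN.
- rewrite mxE {1}/tau bdet_swap -/(tau i u v p phi) tau_swap opprK.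
  exact: idealMr.
by move=> a b; rewrite mxE; apply: idealMr.
Qed.

Lemma sgw_e : inI phi (dotp sgw e - sg).
Proof.
have -> : dotp sgw e = sg - (rho *m col i phi) i 0.
  by rewrite /dotp -colE !mxE !eqxx mulr1.
rewrite addrC addKr; apply: (idealN (ideal_inI phi)).
by rewrite rho_i /tau colset_id; apply: bdet_inI.
Qed.

Lemma sg_NM m : NM phi (sg *: m - dotp sgw m *: e).
Proof.
exists (rho^T *m m); rewrite -mul_scalar_mx -sg_decomp mulmxDl -!mulmxA.
rewrite [sgw^T *m m]mx11_scalar mul_mx_scalar addrK //.
Qed.

Lemma sgw_NM m : NM phi m -> inI phi (dotp sgw m).
Proof.
case=> g ->; rewrite /dotp mulmxA -trmx_mul.
exact: (inmxMr (ideal_inI phi) g (inmxT phi_sgw) 0 0).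
Qed.
End Local.
End Sigma.

Section AddIs.
Variable R : comNzRingType.
Definition addIs (P : R -> Prop) ys := foldl (@addI R) P ys.

Lemma ideal_addIs P ys : ideal P -> ideal (addIs P ys).
Proof. by elim: ys P => //= y s IH P iP; apply/IH/ideal_addI. Qed.

Lemma addIs_sub P ys x : ideal P -> P x -> addIs P ys x.
Proof. by elim: ys P => //= y s IH P iP Px; apply: IH; [exact: ideal_addI|exact: addI_sub]. Qed.

Lemma addIs_rcons P ys y : addIs P (rcons ys y) = addI (addIs P ys) y.
Proof. by rewrite /addIs foldl_rcons. Qed.

Lemma addMs_scale n (P : R -> Prop) (N : 'cV[R]_n -> Prop) ys : 
  (forall z m, P z -> N (z *: m)) -> forall z m, addIs P ys z -> addMs N ys (z *: m).
Proof.
elim: ys P N => //= y s IH P N h; apply: IH => z m [c hc].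
by exists (c *: m); rewrite scalerA mulrC -scalerBl; apply: h.
Qed.

Lemma addMs_dotp n (P : R -> Prop) (N : 'cV[R]_n -> Prop) ys w :
  (forall m, N m -> P (dotp w m)) -> forall m, addMs N ys m -> addIs P ys (dotp w m).
Proof.
elim: ys P N => //= y s IH P N h; apply: IH => m [m' hm].
by exists (dotp w m'); rewrite mulrC -dotpZ -dotpB; apply: h.
Qed.

Lemma addMs_split n (N : 'cV[R]_n -> Prop) ys m : submod N ->
  addMs N ys m <-> exists2 m0, N m0 & inmx (addIs (@zero_ideal R) ys) (m - m0).
Proof.
move=> sN; elim/last_ind: ys m => [|ys y IH] m.
  split=> [Nm|[m0 Nm0 /inmx_zero/eqP]]; first by exists m; rewrite ?subrr //; apply/inmx_zero.
  by rewrite subr_eq0 => /eqP->.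
rewrite addMs_rcons addIs_rcons; split=> [[m' /IH[m0 Nm0 h]]|[m0 Nm0 /inmx_addI[m' h]]].
  by exists m0 => // i j; exists (m' i j); have := h i j; rewrite !mxE addrAC mulrC.
by exists m'; apply/IH; exists m0 => //; rewrite addrAC.
Qed.
End AddIs.

Section Depth.
Variables (R : comNzRingType) (half : R) (halfP : half + half = 1).
Variables (t : nat) (phi : 'M[R]_(t.+2, t)).
Local Notation Om := (Om phi).
Hypothesis trphi_exact : forall m (g : 'M_(t.+2, m)), phi^T *m g = 0 -> exists w, g = Om *m w.

Definition sgt := ('I_t * 'I_t.+2 * 'I_t.+2 * 'I_t.+2)%type.
Definition sgx (x : sgt) : R :=
  tau x.1.1.1 (ev R x.1.1.2) (ev R x.1.2) (ev R x.2) phi.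
Definition sgxe (x : sgt) : 'cV[R]_t := delta_mx x.1.1.1 0.
Definition sgxw (x : sgt) : 'cV[R]_t :=
  sgw phi x.1.1.1 (ev R x.1.1.2) (ev R x.1.2) (ev R x.2).

Lemma torsion_free (V : lmodType R) (N : V -> Prop) y : N 0 ->
  (forall u v, N u -> N v -> N (u + v)) -> (forall a u, N u -> N (a *: u)) ->
  gens sgx y -> (forall u, N (y *: u) -> N u) ->
  forall u, (forall x, exists n, N (sgx x ^+ n *: u)) -> N u.
Proof.
move=> N0 ND NZ [c ->] h u; apply: (kill_pow (K := fun=> True)) => // {}u _ hu.
apply: h; rewrite scaler_suml; elim/big_rec: _ => // x v _ Nv; apply: ND => //.
by rewrite -scalerA; apply: NZ.
Qed.

Section Level.
Variables (ys : seq R) (y : R).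
Let P := addIs (inI phi) ys.
Let N := addMs (NM phi) ys.
Hypotheses (gy : gens sgx y) (ry : regm P y) (my : mreg N y).

Let iP : ideal P. Proof. exact/ideal_addIs/ideal_inI. Qed.
Let sN : submod N. Proof. exact/submod_addMs/submod_NM. Qed.

Let tP z : (forall x, exists n, P (sgx x ^+ n * z)) -> P z.
Proof.
apply: (@torsion_free R^o P) gy _ z; [exact: ideal0 iP|exact: idealD iP|exact: idealM iP|].
by move=> u; rewrite [_ *: _]mulrC; apply: ry.
Qed.

Let tN m : (forall x, exists n, N (sgx x ^+ n *: m)) -> N m.
Proof. apply: torsion_free gy my m; [exact: submod0 sN|exact: submodD sN|exact: submodZ sN]. Qed.

Lemma end_homothety y' (F : 'M[R]_t) : gens sgx y' -> regm (addI P y) y' ->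
  (forall m, N m -> N (F *m m)) -> exists b, forall m, N (F *m m - b *: m).
Proof.
move=> gy' ry' hF.
apply: (@homothety R t _ sgx sgxe sgxw P N iP sN _ _ _ _ tP tN F hF y y') => //.
- by apply: addMs_scale => z m; exact: (inI_NM halfP).
- move=> x m; apply: addMs_sub; [exact: submod_NM|exact: sg_NM].
- move=> x m; apply: addMs_dotp; exact: sgw_NM.
- move=> x; apply: addIs_sub; [exact: ideal_inI|exact: sgw_e].
Qed.
End Level.

(* The relation [X = 0] in [coker phi (x) M/(ys)M]. *)
Definition NC ys (X : 'M[R]_(t.+2, t)) :=
  exists A D, inmx (addIs (@zero_ideal R) ys) (X - (phi *m A - D *m phi)).

Let Q ys := addIs (@zero_ideal R) ys.
Let iQ ys : ideal (Q ys). Proof. exact/ideal_addIs/ideal_zero. Qed.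

Lemma NM_cols ys n (X : 'M[R]_(t, n)) : (forall j, addMs (NM phi) ys (col j X)) ->
  exists G, inmx (Q ys) (X - phi^T *m G).
Proof.
move=> h; have {}h j : exists g, inmx (Q ys) (col j X - phi^T *m g).
  by have [m [g ->] hm] := (proj1 (addMs_split ys _ (submod_NM phi)) (h j)); exists g.
have [f hf] := fin_all_exists h; exists (\matrix_(i, j) f j i 0) => i j.
have := hf j i 0; rewrite !mxE; congr (Q ys (_ - _)); apply: eq_bigr => k _.
by rewrite !mxE.
Qed.

Lemma NM_col ys n (X : 'M[R]_(t, n)) G : inmx (Q ys) (X - phi^T *m G) ->
  forall j, addMs (NM phi) ys (col j X).
Proof.
move=> h j; apply/addMs_split; first exact: submod_NM.
exists (phi^T *m col j G); first by exists (col j G).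
have -> : col j X - phi^T *m col j G = col j (X - phi^T *m G).
  by rewrite !colE mulmxBl mulmxA.
by move=> i l; rewrite [col _ _ _ _]mxE; apply: h.
Qed.

(* If y X = 0 in the cokernel, then X comes from an endomorphism of M/(ys, y)M, that is, from
   a scalar. *)
Lemma mreg_NC ys y : mreg (addMs (NM phi) ys) y ->
  (forall F : 'M[R]_t, (forall m, addMs (NM phi) (rcons ys y) m -> addMs (NM phi) (rcons ys y) (F *m m)) ->
    exists b, forall m, addMs (NM phi) (rcons ys y) (F *m m - b *: m)) ->
  forall X, NC ys (y *: X) -> NC ys X.
Proof.
move=> ry hom X [A [D hE]]; set E := _ - _ in hE.
have eX : y *: X = phi *m A - D *m phi + E by rewrite /E addrC subrK.
(* Modulo (ys, y) the equation reads phi A = D phi, so [A^T] acts on M/(ys, y)M. *)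
have [b hb] : exists b, forall m, addMs (NM phi) (rcons ys y) (A^T *m m - b *: m).
  apply: hom => m /addMs_split-/(_ (submod_NM phi))[m0 [g ->] hm].
  apply/addMs_split; first exact: submod_NM.
  exists (phi^T *m (D^T *m g)); first by exists (D^T *m g).
  have -> : A^T *m m - phi^T *m (D^T *m g) = A^T *m (m - phi^T *m g) + y *: (X^T *m g) - E^T *m g.
    have eX' : y *: (X^T *m g) = A^T *m (phi^T *m g) - phi^T *m (D^T *m g) + E^T *m g.
      by rewrite scalemxAl -linearZ /= eX linearD linearB /= !trmx_mul mulmxDl mulmxBl -!mulmxA.
    by rewrite eX' mulmxBr !addrA addrK subrK.
  have iQ' := iQ (rcons ys y); apply: inmxB => //; first apply: inmxD => //.
  - exact: inmxMl.
  - move=> i j; rewrite mxE /Q addIs_rcons mulrC; exact/addI_gen/iQ.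
  - apply: inmxMr => // i j; rewrite mxE /Q addIs_rcons; exact/addI_sub/hE/iQ.
have [G hG] : exists G, inmx (Q (rcons ys y)) (A^T - b%:M - phi^T *m G).
  apply: NM_cols => j; have := hb (delta_mx j 0); rewrite -colE; congr addMs.
  by apply/matrixP=> k l; rewrite !mxE (ord1 l) eqxx andbT mulr_natr.
rewrite /Q addIs_rcons in hG; have [E' hE'] := inmx_addI hG.
set E2 := _ - _ in hE'.
have eA : A = b%:M + G^T *m phi + y *: E'^T + E2^T.
  apply: trmx_inj; rewrite !linearD linearZ /= trmx_mul !trmxK tr_scalar_mx.
  have -> : A^T - b%:M - phi^T *m G - y *: E' = A^T - (b%:M + phi^T *m G + y *: E').
    by rewrite !opprD !addrA.
  by rewrite addrC subrK.
(* Substituting A shows that y (X - phi E'^T) equals (b + phi G^T - D) phi modulo (ys). Its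
   transpose is zero in M/(ys)M column by column, and regularity of y there removes y. *)
have [H hH] : exists H, inmx (Q ys) ((X - phi *m E'^T)^T - phi^T *m H).
  apply: NM_cols => j; apply: ry; rewrite -[_ *: _]/(y *: _) -linearZ /=.
  apply: (NM_col (G := (b%:M + phi *m G^T - D)^T)) => /=.
  have -> : y *: (X - phi *m E'^T)^T - phi^T *m (b%:M + phi *m G^T - D)^T
     = (phi *m E2^T + E)^T.
    apply: trmx_inj; rewrite linearB linearZ /= !trmxK trmx_mul !trmxK scalerBr eX eA.
    rewrite !mulmxDr mulmxBl mulmxDl -scalemxAr mul_mx_scalar mul_scalar_mx mulmxA.
    set p := b *: phi + _; apply/eqP; rewrite !subr_eq; apply/eqP.
    by rewrite [RHS](AC (2 * 2 * 1) (3 * 5 * 1 * 4 * 2)).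
  by apply: inmxT; apply: inmxD => //; apply: inmxMl => //; apply: inmxT.
exists E'^T, (- H^T); have := inmxT hH; rewrite linearB /= trmxK trmx_mul trmxK.
by rewrite mulNmx opprK opprD addrA.
Qed.

(** [A^T] acts on M as a scalar b, so A = b + G^T phi; then D - b - phi G^T kills phi and equals H
    Om. The alternating part K of H is traded by [psiK_H] for a change of Z by [psiK K] and of the
    scalar by [om K]. *)
Lemma end_exact2 A D : phi *m A = D *m phi ->
  (forall F : 'M[R]_t, (forall m, NM phi m -> NM phi (F *m m)) ->
    exists b, forall m, NM phi (F *m m - b *: m)) ->
  exists Z S c, [/\ S^T = S, A = Z *m phi + c%:M & D = phi *m Z + S *m Om + c%:M].
Proof.
move=> eAD hom; have [b hb] : exists b, forall m, NM phi (A^T *m m - b *: m).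
  apply: hom => m [g ->]; exists (D^T *m g).
  by rewrite !mulmxA -!trmx_mul eAD.
have [G] : exists G, inmx (Q [::]) (A^T - b%:M - phi^T *m G).
  apply: NM_cols => j; have := hb (delta_mx j 0); rewrite -colE; congr NM.
  by apply/matrixP=> k l; rewrite !mxE (ord1 l) eqxx andbT mulr_natr.
move/inmx_zero/eqP; rewrite subr_eq0 => /eqP eG.
have eA : A = b%:M + G^T *m phi.
  by apply: trmx_inj; rewrite linearD /= tr_scalar_mx trmx_mul trmxK -eG addrC subrK.
have [H eH] : exists H, D - b%:M - phi *m G^T = H *m Om.
  apply: (phi_exactl trphi_exact); rewrite !mulmxBl -eAD eA mulmxDr mul_mx_scalar mul_scalar_mx.
  by rewrite mulmxA -addrA -opprD subrr.
pose S := half *: (H + H^T); pose K := half *: (H - H^T).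
have eHK : H = S + K.
  by rewrite /S /K -scalerDr addrACA subrr addr0 scalerDr half_dbl.
have aK : K^T = - K by rewrite /K linearZ linearB /= trmxK -scalerN opprB.
have hK := psiK_H halfP phi aK; have hK' := psiK_phi half phi K.
exists (G^T - psiK half phi K), S, (b + om half phi K); split.
- by rewrite /S linearZ linearD /= trmxK addrC.
- rewrite eA mulmxBl hK' raddfD /=.
  by rewrite [RHS]addrC addrACA subrr addr0.
- have -> : D = b%:M + phi *m G^T + H *m Om.
    by rewrite -eH -(addrA D) -(opprD b%:M) [RHS]addrC subrK.
  rewrite {1}eHK mulmxDl mulmxBr raddfD /= -hK.
  by rewrite [RHS](AC (3 * (1 * 2)) (((4 * 1) * (3 * 6)) * (2 * 5))) /= addNr addr0.
Qed.

End Depth.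

(** * Ideals of minors *)

Section MinorIdeal.
Variable R : comNzRingType.

Lemma bdet_minor t (phi : 'M[R]_(t.+2, t)) p q : minor_ideal phi t (bordered_det p q phi).
Proof.
have iM := ideal_gen (@minor R t.+2 t t phi).
rewrite /bordered_det (expand_det_col _ ord0); apply: ideal_sum => // i _.
apply: idealM => //; apply: idealM => //.
rewrite (expand_det_col _ ord0); apply: ideal_sum => // i' _.
apply: idealM => //; apply: idealM => //.
set d := \det _; suff -> : d = minor phi ([ffun v => lift i (lift i' v)], [ffun v => v]).
  exact: gen_ideal_gen.
congr (\det _); apply/matrixP=> a b; transitivity (phi (lift i (lift i' a)) b); last by rewrite mxE !ffunE.
rewrite -(@row_mxEr _ _ (1 + 1) _ (row_mx p q)) 4!mxE.
have e : lift ord0 (lift ord0 b) = (@rshift (1 + 1) t b : 'I_t.+2) by apply: val_inj.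
rewrite e; exact: erefl.
Qed.

Lemma minor_idealE t (phi : 'M[R]_(t.+2, t)) : minor_ideal phi t = inI phi.
Proof.
apply: functional_extensionality => x; apply: propositional_extensionality; split.
  apply: gen_ideal_sub; first exact: ideal_inI.
  by case=> f g; apply: (minor_inI phi f g).
case=> K ->; apply: ideal_sum => [|j _]; first exact: ideal_gen.
rewrite mxE; apply: ideal_sum => [|l _]; first exact: ideal_gen.
apply: idealM; first exact: ideal_gen.
by rewrite mxE; apply: bdet_minor.
Qed.

(** As in [minor_inI], with three rows j, l, k missed by [f]: e_j and e_l form the border and e_k
    replaces a column i missed by [g]. The matrix [C] puts this column in front of the columns
    [g]. *)
Lemma minor_gens u (phi : 'M[R]_(u.+3, u.+1)) (f : 'I_u -> 'I_u.+3) (g : 'I_u -> 'I_u.+1) :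
  gens (sgx phi) (\det (mxsub f g phi)).
Proof.
have [j jf] : exists j, j \notin codom f by apply: exists_notin; rewrite size_codom !card_ord ltnS leqW.
have [l] : exists l, l \notin j :: codom f.
  by apply: exists_notin; rewrite /= size_codom !card_ord.
rewrite inE negb_or => /andP[lj lf].
have [k] : exists k, k \notin [:: j, l & codom f].
  by apply: exists_notin; rewrite /= size_codom !card_ord.
rewrite !inE !negb_or => /and3P[kj kl kf].
have [i ig] : exists i, i \notin codom g by apply: exists_notin; rewrite size_codom !card_ord.
have gM a x : gens (sgx phi) x -> gens (sgx phi) (a * x).
  move=> [c ->]; exists (fun j => a * c j); rewrite mulr_sumr.
  by apply: eq_bigr => y _; rewrite mulrA.
have g1 x : gens (sgx phi) (sgx phi x).
  exists (fun y => (y == x)%:R); rewrite (bigD1 x) //= eqxx mul1r big1 ?addr0 // => y.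
  by move=> /negPf->; rewrite mul0r.
pose C : 'M[R]_(u.+1, 1 + u) := row_mx (delta_mx i 0) (colsub g 1%:M).
pose P : 'M[R]_(1 + 1 + (1 + u), u.+3) :=
  col_mx (col_mx (ev R j)^T (ev R l)^T) (col_mx (ev R k)^T (rowsub f 1%:M)).
pose A := colset i (ev R k) phi.
pose B : 'M[R]_(u.+3, 1 + 1 + (1 + u)) :=
  row_mx (row_mx (ev R j) (ev R l)) (row_mx (ev R k) (colsub g phi)).
have eB : (bordered (ev R j) (ev R l) A : 'M_(u.+3, 1 + 1 + u.+1)) *m block_mx 1%:M 0 0 C = B.
  rewrite /bordered mul_row_block !mulmx0 mulmx1 addr0 add0r /B /C mul_mx_row; congr (row_mx _ (row_mx _ _)).
    by rewrite -colE; apply/matrixP=> a b; rewrite !mxE eqxx (ord1 b).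
  rewrite mulmx_colsub mulmx1; apply/matrixP=> a b; rewrite !mxE.
  by case: eqP => // e; case/negP: ig; rewrite -e codom_f.
have ee a b : (ev R a)^T *m ev R b = ((a == b)%:R)%:M.
  rewrite trmx_delta mul_delta_mx_cond; apply/matrixP=> x y.
  by rewrite (ord1 x) (ord1 y); case: (a == b); rewrite !mxE ?eqxx.
have fe a : a \notin codom f -> rowsub f 1%:M *m ev R a = 0.
  move=> af; apply/matrixP=> x y; rewrite -colE !mxE.
  by case: eqP => // e; case/negP: af; rewrite -e codom_f.
have e : P *m B = block_mx 1%:M
   (col_mx (row_mx 0 ((ev R j)^T *m colsub g phi)) (row_mx 0 ((ev R l)^T *m colsub g phi))) 0
   (block_mx 1%:M ((ev R k)^T *m colsub g phi) 0 (mxsub f g phi)).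
  rewrite /P /B mul_col_row; congr block_mx.
  - rewrite mul_col_row !ee !eqxx (negPf lj) eq_sym (negPf lj) !scalar_mx0.
    exact/esym/(@scalar_mx_block _ 1 1).
  - rewrite mul_col_mx !mul_mx_row !ee ![_ == k]eq_sym (negPf kj) (negPf kl) !scalar_mx0 //.
  - rewrite mul_col_row !ee (negPf kj) (negPf kl) !fe // !scalar_mx0.
    exact: block_mx0.
  - rewrite mul_col_row !ee eqxx fe //; congr block_mx.
    by rewrite mul_rowsub_mx mul1mx; apply/matrixP=> a b; rewrite !mxE.
have := congr1 determinant e; rewrite det_ublock det1 mul1r det_ublock det1 mul1r => <-.
have eD : \det (B : 'M_u.+3) = sgx phi (i, k, j, l)
    * \det (block_mx 1%:M 0 0 C : 'M_(1 + 1 + u.+1)).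
  by rewrite -eB (@det_mulmx _ u.+3 (bordered (ev R j) (ev R l) A)).
by rewrite (@det_mulmx _ u.+3 P B) eD mulrCA mulrC; apply: gM; apply: g1.
Qed.
End MinorIdeal.

Section Radical.
Variable R : comNzRingType.
Lemma radical_gens (J : finType) (d : J -> R) (P : R -> Prop) y : ideal P ->
  (forall j, exists n, P (d j ^+ n)) -> gens d y -> exists n, P (y ^+ n).
Proof.
move=> iP h [c ->]; have PX x n m : P (x ^+ n) -> (n <= m)%N -> P (x ^+ m).
  by move=> Px /subnK<-; rewrite exprD; apply: idealM.
elim/big_rec: _ => [|j x _ [n Pn]].
  by exists 1; rewrite expr1; apply: ideal0.
have [m Pm] := h j; exists (m + n)%N; rewrite exprDn; apply: ideal_sum => // i _.
rewrite -mulr_natl; apply: idealM => //.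
have [le|lt] := leqP m (m + n - i); [apply: idealMr|apply: idealM] => //.
  by apply: PX le; rewrite exprMn; apply: idealM.
by apply: PX Pn _; lia.
Qed.
End Radical.

(** * The normal module *)

Section Eps.
Variables (R : comNzRingType) (half : R) (halfP : half + half = 1).
Variables (t : nat) (phi : 'M[R]_(t.+2, t)).
Local Notation Om := (Om phi).
Local Notation om := (om half phi).
Local Notation psiK := (psiK half phi).
Local Notation I := (inI phi).
Hypothesis phi_inj : forall m (v : 'M_(t, m)), phi *m v = 0 -> v = 0.
Hypothesis Om_exact : forall m (g : 'M_(t.+2, m)), Om *m g = 0 -> exists w, g = phi *m w.
Hypothesis trphi_exact : forall m (g : 'M_(t.+2, m)), phi^T *m g = 0 -> exists w, g = Om *m w.

Let iI : ideal I. Proof. exact: ideal_inI. Qed.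

Lemma omP a K L : om (a *: K + L) = a * om K + om L.
Proof. by rewrite /om mulmxDl -scalemxAl mxtraceD mxtraceZ mulrDr mulrCA. Qed.

Lemma psiKP a K L : psiK (a *: K + L) = a *: psiK K + psiK L.
Proof.
rewrite /psiK scaler_sumr -big_split; apply: eq_bigr => j _ /=.
rewrite scaler_sumr -big_split; apply: eq_bigr => l _ /=.
by rewrite !mxE mulrDr scalerDl scalerA mulrCA.
Qed.

(* The derivative of the minor [om K] at [phi] in the direction [X]. *)
Definition epsl K (X : 'M[R]_(t.+2, t)) := \tr (psiK K *m X).

Lemma epslP a K L X : epsl (a *: K + L) X = a * epsl K X + epsl L X.
Proof. by rewrite /epsl psiKP mulmxDl -scalemxAl mxtraceD mxtraceZ. Qed.

Lemma epslPr K a X Y : epsl K (a *: X + Y) = a * epsl K X + epsl K Y.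
Proof. by rewrite /epsl mulmxDr -scalemxAr mxtraceD mxtraceZ. Qed.

Lemma alt_lin a (K L : 'M[R]_t.+2) : K^T = - K -> L^T = - L ->
  (a *: K + L)^T = - (a *: K + L).
Proof. by move=> hK hL; rewrite linearP /= hK hL scalerN opprD. Qed.

(** The difference of K and L is a boundary of the Eagon-Northcott complex, and by [psiK_d1] its
    gradient is V^T Om, with entries in I_t. *)
Lemma epsl_wd K L X : K^T = - K -> L^T = - L -> om K = om L -> I (epsl K X - epsl L X).
Proof.
move=> aK aL e; have -> : epsl K X - epsl L X = epsl (-1 *: L + K) X.
  by rewrite epslP mulN1r addrC.
have o0 : om (-1 *: L + K) = 0 by rewrite omP e mulN1r addNr.
have tr0 : \tr ((-1 *: L + K) *m Om) = 0.
  by move: o0; rewrite /om; move: (\tr _) => T h; rewrite -[T]mul1r -halfP mulrDl h addr0.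
have [V ->] := alt_trace_exact halfP Om_exact trphi_exact (alt_lin (-1) aL aK) tr0.
rewrite /epsl (psiK_d1 halfP phi_inj) -mulmxA mxtrace_mulC -mulmxA.
exact: (inmx_trace iI (inmxMr iI _ (inI_Om phi))).
Qed.

(** A homomorphism is encoded as a function on R, so a presentation of each element of I_t must be
    chosen; by [epsl_wd] the choice is invisible modulo I_t. *)
Definition sel (x : R) : 'M[R]_t.+2 :=
  epsilon (inhabits 0) (fun K => K^T = - K /\ x = om K).

Lemma selP x : I x -> (sel x)^T = - sel x /\ x = om (sel x).
Proof.
case/(inI_alt halfP) => K aK e.
exact: (epsilon_spec (inhabits 0) (fun K => K^T = - K /\ x = om K) (ex_intro _ K (conj aK e))).
Qed.

Definition epsf X x := epsl (sel x) X.

Lemma epsfE X K : K^T = - K -> I (epsf X (om K) - epsl K X).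
Proof.
by move=> aK; have [h1 h2] := selP (inI_om half phi K); apply: epsl_wd.
Qed.

Lemma epsf_hom X : is_hom_I I (epsf X).
Proof.
split=> [x y Ix Iy|r x Ix].
  have [hx ex] := selP Ix; have [hy ey] := selP Iy.
  have := epsfE X (alt_lin 1 hx hy); rewrite omP epslP !mul1r -ex -ey //.
have [hx ex] := selP Ix; have h0 : (0 : 'M[R]_t.+2)^T = - 0 by rewrite trmx0 oppr0.
have e0 : om 0 = 0 by rewrite /om mul0mx mxtrace0 mulr0.
have f0 : epsl 0 X = 0.
  by have := epslP (-1) 0 0 X; rewrite scaler0 addr0 mulN1r addNr.
by have := epsfE X (alt_lin r hx h0); rewrite omP epslP e0 f0 !addr0 -ex.
Qed.

Lemma NC0E X : NC phi [::] X <-> exists A D, X = phi *m A - D *m phi.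
Proof.
split=> [[A [D /inmx_zero/eqP]]|[A [D ->]]].
  by rewrite subr_eq0 => /eqP->; exists A, D.
by exists A, D; apply/inmx_zero; rewrite subrr.
Qed.

(** The directions phi A - D phi are infinitesimal base changes, which preserve the ideal of minors;
    the two homotopy identities for [psiK K] make this explicit. *)
Lemma epsl_NC K X : K^T = - K -> NC phi [::] X -> I (epsl K X).
Proof.
move=> aK /NC0E[A [D ->]]; rewrite /epsl mulmxBr raddfB /= mulmxA psiK_phi mul_scalar_mx.
rewrite mxtraceZ mulmxA mxtrace_mulC mulmxA; apply: idealB => //.
  by apply: idealMr => //; apply: inI_om.
have -> : phi *m psiK K = (om K)%:M - K *m Om by rewrite -(psiK_H halfP) // addrK.
apply: inmx_trace => //; apply: inmxMr => //; apply: inmxB => //; last exact: (inmxMl iI _ (inI_Om phi)).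
move=> i j; rewrite mxE -mulr_natr; apply: idealMr => //; exact: inI_om.
Qed.

Lemma NC_phil A : NC phi [::] (phi *m A).
Proof. by apply/NC0E; exists A, 0; rewrite mul0mx subr0. Qed.
Lemma NC_phir D : NC phi [::] (D *m phi).
Proof. by apply/NC0E; exists 0, (- D); rewrite mulmx0 sub0r mulNmx opprK. Qed.
Lemma NC_D X Y : NC phi [::] X -> NC phi [::] Y -> NC phi [::] (X + Y).
Proof.
move=> /NC0E[A [D ->]] /NC0E[A' [D' ->]]; apply/NC0E; exists (A + A'), (D + D').
by rewrite mulmxDr mulmxDl opprD addrACA.
Qed.
Lemma NC_Z a X : NC phi [::] X -> NC phi [::] (a *: X).
Proof.
move=> /NC0E[A [D ->]]; apply/NC0E; exists (a *: A), (a *: D).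
by rewrite scalerBr scalemxAr scalemxAl.
Qed.
Lemma NC_B X Y : NC phi [::] X -> NC phi [::] Y -> NC phi [::] (X - Y).
Proof. by move=> hX hY; apply: NC_D => //; rewrite -scaleN1r; apply: NC_Z. Qed.
Lemma NC_I x X : I x -> NC phi [::] (x *: X).
Proof.
move=> /(inI_alt halfP)[K _ ->].
by rewrite -mul_mx_scalar -(psiK_phi half phi) mulmxA; apply: NC_phir.
Qed.

Lemma Kpq_alt (p q : 'cV[R]_t.+2) : (Kpq p q)^T = - Kpq p q.
Proof. by rewrite /Kpq linearB /= !trmx_mul !trmxK opprB. Qed.

Lemma om_Kpq p q : om (Kpq p q) = bordered_det p q phi.
Proof.
rewrite /om /Kpq mulmxBl raddfB /= -!mulmxA ![\tr (_ *m (_ *m _))]mxtrace_mulC.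
rewrite ![\tr (_ *m Om *m _)]/mxtrace !big_ord1 -!bdet_Om [bordered_det q p _]bdet_swap opprK.
by rewrite mulrDr -mulrDl halfP mul1r.
Qed.

Lemma psiK_Kpq p q : psiK (Kpq p q) = bordered_adj p q phi.
Proof.
apply/eqP; rewrite -subr_eq0; apply/eqP/phi_inj; rewrite mulmxBr.
apply/eqP; rewrite subr_eq0; apply/eqP/(addIr (Kpq p q *m Om)).
by rewrite (psiK_H halfP) ?Kpq_alt // Kpq_H om_Kpq.
Qed.

Definition tt X p q := \tr (bordered_adj p q phi *m X).

Lemma epsl_Kpq p q X : epsl (Kpq p q) X = tt X p q.
Proof. by rewrite /epsl psiK_Kpq. Qed.

Lemma tt_rank1 v i p q : tt (v *m (delta_mx i 0 : 'cV_t)^T) p q = tau i v p q phi.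
Proof.
rewrite /tt mulmxA mxtrace_mulC trmx_delta -rowE /mxtrace big_ord1 mxE.
by rewrite bpsi_tau.
Qed.

Lemma tau_cyc i u p q : tau i p q u phi = tau i u p q phi.
Proof.
rewrite tau_swap {1}/tau bdet_swap -/(tau i q u p phi) opprK tau_swap.
by rewrite {1}/tau bdet_swap -/(tau i u p q phi) opprK.
Qed.

Lemma tau_pu i u p : tau i u p p phi = 0.
Proof. by rewrite /tau bdet_pp. Qed.

(* At [sg = tau i u p q], [sg X] is equivalent to a multiple of a rank one matrix supported on
   [u], [p], [q], whose coefficients are read off from [epsl]. *)
Lemma local_NC i u p q (X : 'M[R]_(t.+2, t)) : (forall K, K^T = - K -> I (epsl K X)) ->
  NC phi [::] (tau i u p q phi ^+ 3 *: X).
Proof.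
move=> h; set sg := tau i u p q phi.
pose w := sgw phi i u p q; pose e : 'cV[R]_t := delta_mx i 0.
have [z] := local_cramer phi i u p q (X *m w); rewrite -/sg.
set c1 := tau i (X *m w) p q phi; set c2 := tau i u (X *m w) q phi.
set c3 := tau i u p (X *m w) phi => ez.
pose v := c1 *: u + c2 *: p + c3 *: q.
have h2 : NC phi [::] (sg ^+ 2 *: X - v *m e^T).
  have e1 : sg *: X = X *m bordered_adj p q (colset i u phi) *m phi + X *m w *m e^T.
    have := sg_decomp phi i u p q; move/(congr1 trmx); rewrite linearD /= !trmx_mul !trmxK.
    by rewrite tr_scalar_mx -/sg -mul_mx_scalar => <-; rewrite mulmxDr !mulmxA.
  have -> : sg ^+ 2 *: X - v *m e^T =
      sg *: (X *m bordered_adj p q (colset i u phi) *m phi) + phi *m (z *m e^T).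
    rewrite expr2 -scalerA e1 scalerDr -addrA; congr (_ + _).
    by rewrite scalemxAl ez -!addrA mulmxDl mulmxA -[u in c1 *: u + _]/u addrA addrK.
  by apply: NC_D; [exact/NC_Z/NC_phir|exact: NC_phil].
have hv p' q' : I (tau i v p' q' phi).
  rewrite -tt_rank1 -epsl_Kpq; have aK := Kpq_alt p' q'.
  have -> : v *m (delta_mx i 0)^T = sg ^+ 2 *: X - (sg ^+ 2 *: X - v *m e^T).
    by rewrite opprB addrC subrK.
  have -> Y : epsl (Kpq p' q') (sg ^+ 2 *: X - Y)
     = sg ^+ 2 * epsl (Kpq p' q') X + -1 * epsl (Kpq p' q') Y.
    by rewrite epslPr -[- Y]addr0 -scaleN1r epslPr /epsl mulmx0 mxtrace0 addr0.
  by apply: idealD => //; apply: idealM => //; [exact: h|exact: epsl_NC].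
have vE p' q' : tau i v p' q' phi
    = c1 * tau i u p' q' phi + c2 * tau i p p' q' phi + c3 * tau i q p' q' phi.
  have t0 : tau i 0 p' q' phi = 0 by rewrite -bpsi_tau mulmx0 mxE.
  by rewrite /v -addrA !tau_lin -[c3 *: q]addr0 tau_lin t0 addr0 addrA.
(* Evaluating at (p, q), (q, u), (u, p) isolates one coefficient each, at the cost of a third factor
   [sg]. *)
have i1 : I (c1 * sg) by have := hv p q; rewrite vE tau_pp tau_qq !mulr0 !addr0.
have i2 : I (c2 * sg).
  by have := hv q u; rewrite vE tau_qq tau_pp tau_cyc !mulr0 add0r addr0.
have i3 : I (c3 * sg).
  by have := hv u p; rewrite vE tau_qq tau_pp -tau_cyc !mulr0 !add0r.
rewrite exprS -scalerA -[_ ^+ 2 *: X](subrK (v *m e^T)) scalerDr; apply: NC_D.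
  exact: NC_Z.
rewrite scalemxAl /v !scalerDr !mulmxDl !scalerA ![sg * _]mulrC -!scalemxAl.
by apply: NC_D; [apply: NC_D|]; apply: NC_I.
Qed.

End Eps.

(** * Surjectivity onto Hom(I_t, R/I_t) *)

Section Surj.
Variables (R : comNzRingType) (half : R) (halfP : half + half = 1).
Variables (t : nat) (phi : 'M[R]_(t.+2, t)).
Local Notation Om := (Om phi).
Local Notation om := (om half phi).
Local Notation I := (inI phi).
Hypothesis phi_inj : forall m (v : 'M_(t, m)), phi *m v = 0 -> v = 0.
Hypothesis Om_exact : forall m (g : 'M_(t.+2, m)), Om *m g = 0 -> exists w, g = phi *m w.
Hypothesis trphi_exact : forall m (g : 'M_(t.+2, m)), phi^T *m g = 0 -> exists w, g = Om *m w.

Let iI : ideal I. Proof. exact: ideal_inI. Qed.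

Lemma bdet_phil z q : bordered_det (phi *m z) q phi = 0.
Proof. by rewrite bdet_Om trmx_mul -!mulmxA [_ *m (Om *m q)]mulmxA trphi_Om mul0mx mulmx0 mxE. Qed.

Lemma tau_phi i v z q : I (tau i v (phi *m z) q phi).
Proof.
rewrite tau_swap; apply: idealN => //; rewrite -bpsi_tau mulmxA bpsi_mul mul_scalar_mx mxE.
by apply: idealMr => //; apply: bdet_inI.
Qed.

Lemma epslE K X : epsl half phi K X
  = \sum_j \sum_l (half * K j l) * tt phi X (ev R l) (ev R j).
Proof.
rewrite /epsl /psiK mulmx_suml raddf_sum; apply: eq_bigr => j _.
rewrite mulmx_suml raddf_sum; apply: eq_bigr => l _ /=.
by rewrite -scalemxAl mxtraceZ.
Qed.

Section Hom.
Variable f : R -> R.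
Hypothesis hf : is_hom_I I f.

Definition congf x y := I x /\ I (f x - y).

Lemma congf0 : congf 0 0.
Proof.
split; first exact: ideal0; have := hf.2 0 0 (ideal0 iI).
by rewrite !mul0r.
Qed.
Lemma congfD x y x' y' : congf x y -> congf x' y' -> congf (x + x') (y + y').
Proof.
move=> [h1 h2] [h1' h2']; split; first exact: idealD.
have -> : f (x + x') - (y + y') = (f (x + x') - (f x + f x')) + ((f x - y) + (f x' - y')) by ring.
by apply: idealD => //; [apply: hf.1|apply: idealD].
Qed.
Lemma congfZ a x y : congf x y -> congf (a * x) (a * y).
Proof.
move=> [h1 h2]; split; first exact: idealM.
have -> : f (a * x) - a * y = (f (a * x) - a * f x) + a * (f x - y) by ring.
by apply: idealD => //; [apply: hf.2|apply: idealM].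
Qed.
Lemma congff x : I x -> congf x (f x).
Proof. by split=> //; rewrite subrr; apply: ideal0. Qed.
Lemma congf_eq x y y' : congf x y -> congf x y' -> I (y - y').
Proof.
move=> [_ h] [_ h']; have -> : y - y' = (f x - y') - (f x - y) by ring.
exact: idealB.
Qed.

Let G p q := f (bordered_det p q phi).
Let cG p q : congf (bordered_det p q phi) (G p q). Proof. exact/congff/bdet_inI. Qed.

Section Local.
Variables (i : 'I_t) (u p q : 'cV[R]_t.+2).
Let sg := tau i u p q phi.
(** Chosen so that [tau i v] agrees with sg G on the pairs (p, q), (q, u), (u, p). *)
Let v := G p q *: u + G q u *: p + G u p *: q.
Let E x y := sg * G x y - tau i v x y phi.

Let tauv x y : tau i v x y phi
  = G p q * tau i u x y phi + G q u * tau i p x y phi + G u p * tau i q x y phi.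
Proof.
have t0 : tau i 0 x y phi = 0 by rewrite -bpsi_tau mulmx0 mxE.
by rewrite /v -addrA !tau_lin -[G u p *: q]addr0 tau_lin t0 addr0 addrA.
Qed.

Let E_lin a x x' y : I (E (a *: x + x') y - (a * E x y + E x' y)).
Proof.
rewrite /E /tau bdet_lin1 -!/(tau _ _ _ _ _).
have := congf_eq (cG (a *: x + x') y) _; rewrite bdet_lin1.
move=> /(_ _ (congfD (congfZ a (cG x y)) (cG x' y))) h.
set A := G (a *: x + x') y in h *; set T1 := tau i v x y phi; set T2 := tau i v x' y phi.
have -> : sg * A - (a * T1 + T2) - (a * (sg * G x y - T1) + (sg * G x' y - T2))
  = sg * (A - (a * G x y + G x' y)) by ring.
exact: idealM.
Qed.

Let E_alt x y : I (E x y + E y x).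
Proof.
rewrite /E [tau i v y x phi]/tau bdet_swap -/(tau i v x y phi).
have := congf_eq (cG y x) _; rewrite bdet_swap -mulN1r => /(_ _ (congfZ (-1) (cG x y))) h.
have -> : sg * G x y - tau i v x y phi + (sg * G y x - - tau i v x y phi) =
  sg * (G y x - -1 * G x y) by ring.
exact: idealM.
Qed.

Let E_xx x : I (E x x).
Proof.
rewrite /E tau_pu subr0; apply: idealM => //.
by have := congf_eq (cG x x) _; rewrite bdet_pp => /(_ _ congf0); rewrite subr0.
Qed.

Let E_phi z y : I (E (phi *m z) y).
Proof.
rewrite /E; apply: idealB => //; last exact: tau_phi.
apply: idealM => //.
by have := congf_eq (cG (phi *m z) y) _; rewrite bdet_phil => /(_ _ congf0); rewrite subr0.
Qed.

Let sub_E r y : submod (fun x => I (r * E x y)).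
Proof.
have E0 : I (r * E 0 y) by apply: idealM => //; have := E_phi 0 y; rewrite mulmx0.
have EL a x x' : I (r * E x y) -> I (r * E x' y) -> I (r * E (a *: x + x') y).
  move=> h h'; have -> : r * E (a *: x + x') y
    = r * (E (a *: x + x') y - (a * E x y + E x' y)) + (a * (r * E x y) + r * E x' y) by ring.
  by apply: idealD => //; [apply: idealM|apply: idealD => //; apply: idealM].
split=> // [x x' h h'|a x h]; first by rewrite -[x]scale1r; apply: EL.
by rewrite -[_ *: _]addr0; apply: EL.
Qed.

Let E_span r y : I (r * E u y) -> I (r * E p y) -> I (r * E q y) ->
  forall x, I (r * (sg * E x y)).
Proof.
move=> hu hp hq x; have E0 : I (E 0 y) by have := E_phi 0 y; rewrite mulmx0.
have h := E_lin sg x 0 y; rewrite addr0 in h.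
have h2 : I (r * E (sg *: x) y).
  have sE := sub_E r y; have [z ->] := local_cramer phi i u p q x.
  have hz : I (r * E (phi *m z) y) by apply: idealM.
  exact (submodD sE (submodD sE (submodD sE hz (submodZ sE _ hu)) (submodZ sE _ hp))
    (submodZ sE _ hq)).
have -> : r * (sg * E x y)
  = r * E (sg *: x) y - r * (E (sg *: x) y - (sg * E x y + E 0 y)) - r * E 0 y by ring.
by do !apply: idealB => //; apply: idealM.
Qed.

Let E_swap x y : I (E x y) -> I (E y x).
Proof. by move=> h; have := idealB iI (E_alt x y) h; rewrite addrAC subrr add0r. Qed.

Let E_swapM x y : I (sg * E x y) -> I (sg * E y x).
Proof.
by move=> h; have := idealB iI (idealM iI sg (E_alt x y)) h; rewrite mulrDr addrAC subrr add0r.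
Qed.

Let E_up : I (E u p).
Proof.
rewrite /E tauv tau_pp tau_qq mulr0 mulr0 -tau_cyc tau_cyc -[tau i q u p phi]tau_cyc.
by rewrite !add0r mulrC subrr; apply: ideal0.
Qed.
Let E_pq : I (E p q).
Proof. by rewrite /E tauv tau_pp tau_qq !mulr0 !addr0 mulrC subrr; apply: ideal0. Qed.
Let E_qu : I (E q u).
Proof. by rewrite /E tauv tau_pp tau_qq tau_cyc !mulr0 add0r addr0 mulrC subrr; apply: ideal0. Qed.

Let E_basis z := z = u \/ z = p \/ z = q.

(** The defect E is alternating and bilinear modulo I_t, and vanishes on the image of phi and on
    pairs from u, p, q. By [local_cramer] these span up to the factor sg, so two factors, one per
    argument, kill E. *)
Lemma local_surj : exists X, forall x y, I (sg ^+ 3 * G x y - tt phi X x y).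
Proof.
exists (sg ^+ 2 *: (v *m (delta_mx i 0 : 'cV_t)^T)) => x y.
rewrite /tt -scalemxAr mxtraceZ -/(tt phi _ x y) tt_rank1.
have -> : sg ^+ 3 * G x y - sg ^+ 2 * tau i v x y phi = sg * (sg * E x y) by rewrite /E; ring.
have hb z : E_basis z -> forall x, I (sg * E x z).
  move=> hz {}x; rewrite -[sg * _]mul1r.
  by case: hz => [|[]] ->; apply: E_span; rewrite mul1r //; apply: E_swap.
by apply: E_span; apply: E_swapM; apply: hb; rewrite /E_basis; tauto.
Qed.
End Local.

Lemma congf_tt X : (forall p q, I (G p q - tt phi X p q)) ->
  forall K, congf (om K) (epsl half phi K X).
Proof.
move=> h K; rewrite epslE -om_sum; apply: (big_ind2 congf) => [||j _]; [exact: congf0|exact: congfD|].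
apply: (big_ind2 congf) => [||l _]; [exact: congf0|exact: congfD|].
apply: congfZ; split; [exact: bdet_inI|exact: h].
Qed.

End Hom.

Section Global.
Variables y1 y2 : R.
Hypotheses (g1 : gens (sgx phi) y1) (g2 : gens (sgx phi) y2) (r1 : regm I y1).
Hypothesis n1 : forall X, NC phi [::] (y1 *: X) -> NC phi [::] X.
Hypothesis n2 : forall X, NC phi [:: y1] (y2 *: X) -> NC phi [:: y1] X.

Let ttl a X Y p q : tt phi (a *: X + Y) p q = a * tt phi X p q + tt phi Y p q.
Proof. by rewrite /tt mulmxDr -scalemxAr mxtraceD mxtraceZ. Qed.

Let ttB a b X Y p q : tt phi (a *: X - b *: Y) p q = a * tt phi X p q - b * tt phi Y p q.
Proof. by rewrite /tt mulmxBr -!scalemxAr raddfB /= !mxtraceZ. Qed.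

Lemma epsl_inj X : (forall K, K^T = - K -> I (epsl half phi K X)) -> NC phi [::] X.
Proof.
move=> h; apply: (torsion_free (N := NC phi [::]) _ _ _ g1 n1) => [|||x].
- by apply/NC0E; exists 0, 0; rewrite mulmx0 mul0mx subrr.
- exact: NC_D.
- exact: NC_Z.
exists 3; exact: (local_NC halfP phi_inj).
Qed.

Lemma epsf_ker X : (forall x, I x -> I (epsf half phi X x)) <-> NC phi [::] X.
Proof.
split=> [h|h x Ix]; last first.
  by have [aK ->] := selP halfP Ix; rewrite /epsf; apply: epsl_NC => //; case: (selP halfP (inI_om half phi (sel half phi x))).
apply: epsl_inj => K aK; have := epsfE halfP phi_inj Om_exact trphi_exact X aK.
move/(idealB iI (h _ (inI_om half phi K))); rewrite opprB addrCA subrr addr0 //.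
Qed.

(** The r for which r f is a derivative map form an ideal that contains powers of y1 and y2, with
    directions X1 and X2. By injectivity y2^m X1 and y1^n X2 agree in coker(phi) (x) M, so X1 is
    y1^n times a direction X, and cancelling y1^n modulo I_t shows that X realizes f. *)
Lemma epsf_surj f : is_hom_I I f ->
  exists X, forall x, I x -> I (epsf half phi X x - f x).
Proof.
move=> hf; pose G p q := f (bordered_det p q phi).
pose S r := exists X, forall p q, I (r * G p q - tt phi X p q).
have iS : ideal S.
  split=> [|r s [X hX] [Y hY]|r s [X hX]].
  - by exists 0 => p q; rewrite /tt mulmx0 mxtrace0 mul0r subr0; apply: ideal0.
  - exists (X + Y) => p q; rewrite -[X]scale1r ttl mul1r.
    by rewrite mulrDl opprD addrACA; apply: idealD.
  - exists (r *: X) => p q; have t0 : tt phi 0 p q = 0 by rewrite /tt mulmx0 mxtrace0.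
    by rewrite -[r *: X]addr0 ttl t0 addr0 -mulrA -mulrBr; apply: idealM.
have hS x : exists n, S (sgx phi x ^+ n) by exists 3; exact: local_surj.
have [n [X1 h1]] := radical_gens iS hS g1; have [m [X2 h2]] := radical_gens iS hS g2.
have NC1E X : NC phi [:: y1] X <-> exists Y, NC phi [::] (X - y1 *: Y).
  split=> [[A [D /inmx_addI[Y hY]]]|[Y [A [D hY]]]].
    by exists Y, A, D; rewrite addrAC.
  exists A, D => i j; exists (Y i j); have := hY i j; rewrite !mxE addrAC mulrC //.
(* Regularity of y2 modulo y1 passes to y1^k: [n2] extracts one factor y1 from X and [n1] cancels it
   in the relation. *)
have step k X Y : NC phi [::] (y2 *: X - y1 ^+ k *: Y) ->
    exists Z, NC phi [::] (X - y1 ^+ k *: Z).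
  elim: k X Y => [|k IH] X Y h.
    by exists X; rewrite scale1r subrr; apply/NC0E; exists 0, 0; rewrite mulmx0 mul0mx subrr.
  have /n2/NC1E[X' hX'] : NC phi [:: y1] (y2 *: X).
    by apply/NC1E; exists (y1 ^+ k *: Y); rewrite scalerA -exprS.
  have /n1/IH[Z hZ] : NC phi [::] (y1 *: (y2 *: X' - y1 ^+ k *: Y)).
    have -> : y1 *: (y2 *: X' - y1 ^+ k *: Y)
      = (y2 *: X - y1 ^+ k.+1 *: Y) - y2 *: (X - y1 *: X').
      rewrite !scalerBr !scalerA -exprS [y2 * y1]mulrC opprB.
      by rewrite [RHS]addrC addrA subrK.
    by apply: NC_B => //; apply: NC_Z.
  exists Z; have -> : X - y1 ^+ k.+1 *: Z = (X - y1 *: X') + y1 *: (X' - y1 ^+ k *: Z).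
    by rewrite scalerBr scalerA -exprS addrA subrK.
  by apply: NC_D => //; apply: NC_Z.
have steps l k X Y : NC phi [::] (y2 ^+ l *: X - y1 ^+ k *: Y) ->
    exists Z, NC phi [::] (X - y1 ^+ k *: Z).
  elim: l X Y => [|l IH] X Y h; first by exists Y; rewrite -[X]scale1r.
  have [Z hZ] : exists Z, NC phi [::] (y2 ^+ l *: X - y1 ^+ k *: Z).
    by apply: (step _ _ Y); rewrite scalerA -exprS.
  exact: IH hZ.
have e12 : NC phi [::] (y2 ^+ m *: X1 - y1 ^+ n *: X2).
  apply: epsl_inj => K aK; rewrite epslE.
  apply: ideal_sum => // j _; apply: ideal_sum => // l _; apply: idealM => //.
  rewrite ttB; set p := ev R l; set q := ev R j.
  have -> : y2 ^+ m * tt phi X1 p q - y1 ^+ n * tt phi X2 p q =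
    y1 ^+ n * (y2 ^+ m * G p q - tt phi X2 p q) - y2 ^+ m * (y1 ^+ n * G p q - tt phi X1 p q) by ring.
  by apply: idealB => //; apply: idealM.
have [X hX] := steps _ _ _ _ e12; exists X => x Ix.
have hG p q : I (G p q - tt phi X p q).
  have rn k : regm I (y1 ^+ k).
    elim: k => [|k IH] r; first by rewrite expr0 mulr1.
    by rewrite exprSr mulrA => /r1/IH.
  apply: (rn n).
  have h := epsl_NC halfP (Kpq_alt p q) hX; rewrite epsl_Kpq // in h.
  have e : tt phi (X1 - y1 ^+ n *: X) p q = tt phi X1 p q - y1 ^+ n * tt phi X p q.
    by rewrite -[X1 in LHS]scale1r ttB mul1r.
  rewrite e in h.
  have -> : (G p q - tt phi X p q) * y1 ^+ n
     = (y1 ^+ n * G p q - tt phi X1 p q) + (tt phi X1 p q - y1 ^+ n * tt phi X p q) by ring.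
  exact: idealD.
have [aK eK] := selP halfP Ix; have [_] := congf_tt hf hG (sel half phi x).
by rewrite -eK /epsf => h; have := idealN iI h; rewrite opprB.
Qed.
End Global.
End Surj.

(** * Gradings *)

Section Grading.
Variables (k : closedFieldType) (n : nat).
Local Notation R := {mpoly k[n]}.
Implicit Types (p q : R) (d e : int).

Lemma homogz0 d : homogz d (0 : R).
Proof. by case: d => d //=; apply: dhomog0. Qed.

Lemma homogzD d p q : homogz d p -> homogz d q -> homogz d (p + q).
Proof. by case: d => d /=; [apply: dhomogD|move=> -> ->; rewrite addr0]. Qed.

Lemma homogzZ d c p : homogz d p -> homogz d (c *: p).
Proof. by case: d => d /=; [apply: dhomogZ|move=> ->; rewrite scaler0]. Qed.

Lemma homogzN d p : homogz d p -> homogz d (- p).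
Proof. by rewrite -scaleN1r; apply: homogzZ. Qed.

Lemma homogzB d p q : homogz d p -> homogz d q -> homogz d (p - q).
Proof. by move=> hp hq; apply: homogzD => //; apply: homogzN. Qed.

Lemma homogzM d e p q : homogz d p -> homogz e q -> homogz (d + e) (p * q).
Proof.
case: d => d /=; last by move=> -> _; rewrite mul0r; apply: homogz0.
case: e => e /=; last by move=> _ ->; rewrite mulr0; apply: homogz0.
exact: dhomogM.
Qed.

Lemma homogz_sum d (J : Type) (s : seq J) (P : pred J) (F : J -> R) :
  (forall j, P j -> homogz d (F j)) -> homogz d (\sum_(j <- s | P j) F j).
Proof. by move=> h; elim/big_rec: _ => [|j x Pj hx]; [apply: homogz0|apply: homogzD; auto]. Qed.

Lemma homogz_prod (J : Type) (s : seq J) (D : J -> int) (F : J -> R) :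
  (forall j, homogz (D j) (F j)) -> homogz (\sum_(j <- s) D j) (\prod_(j <- s) F j).
Proof.
move=> h; elim: s => [|j s IH]; first by rewrite !big_nil; apply: dhomog1.
by rewrite !big_cons; apply: homogzM.
Qed.

Lemma homogz_bool d (b : bool) : (b -> d = 0) -> homogz d (b%:R : R).
Proof. by case: b => [->//|_]; [apply: dhomog1|apply: homogz0]. Qed.

Lemma homogz_mul m s r (A : 'M[R]_(m, s)) (B : 'M[R]_(s, r)) (DA DB D : _ -> _ -> int) :
  (forall i j, homogz (DA i j) (A i j)) -> (forall i j, homogz (DB i j) (B i j)) ->
  (forall i l j, D i j = DA i l + DB l j) -> forall i j, homogz (D i j) ((A *m B) i j).
Proof.
move=> hA hB hD i j; rewrite mxE; apply: homogz_sum => l _.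
by rewrite (hD i l j); apply: homogzM.
Qed.

Lemma homogz_det m (A : 'M[R]_m) (r c : 'I_m -> int) :
  (forall i j, homogz (r i - c j) (A i j)) -> homogz (\sum_i r i - \sum_j c j) (\det A).
Proof.
move=> h; rewrite /determinant; apply: homogz_sum => s _.
rewrite mulr_sign; have H : homogz (\sum_i r i - \sum_j c j) (\prod_i A i (s i)).
  rewrite [X in _ - X](reindex_inj (@perm_inj _ s)) -sumrB; exact: homogz_prod.
by case: (s : bool) => //; apply: homogzN.
Qed.

Definition hcomp d p : R := if d is Posz m then pihomog mdeg m p else 0.

Lemma hcompD d p q : hcomp d (p + q) = hcomp d p + hcomp d q.
Proof. by case: d => d /=; rewrite ?pihomogD ?addr0. Qed.
Lemma hcompN d p : hcomp d (- p) = - hcomp d p.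
Proof. by case: d => d /=; rewrite ?pihomogN ?oppr0. Qed.
Lemma hcomp0 d : hcomp d 0 = 0.
Proof. by case: d => d //=; rewrite pihomog0. Qed.
Lemma hcomp_sum d (J : Type) (s : seq J) (P : pred J) (F : J -> R) :
  hcomp d (\sum_(j <- s | P j) F j) = \sum_(j <- s | P j) hcomp d (F j).
Proof. by apply: (big_morph (hcomp d) (hcompD d) (hcomp0 d)). Qed.

Lemma hcompP d p : homogz d (hcomp d p).
Proof. by case: d => d //=; apply: pihomogP. Qed.

Lemma hcomp_id (m : nat) p : p \is m.-homog -> hcomp m p = p.
Proof. exact: pihomog_dE. Qed.

Lemma hcomp_homog d (m : nat) p : p \is m.-homog -> hcomp d p = if d == m then p else 0.
Proof.
case: d => d /= hp //; case: eqVneq => [[->]|ne]; first exact: pihomog_dE.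
by rewrite (pihomog_ne0 _ hp) // eq_sym.
Qed.

Lemma hcompM d e p q : homogz e q -> hcomp (d + e) (p * q) = hcomp d p * q.
Proof.
case: e => e /= hq; last by rewrite hq !mulr0 hcomp0.
rewrite [p in LHS](pihomog_partitionE (leqnn (mmeasure mdeg p))).
rewrite [p in RHS](pihomog_partitionE (leqnn (mmeasure mdeg p))).
rewrite mulr_suml !hcomp_sum mulr_suml; apply: eq_bigr => i _.
have hi := pihomogP mdeg i p.
rewrite (hcomp_homog _ hi) (hcomp_homog _ (dhomogM hi hq)) PoszD.
by rewrite (inj_eq (addIr _)); case: ifP => // _; rewrite mul0r.
Qed.

Lemma ideal_max : ideal (@in_max_ideal k n).
Proof.
rewrite /in_max_ideal; split=> [|p q hp hq|r p hp]; first exact: mcoeff0.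
- by rewrite mcoeffD hp hq addr0.
- by rewrite rmorphM /= hp mulr0.
Qed.

Lemma minimal_inI t (phi : 'M[R]_(t.+2, t)) : (0 < t)%N -> minimal_mx phi ->
  forall x, inI phi x -> in_max_ideal x.
Proof.
case: t phi => // t phi _ hphi x; rewrite -(minor_idealE phi).
apply: gen_ideal_sub; first exact: ideal_max.
case=> f g; rewrite /minor (expand_det_row _ ord0); apply: ideal_sum; first exact: ideal_max.
by move=> j _; apply: idealMr; [exact: ideal_max|rewrite mxE].
Qed.

Section Weights.
Variables (t : nat) (a : 'I_t.+2 -> int) (b : 'I_t -> int).
Variable phi : 'M[R]_(t.+2, t).
Hypothesis hphi : forall j i, homogz (a j - b i) (phi j i).

(** A unit column e_x is homogeneous with column weight a x. The weights [c] are free so that a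
    column of phi may also be replaced by a unit vector. *)
Lemma homogz_bdet x y c (A : 'M[R]_(t.+2, t)) : (forall j i, homogz (a j - c i) (A j i)) ->
  homogz (\sum_j a j - (a x + a y + \sum_i c i)) (bordered_det (ev R x) (ev R y) A).
Proof.
move=> hA; pose w (l : 'I_t.+2) := match @split (1 + 1) t l with
  | inl l' => if @split 1 1 l' is inl _ then a x else a y | inr i => c i end.
have w2 i : w (@rshift (1 + 1) t i) = c i by rewrite /w (unsplitK (inr i)).
have w0 : w (@lshift (1 + 1) t (@lshift 1 1 ord0)) = a x.
  by rewrite /w (unsplitK (inl _)) (unsplitK (inl _)).
have w1 : w (@lshift (1 + 1) t (@rshift 1 1 ord0)) = a y.
  by rewrite /w (unsplitK (inl _)) (unsplitK (inr _)).
have -> : a x + a y + \sum_i c i = \sum_l w l.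
  rewrite (@big_split_ord _ _ _ (1 + 1) t) /= (@big_split_ord _ _ _ 1 1) /= !big_ord1 w0 w1.
  by congr (_ + _); apply: eq_bigr => i _.
apply: homogz_det => i l; elim/c_ind: l => [||l].
- rewrite bm0 w0 mxE andbT; apply: homogz_bool => /eqP->; exact: subrr.
- rewrite bm1 w1 mxE andbT; apply: homogz_bool => /eqP->; exact: subrr.
- by rewrite bm2 w2; apply: hA.
Qed.

Lemma homogz_Om j l : homogz (ell a b - a j - a l) (Om phi j l).
Proof.
rewrite mxE; have := homogz_bdet j l hphi; congr homogz; rewrite /ell.
by rewrite !opprD !addrA addrAC [in RHS]addrAC; ring.
Qed.

Lemma homogz_bpsi x y i j :
  homogz (ell a b - a x - a y - a j + b i) (bordered_adj (ev R x) (ev R y) phi i j).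
Proof.
have -> : bordered_adj (ev R x) (ev R y) phi i j = tau i (ev R j) (ev R x) (ev R y) phi.
  by rewrite -bpsi_tau /ev -colE [RHS]mxE.
pose c l := if l == i then a j else b l.
have hA l m : homogz (a l - c m) (colset i (ev R j) phi l m).
  rewrite mxE /c; case: eqP => // _; rewrite mxE andbT.
  by apply: homogz_bool => /eqP->; exact: subrr.
have := homogz_bdet x y hA; congr homogz; rewrite /ell.
rewrite (bigD1 i) //= [\sum_l b l](bigD1 i) //= /c eqxx.
rewrite (eq_bigr b) => [|l /negPf->//]; ring.
Qed.
End Weights.
End Grading.

(** * The resolution *)

Section Final.
Variables (k : closedFieldType) (n u : nat).
Local Notation t := u.+1.
Local Notation R := {mpoly k[n]}.
Variables (a : 'I_t.+2 -> int) (b : 'I_t -> int) (phi : 'M[R]_(t.+2, t)).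
Local Notation Om := (Om phi).
Local Notation I := (inI phi).
Variables (half : R) (halfP : half + half = 1).
Hypothesis half_homog : homogz 0 half.
Hypothesis hphi : forall j i, homogz (a j - b i) (phi j i).
Hypothesis mphi : minimal_mx phi.

Definition Index2 := ('I_t * 'I_t + 'I_t.+2 * 'I_t.+2)%type.
Definition Index3 := ('I_t * 'I_t.+2 + 'I_t.+2 * 'I_t.+2)%type.
Definition index2_full : seq Index2 := map inl (allp t t) ++ map inr (allp t.+2 t.+2).
Definition index2 : seq Index2 := behead index2_full.
Definition index3 : seq Index3 := map inl (allp t t.+2) ++ map inr (symp t.+2).

Definition twist1 (x : 'I_t.+2 * 'I_t) : int := a x.1 - b x.2.
Definition twist2 (x : Index2) : int :=
  match x with inl y => b y.1 - b y.2 | inr y => a y.1 - a y.2 end.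
Definition twist3 (x : Index3) : int :=
  match x with inl y => b y.1 - a y.2 | inr y => a y.1 + a y.2 - ell a b end.
Definition twist4 (x : 'I_t.+2 * 'I_t) : int := a x.1 + b x.2 - ell a b.
Definition twist5 (x : 'I_t * 'I_t) : int := b x.1 + b x.2 - ell a b.

Lemma index2_fullE : index2_full = inl (ord0, ord0) :: index2.
Proof. by rewrite /index2 /index2_full /allp enum_ordSl. Qed.

Lemma tw1E : tw1 a b = map twist1 (allp t.+2 t).
Proof. by rewrite map_allpairs. Qed.
(** The first entry of the full list has twist b 0 - b 0 = 0, so [rem 0] deletes exactly the head,
    as [behead] does. *)
Lemma tw2E : tw2 a b = map twist2 index2.
Proof.
have e : map twist2 index2_full = [seq b i - b i' | i <- enum 'I_t, i' <- enum 'I_t]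
         ++ [seq a j - a j' | j <- enum 'I_t.+2, j' <- enum 'I_t.+2].
  by rewrite /index2_full map_cat; congr (_ ++ _); rewrite -[LHS]map_comp /allp map_allpairs.
by rewrite /tw2 -e index2_fullE /= subrr eqxx.
Qed.
Lemma tw3E : tw3 a b = map twist3 index3.
Proof.
rewrite /index3 map_cat; congr (_ ++ _); rewrite -[RHS]map_comp.
  by rewrite /allp map_allpairs.
by rewrite /symp map_allpairs.
Qed.
Lemma tw4E : tw4 a b = map twist4 (allp t.+2 t).
Proof. by rewrite map_allpairs. Qed.
Lemma tw5E : tw5 a b = map twist5 (altp t).
Proof. by rewrite /altp map_allpairs. Qed.

Lemma sum_uniq (T T' : eqType) (s : seq T) (s' : seq T') :
  uniq s -> uniq s' -> uniq (map inl s ++ map inr s' : seq (T + T')).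
Proof.
move=> us us'; rewrite cat_uniq !map_inj_uniq //; try by move=> x y [].
rewrite us us' andbT /=; apply/hasPn => _ /mapP[y _ ->].
by apply/mapP => -[].
Qed.

Lemma mem_inl (T T' : eqType) (s : seq T) (s' : seq T') x :
  (inl x \in (map inl s ++ map inr s' : seq (T + T'))) = (x \in s).
Proof.
rewrite mem_cat mem_map; last by move=> y z [].
by rewrite orbC; case: mapP => // -[].
Qed.
Lemma mem_inr (T T' : eqType) (s : seq T) (s' : seq T') x :
  (inr x \in (map inl s ++ map inr s' : seq (T + T'))) = (x \in s').
Proof.
rewrite mem_cat orbC mem_map; last by move=> y z [].
by rewrite orbC; case: mapP => // -[].
Qed.

Lemma index2_uniq : uniq index2.
Proof.
have : uniq index2_full by apply: sum_uniq; apply: allp_uniq.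
by rewrite index2_fullE => /andP[].
Qed.
Lemma mem_index2 x : (x \in index2) = (x != inl (ord0, ord0)).
Proof.
have : uniq index2_full by apply: sum_uniq; apply: allp_uniq.
have : x \in index2_full by case: x => x; rewrite ?mem_inl ?mem_inr mem_allp.
rewrite index2_fullE inE cons_uniq => /orP[/eqP->|xs] /andP[h _]; first by rewrite eqxx (negPf h).
by rewrite xs; apply/esym; apply: contraNneq h => <-.
Qed.
Lemma index3_uniq : uniq index3.
Proof. by apply: sum_uniq; [apply: allp_uniq|apply: symp_uniq]. Qed.

Definition coord1 := @fullC R _ _ ord0 ord0 _ (size_map twist1 (allp t.+2 t)).
Definition coord4 := @fullC R _ _ ord0 ord0 _ (size_map twist4 (allp t.+2 t)).
Definition coord5 := altC (ord0 : 'I_t) (dbl0 halfP) (size_map twist5 (altp t)).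

Definition entry2 (v : 'M[R]_t * 'M[R]_t.+2) (x : Index2) : R :=
  match x with inl y => v.1 y.1 y.2 | inr y => v.2 y.1 y.2 end.
Definition entry3 (v : 'M[R]_(t, t.+2) * 'M[R]_t.+2) (x : Index3) : R :=
  match x with inl y => v.1 y.1 y.2 | inr y => v.2 y.1 y.2 end.

Definition coord2 : coords ('M[R]_t * 'M[R]_t.+2)%type (size (map twist2 index2)).
Proof.
refine (@Coords _ _ _ (fun v : 'M[R]_t * 'M[R]_t.+2 => v.1 ord0 ord0 = 0)
  (fun z => (\matrix_(i, j) ldec index2 z (inl (i, j)), \matrix_(i, j) ldec index2 z (inr (i, j))))
  (fun v => lenc index2 (inl (ord0, ord0)) _ (entry2 v)) _ _ _ _ _).
- by move=> x y z; congr pair; apply/matrixP=> i j; rewrite !mxE ldecP.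
- by move=> x y z; apply: lencP => -[] w; rewrite /= !mxE.
- move=> z; apply: ldecK; [exact: index2_uniq|exact: size_map|].
  by case=> -[i j] _; rewrite /= mxE.
- move=> [A D] /= A0; congr pair; apply/matrixP=> i j; rewrite mxE.
    have [e|ne] := eqVneq (inl (i, j) : Index2) (inl (ord0, ord0)).
      rewrite ldec_out ?mem_index2 ?e ?eqxx ?size_map //.
      by case: e => -> ->; rewrite A0.
    by rewrite lencK ?index2_uniq ?size_map ?mem_index2.
  by rewrite lencK ?index2_uniq ?size_map ?mem_index2.
- by move=> z; rewrite /= mxE ldec_out ?mem_index2 ?eqxx ?size_map.
Defined.

Definition coord3 : coords ('M[R]_(t, t.+2) * 'M[R]_t.+2)%type (size (map twist3 index3)).
Proof.
refine (@Coords _ _ _ (fun v : 'M[R]_(t, t.+2) * 'M[R]_t.+2 => v.2^T = v.2)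
  (fun z => (\matrix_(i, j) ldec index3 z (inl (i, j)), symof (fun x => ldec index3 z (inr x))))
  (fun v => lenc index3 (inl (ord0, ord0)) _ (entry3 v)) _ _ _ _ _).
- by move=> x y z; congr pair; apply/matrixP=> i j; rewrite !mxE ldecP.
- by move=> x y z; apply: lencP => -[] w; rewrite /= !mxE.
- move=> z; apply: ldecK; [exact: index3_uniq|exact: size_map|].
  case=> -[i j]; first by rewrite /= mxE.
  by rewrite mem_inr mem_symp /= mxE => ->.
- move=> [A S] /= sS; congr pair; apply/matrixP=> i j; rewrite mxE.
    by rewrite lencK ?index3_uniq ?size_map // mem_inl mem_allp.
  rewrite lencK ?index3_uniq ?size_map //=; last first.
    by rewrite mem_inr; case: leqP => h; rewrite mem_symp // ltnW.
  by case: leqP => //= _; rewrite -{1}sS mxE.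
- move=> z; apply/matrixP=> i j; rewrite !mxE; case: ltngtP => // h.
  by rewrite (val_inj h).
Defined.

Definition diff2 (v : 'M[R]_t * 'M[R]_t.+2) : 'M[R]_(t.+2, t) := phi *m v.1 - v.2 *m phi.
(* The class of [v] modulo (id_F, id_G) has a unique representative whose End(F)-component
   vanishes at (0, 0); [tw2] drops the twist of that entry. *)
Definition mod_id (v : 'M[R]_t * 'M[R]_t.+2) : 'M[R]_t * 'M[R]_t.+2 :=
  (v.1 - (v.1 ord0 ord0)%:M, v.2 - (v.1 ord0 ord0)%:M).
Definition diff3 (v : 'M[R]_(t, t.+2) * 'M[R]_t.+2) : 'M[R]_t * 'M[R]_t.+2 :=
  mod_id (v.1 *m phi, phi *m v.1 + v.2 *m Om).
Definition diff4 (W : 'M[R]_(t.+2, t)) : 'M[R]_(t, t.+2) * 'M[R]_t.+2 :=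
  (- (W^T *m Om), W *m phi^T + phi *m W^T).
Definition diff5 (Y : 'M[R]_t) : 'M[R]_(t.+2, t) := phi *m Y.

Lemma lin_diff2 : linear diff2.
Proof.
move=> x v w; rewrite /diff2 /= mulmxDr mulmxDl -scalemxAr -scalemxAl scalerBr.
by rewrite opprD addrACA.
Qed.
Lemma lin_mod_id : linear mod_id.
Proof.
move=> x v w; rewrite /mod_id /=; congr pair; rewrite !mxE raddfD /= -scale_scalar_mx.
all: by rewrite scalerBr opprD addrACA.
Qed.
Lemma lin_diff3 : linear diff3.
Proof.
move=> x v w; rewrite /diff3 -lin_mod_id; congr mod_id; congr pair => /=.
  by rewrite mulmxDl -scalemxAl.
by rewrite mulmxDr mulmxDl -scalemxAr -scalemxAl scalerDr addrACA.
Qed.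
Lemma lin_diff4 : linear diff4.
Proof.
move=> x v w; rewrite /diff4 [(x *: v + w)^T]linearP /=; congr pair.
  by rewrite mulmxDl -scalemxAl opprD -scalerN.
by rewrite mulmxDl mulmxDr -scalemxAl -scalemxAr addrACA -scalerDr.
Qed.
Lemma lin_diff5 : linear diff5.
Proof. by move=> x v w; rewrite /diff5 mulmxDr -scalemxAr. Qed.

Definition d2 := lin_mx_of coord2 coord1 diff2.
Definition d3 := lin_mx_of coord3 coord2 diff3.
Definition d4 := lin_mx_of coord4 coord3 diff4.
Definition d5 := lin_mx_of coord5 coord4 diff5.

Lemma hdelta (T : eqType) (s : seq T) (w : T -> int) x0 (us : uniq s)
   (l : 'I_(size (map w s))) x :
  homogz (w x - w (nth x0 s l)) (ldec s (delta_mx l 0) x : R).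
Proof.
rewrite (ldec_delta R x0 us (size_map w s)); apply: homogz_bool => /eqP->; exact: subrr.
Qed.

Let hOm := homogz_Om hphi.

Lemma twN (T : eqType) (s : seq T) (w : T -> int) x0 (l : 'I_(size (map w s))) :
  (map w s)`_l = w (nth x0 s l).
Proof. by rewrite (nth_map x0) // -(size_map w). Qed.

Lemma graded_d2 : graded_mx d2.
Proof.
move=> l j; rewrite (twN (ord0, ord0)) (twN (inl (ord0, ord0))) lin_mx_ofE /= mxE.
set wj := twist2 _; case: (nth _ _ l) => x y; rewrite /twist1 /diff2 [X in homogz _ X]mxE [in X in homogz _ (_ + X)]mxE /=.
apply: homogzB.
  apply: (homogz_mul (DA := fun j i => a j - b i) (DB := fun i i' => b i - b i' - wj)
    (D := fun j i => a j - b i - wj)) => // [i i'|*]; last by ring.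
  by rewrite mxE; apply: (@hdelta _ _ twist2 _ index2_uniq _ (inl (i, i'))).
apply: (homogz_mul (DA := fun j j' => a j - a j' - wj) (DB := fun j i => a j - b i)
    (D := fun j i => a j - b i - wj)) => // [i i'|*]; last by ring.
by rewrite mxE; apply: (@hdelta _ _ twist2 _ index2_uniq _ (inr (i, i'))).
Qed.

Lemma graded_d3 : graded_mx d3.
Proof.
move=> l j; rewrite (twN (inl (ord0, ord0))) (twN (inl (ord0, ord0))) lin_mx_ofE.
set z := dec coord3 _; rewrite /= mxE; set wj := twist3 _.
have hZ i i' : homogz (b i - a i' - wj) (z.1 i i').
  by rewrite /z mxE; apply: (@hdelta _ _ twist3 _ index3_uniq _ (inl (i, i'))).
have hS i i' : homogz (a i + a i' - ell a b - wj) (z.2 i i').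
  rewrite /z mxE; have -> : a i + a i' - ell a b
      = twist3 (inr (if (i <= i')%N then (i, i') else (i', i))).
    by case: ifP => _ //=; ring.
  exact: (@hdelta _ _ twist3 _ index3_uniq _ (inr _)).
have hA i i' : homogz (b i - b i' - wj) ((z.1 *m phi) i i').
  apply: (homogz_mul (DA := fun j i => b j - a i - wj) (DB := fun j i => a j - b i)
    (D := fun j i => b j - b i - wj)) => // *; by ring.
have hD i i' : homogz (a i - a i' - wj) ((phi *m z.1 + z.2 *m Om) i i').
  rewrite mxE; apply: homogzD.
    apply: (homogz_mul (DA := fun j i => a j - b i) (DB := fun j i => b j - a i - wj)
      (D := fun j i => a j - a i - wj)) => // *; by ring.
  apply: (homogz_mul (DA := fun j i => a j + a i - ell a b - wj)
    (DB := fun j i => ell a b - a j - a i) (D := fun j i => a j - a i - wj)) => // *; by ring.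
have hc m (i i' : 'I_m) d : (i = i' -> d = - wj) ->
    homogz d (((z.1 *m phi) ord0 ord0)%:M i i').
  rewrite [X in homogz _ X]mxE; case: eqVneq => [-> /(_ erefl)->|_ _]; last exact: homogz0.
  by rewrite mulr1n; have := hA ord0 ord0; rewrite subrr add0r.
rewrite /diff3 /mod_id /entry2; case: (nth _ _ l) => -[x y] /=; rewrite [X in homogz _ X]mxE [in X in homogz _ (_ + X)]mxE.
  by apply: homogzB; [exact: hA|apply: hc => ->; rewrite subrr add0r].
by apply: homogzB; [exact: hD|apply: hc => ->; rewrite subrr add0r].
Qed.

Lemma graded_d4 : graded_mx d4.
Proof.
move=> l j; rewrite (twN (inl (ord0, ord0))) (twN (ord0, ord0)) lin_mx_ofE.
set z := dec coord4 _; rewrite /= mxE; set wj := twist4 _.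
have hz i i' : homogz (a i + b i' - ell a b - wj) (z i i').
  by rewrite /z mxE; apply: (@hdelta _ _ twist4 _ (allp_uniq _ _) _ (i, i')).
have hzT i i' : homogz (b i + a i' - ell a b - wj) (z^T i i').
  by rewrite mxE [b i + _]addrC.
rewrite /diff4 /entry3; case: (nth _ _ l) => -[x y] /=; rewrite [X in homogz _ X]mxE.
  apply: homogzN; apply: (homogz_mul (DA := fun j i => b j + a i - ell a b - wj)
    (DB := fun j i => ell a b - a j - a i) (D := fun j i => b j - a i - wj)) => // *; by ring.
apply: homogzD.
  apply: (homogz_mul (DA := fun j i => a j + b i - ell a b - wj)
    (DB := fun j i => a i - b j) (D := fun j i => a j + a i - ell a b - wj)) => // [i i'|*].
    by rewrite mxE.
  by ring.
apply: (homogz_mul (DA := fun j i => a j - b i)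
    (DB := fun j i => b j + a i - ell a b - wj) (D := fun j i => a j + a i - ell a b - wj)) => // *.
by ring.
Qed.

Lemma graded_d5 : graded_mx d5.
Proof.
move=> l j; rewrite (twN (ord0, ord0)) (twN (ord0, ord0)) lin_mx_ofE.
set z := dec coord5 _; rewrite /= mxE; set wj := twist5 _.
have hz i i' : homogz (b i + b i' - ell a b - wj) (z i i').
  rewrite /z mxE; case: ifP => _; first exact: (@hdelta _ _ twist5 _ (altp_uniq _) _ (i, i')).
  case: ifP => _; last exact: homogz0.
  apply: homogzN; rewrite [b i + _]addrC; exact: (@hdelta _ _ twist5 _ (altp_uniq _) _ (i', i)).
case: (nth _ _ l) => x y; rewrite /diff5 /twist4 /=.
apply: (homogz_mul (DA := fun j i => a j - b i)
    (DB := fun j i => b j + b i - ell a b - wj) (D := fun j i => a j + b i - ell a b - wj)) => // *.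
by ring.
Qed.

Let mOm : inmx (@in_max_ideal k n) Om.
Proof. by move=> i j; apply: (minimal_inI _ mphi) => //; apply: inI_Om. Qed.
Let iM := ideal_max k n.

Lemma minimal_d2 : minimal_mx d2.
Proof.
move=> l j; rewrite lin_mx_ofE mxE.
by apply: (inmxB iM); [exact: (inmxMr iM _ mphi)|exact: (inmxMl iM _ mphi)].
Qed.

Lemma minimal_d3 : minimal_mx d3.
Proof.
move=> l j; rewrite lin_mx_ofE mxE /diff3 /mod_id /entry2; move: (dec coord3 _) => z.
have h1 : inmx (@in_max_ideal k n) (z.1 *m phi) by apply: inmxMl.
have hc m : inmx (@in_max_ideal k n) (((z.1 *m phi) ord0 ord0)%:M : 'M_m).
  move=> x y; rewrite mxE; case: eqP => _; [exact: h1|exact: ideal0].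
case: (nth _ _ l) => -[x y]; apply: (inmxB iM) => //.
by apply: (inmxD iM); [exact: (inmxMr iM _ mphi)|exact: (inmxMl iM _ mOm)].
Qed.

Lemma minimal_d4 : minimal_mx d4.
Proof.
move=> l j; rewrite lin_mx_ofE mxE /diff4 /entry3; move: (dec coord4 _) => z.
case: (nth _ _ l) => -[x y].
  by apply: (inmxN iM); exact: (inmxMl iM _ mOm).
apply: (inmxD iM); first by apply: (inmxMl iM); apply: inmxT.
exact: (inmxMr iM _ mphi).
Qed.

Lemma minimal_d5 : minimal_mx d5.
Proof. by move=> l j; rewrite lin_mx_ofE mxE; exact: (inmxMr iM _ mphi). Qed.

Hypothesis phi_inj : forall m (v : 'M_(t, m)), phi *m v = 0 -> v = 0.
Hypothesis Om_exact : forall m (g : 'M_(t.+2, m)), Om *m g = 0 -> exists w, g = phi *m w.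
Hypothesis trphi_exact : forall m (g : 'M_(t.+2, m)), phi^T *m g = 0 -> exists w, g = Om *m w.

Lemma d5_inj (v : 'cV_(_)) : d5 *m v = 0 -> v = 0.
Proof.
move=> h; have e := phi_inj (lin_mx_of_eq0 (c := coord5) (c' := coord4) lin_diff5 (fun _ _ => Logic.I) h).
have {}e : dec coord5 v = 0 := e.
by rewrite -[v](decK coord5) e (linear_f0 (@enc_lin _ _ _ coord5)).
Qed.

Lemma d4_exact (v : 'cV_(_)) : d4 *m v = 0 <-> exists w : 'cV_(_), v = d5 *m w.
Proof.
apply: lin_mx_exact lin_diff4 lin_diff5 _ _ _ _ v => //=.
- by move=> W _; rewrite linearD /= !trmx_mul !trmxK addrC.
- move=> Y aY; rewrite /diff4 /diff5 trmx_mul aY; congr pair.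
    by rewrite -mulmxA trphi_Om mulmx0 oppr0.
  by rewrite mulNmx mulmxN mulmxA subrr.
- move=> W _ [/eqP]; rewrite oppr_eq0 => /eqP e1 e2.
  by have [Y aY ->] := alt_exact phi_inj Om_exact e1 e2; exists Y.
Qed.

Lemma d3_exact (v : 'cV_(_)) : d3 *m v = 0 <-> exists w : 'cV_(_), v = d4 *m w.
Proof.
apply: lin_mx_exact lin_diff3 lin_diff4 _ _ _ _ v => //=.
- by move=> [Z S] _; rewrite /diff3 /mod_id /= !mxE mulr1n subrr.
- by move=> W _; rewrite linearD /= !trmx_mul !trmxK addrC.
- move=> W _; rewrite /diff3 /diff4 /= mulNmx -mulmxA Om_phi mulmx0 oppr0 mulmxDl.
  rewrite -(mulmxA W) trphi_Om mulmx0 add0r -(mulmxA phi) mulmxN addNr.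
  exact: (linear_f0 lin_mod_id).
- move=> [Z S] /= sS [/eqP + /eqP]; rewrite !subr_eq0 => /eqP e1 /eqP e2.
  have [W eZ eS] := end_exact halfP phi_inj Om_exact trphi_exact sS e1 e2.
  by exists W => //; rewrite /diff4 -eZ -eS.
Qed.

Lemma diff2_mod_id v : diff2 (mod_id v) = diff2 v.
Proof.
rewrite /diff2 /mod_id /= mulmxBr mulmxBl mul_mx_scalar mul_scalar_mx opprB addrA.
by rewrite subrK.
Qed.

Lemma d2_exact (v : 'cV_(_)) : (forall A D, phi *m A = D *m phi ->
    exists Z S c, [/\ S^T = S, A = Z *m phi + c%:M & D = phi *m Z + S *m Om + c%:M]) ->
  d2 *m v = 0 <-> exists w : 'cV_(_), v = d3 *m w.
Proof.
move=> ex2; apply: lin_mx_exact lin_diff2 lin_diff3 _ _ _ _ v => //=.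
- by move=> [Z S] _; rewrite /diff3 /mod_id /= !mxE mulr1n subrr.
- move=> [Z S] sS; rewrite /diff3 diff2_mod_id /diff2 /= mulmxDl -!mulmxA Om_phi mulmx0 addr0.
  by rewrite subrr.
- move=> [A D] /= A0 /eqP; rewrite subr_eq0 => /eqP /ex2[Z [S [c [sS eA eD]]]].
  rewrite /= in eA eD; exists (Z, S) => //; rewrite /diff3 /mod_id /=.
  (* The normalization of A at (0, 0) determines c, so [mod_id] adds back exactly the scalar c. *)
  have ec : (Z *m phi) ord0 ord0 = - c.
    by apply/eqP; rewrite -addr_eq0; move: A0; rewrite eA !mxE eqxx mulr1n => ->.
  by rewrite ec !raddfN /= !opprK -eA -eD.
Qed.

Definition eps (v : 'cV[R]_(size (map twist1 (allp t.+2 t)))) : R -> R := epsf half phi (dec coord1 v).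

Lemma epsD v w p : I p -> I (eps (v + w) p - (eps v p + eps w p)).
Proof.
move=> Ip; rewrite /eps -[v]scale1r (dec_lin coord1) /epsf epslPr scale1r mul1r subrr.
exact: (ideal0 (ideal_inI phi)).
Qed.

Lemma epsZ r v p : I p -> I (eps (r *: v) p - r * eps v p).
Proof.
move=> Ip; rewrite /eps -[r *: v]addr0 (dec_lin coord1) (linear_f0 (@dec_lin _ _ _ coord1)).
rewrite addr0 -[r *: dec coord1 v]addr0 /epsf epslPr /epsl mulmx0 mxtrace0 addr0 subrr.
exact: (ideal0 (ideal_inI phi)).
Qed.

Lemma eps_ker : (forall X, (forall x, I x -> I (epsf half phi X x)) <-> NC phi [::] X) ->
  forall v, (forall p, I p -> I (eps v p)) <-> exists w : 'cV_(_), v = d2 *m w.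
Proof.
move=> hk v; apply: iff_trans (hk _) _; apply: iff_trans (NC0E _ _) _.
split=> [[A [D e]]|[w ->]].
  exists (enc coord2 (mod_id (A, D))); rewrite mul_lin_mx_of; last exact: lin_diff2.
  have m2 : cmem coord2 (mod_id (A, D)) by rewrite /= !mxE mulr1n subrr.
  by rewrite (encK m2) diff2_mod_id -[diff2 _]e decK.
exists (dec coord2 w).1, (dec coord2 w).2; rewrite mul_lin_mx_of; last exact: lin_diff2.
by rewrite encK.
Qed.

Lemma eps_onto f : (exists X, forall x, I x -> I (epsf half phi X x - f x)) ->
  exists v, forall p, I p -> I (eps v p - f p).
Proof. by case=> X h; exists (enc coord1 X) => p Ip; rewrite /eps encK //; apply: h. Qed.

(** For p of degree e, the presenting matrix is replaced by the homogeneous components of its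
    entries in the degrees complementary to those of [Om]. The result still presents p, since p is
    its own component of degree e, and its derivative along a vector of degree d is homogeneous of
    degree e + d. *)
Lemma eps_homog (d : int) v : homog_vec d v -> homog_hom I d (eps v).
Proof.
move=> hv e p Ip hp; have [K aK ep] := inI_alt halfP Ip.
have hX j i : homogz (d + (a j - b i)) (dec coord1 v j i).
  rewrite /= mxE; have h : (index (j, i) (allp t.+2 t) < size (map twist1 (allp t.+2 t)))%N.
    by rewrite size_map index_mem mem_allp.
  have := hv (Ordinal h); rewrite (twN (ord0, ord0)) /= nth_index ?mem_allp //.
  by rewrite /ldec insubT.
pose L := \matrix_(j, l) hcomp (e%:Z - (ell a b - a j - a l)) (K j l) : 'M[R]_t.+2.
have aL : L^T = - L.
  apply/matrixP=> j l; rewrite !mxE -hcompN; congr hcomp; first by ring.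
  by have /matrixP/(_ j l) := aK; rewrite !mxE.
have eL : p = om half phi L.
  transitivity (hcomp (e%:Z + 0) (\tr (K *m Om) * half)).
    by rewrite addr0 [_ * half]mulrC -/(om half phi K) -ep (hcomp_id hp).
  rewrite (hcompM _ _ half_homog) [LHS]mulrC; congr (half * _).
  rewrite hcomp_sum; apply: eq_bigr => j _; rewrite !mxE hcomp_sum; apply: eq_bigr => l _.
  have -> : Posz e = e%:Z - (ell a b - a j - a l) + (ell a b - a l - a j) by ring.
  by rewrite hcompM; [rewrite [L j l]mxE; congr (hcomp _ _ * _); ring|exact: hOm].
exists (epsl half phi L (dec coord1 v)); split; last first.
  by rewrite {1}eL; apply: epsfE.
rewrite epslE; apply: homogz_sum => j _; apply: homogz_sum => l _.
have -> : e%:Z + d = 0 + (e%:Z - (ell a b - a j - a l)) + (ell a b - a l - a j + d) by ring.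
apply: homogzM; first by apply: homogzM => //; rewrite mxE; apply: hcompP.
apply: homogz_sum => i _.
have := @homogz_mul k n _ _ _ (bordered_adj (ev R l) (ev R j) phi) (dec coord1 v)
  (fun i m => ell a b - a l - a j - a m + b i) (fun m i => d + (a m - b i))
  (fun i i' => ell a b - a l - a j + d + b i - b i') (homogz_bpsi hphi l j) hX _ i i.
by rewrite addrK; apply=> *; ring.
Qed.
End Final.

Theorem theorem4p9 (k : closedFieldType) (hk : [pchar k] =i pred0)
  (n t : nat) (ht : (0 < t)%N)
  (a : 'I_t.+2 -> int) (b : 'I_t -> int)
  (phi : 'M[{mpoly k[n.+1]}]_(t.+2, t))
  (phi_graded : forall j i, homogz (a j - b i) (phi j i))
  (phi_minimal : minimal_mx phi)
  (std_det : depth_eq (minor_ideal phi t) (@zero_ideal _) 3)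
  (hdepth : depth_ge (minor_ideal phi t.-1) (minor_ideal phi t) 4) :
  normal_module_min_res (minor_ideal phi t)
    (tw1 a b) (tw2 a b) (tw3 a b) (tw4 a b) (tw5 a b).
Proof.
case: t ht a b phi phi_graded phi_minimal std_det hdepth => // u _ a b phi hphi mphi.
rewrite minor_idealE.
move=> [[xs [sx [Jx /regular_seq_chain cx]]] _] [ys [sy [Jy /regular_seq_chain cy]]].
pose half : {mpoly k[n.+1]} := (2%:R^-1) *: 1.
have halfP : half + half = 1.
  rewrite /half -scalerDl -[X in _ *: X]mul1r; have n2 : 2%:R != 0 :> k.
    by have /GRing.pcharf0P -> := hk.
  by rewrite -mulr2n -[_ *+ 2]mulr_natl divff // scale1r mul1r.
have half_homog : homogz 0 half by apply/(@homogzZ _ _ 0)/dhomog1.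
case: xs sx Jx cx => [|x1 [|x2 [|x3 [|? ?]]]] //= _ Jx [r1 [r2 [r3 _]]].
have [I1 I2 I3] : [/\ inI phi x1, inI phi x2 & inI phi x3].
  by split; [exact: (Jx 0%N)|exact: (Jx 1%N)|exact: (Jx 2%N)].
have iZ := ideal_zero {mpoly k[n.+1]}.
(* Injectivity of phi takes one element of the regular sequence in I_t, and each further place of
   the Buchsbaum-Rim complex one more. *)
have phi_inj m (v : 'M_(u.+1, m)) : phi *m v = 0 -> v = 0.
  move=> e; apply/inmx_zero; apply: (phi_inj_mod halfP iZ I1 r1).
  exact/inmx_zero.
have Om_exact m (g : 'M_(u.+3, m)) : Om phi *m g = 0 -> exists w, g = phi *m w.
  move=> e; have [|w /inmx_zero/eqP] := Om_exact_mod halfP iZ I1 r1 I2 r2 (g := g).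
    exact/inmx_zero.
  by rewrite subr_eq0 => /eqP; exists w.
have trphi_exact m (g : 'M_(u.+3, m)) : phi^T *m g = 0 -> exists w, g = Om phi *m w.
  move=> e; have [|w /inmx_zero/eqP] := trphi_exact_mod halfP iZ I1 r1 I2 r2 I3 r3 (g := g).
    exact/inmx_zero.
  by rewrite subr_eq0 => /eqP; exists w.
have gJ x : minor_ideal phi u x -> gens (sgx phi) x.
  case=> c ->; have iG : ideal (gens (sgx phi)).
    exact: (ideal_gen (sgx phi)).
  by apply: ideal_sum => // -[f g] _; apply: idealM => //; apply: minor_gens.
case: ys sy Jy cy => [|y1 [|y2 [|y3 [|y4 [|? ?]]]]] //= _ Jy cy.
have gy i : (i < 4)%N -> gens (sgx phi) [:: y1; y2; y3; y4]`_i by move=> /Jy; apply: gJ.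
have [M1 [M2 [M3 _]]] := mchain_NM halfP ord0 phi_inj Om_exact trphi_exact (ys := [:: y1; y2; y3; y4]) cy.
have [R1 [R2 [R3 [R4 _]]]] := cy.
have g1 : gens (sgx phi) y1 := gy 0%N isT.
have g2 : gens (sgx phi) y2 := gy 1%N isT.
have g3 : gens (sgx phi) y3 := gy 2%N isT.
have g4 : gens (sgx phi) y4 := gy 3%N isT.
(* Level 0 gives exactness at the last interior place of the resolution; levels 1 and 2 make y1, and
   y2 modulo y1, regular on coker(phi) (x) M. *)
have h0 F := end_homothety halfP (ys := [::]) g1 R1 M1 (F := F) g2 R2.
have h1 F := end_homothety halfP (ys := [:: y1]) g2 R2 M2 (F := F) g3 R3.
have h2 F := end_homothety halfP (ys := [:: y1; y2]) g3 R3 M3 (F := F) g4 R4.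
have n1 : forall X, NC phi [::] (y1 *: X) -> NC phi [::] X := mreg_NC (ys := [::]) M1 h1.
have n2 : forall X, NC phi [:: y1] (y2 *: X) -> NC phi [:: y1] X := mreg_NC (ys := [:: y1]) M2 h2.
have ker := epsf_ker halfP phi_inj Om_exact trphi_exact g1 n1.
rewrite tw1E tw2E tw3E tw4E tw5E.
exists (d2 a b phi), (d3 a b phi), (d4 a b phi), (d5 a b phi halfP), (@eps k n.+1 u a b phi half).
split; first by split; [exact: graded_d2|exact: graded_d3|exact: graded_d4|exact: graded_d5].
split; first by split; [exact: minimal_d2|exact: minimal_d3|exact: minimal_d4|exact: minimal_d5].
split; first by move=> v; apply: d5_inj.
split; first by move=> v; apply: d4_exact.
split; first by move=> v; apply: (d3_exact halfP).
split.
  move=> v; apply: d2_exact => A D e.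
  exact: (end_exact2 halfP trphi_exact e h0).
split; first by move=> v; apply: (epsf_hom halfP phi_inj Om_exact trphi_exact).
split; first by move=> v w p; apply: epsD.
split; first by move=> r v p; apply: epsZ.
split; first by apply: eps_ker.
split; last by move=> d v; apply: (eps_homog halfP).
move=> f hf; apply: eps_onto.
exact: (epsf_surj halfP phi_inj g1 g2 R1 n1 n2 hf).
Qed.
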